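(* Let $W=(k'',\beta_u)$, $T$, $B$ and $A$ be as in the context, with $k''$ unramified over $k'$ and $\mu$ odd. Consider the Weil representation $S^A_\psi$ on $\mathcal{H}^A_\psi$ restricted to $T$. a) A character $\chi$ of $T$ of conductor at most $1$ occurs in $S^A_\psi$ if and only if $\chi\neq\eta_0$. In that case there exists $v\in B^*$ such that the function $$\varphi_\chi=\sum_{g\in T/T_1}\chi(g^{-1})S^A_\psi(g)\delta_v$$ is non-zero and spans the subspace of vectors of weight $\chi$ of $\mathcal{H}^A_\psi$. b) (i) A character $\chi$ of $T$ of conductor strictly greater than $1$ occurs in $S^A_\psi$ if and only if its conductor is odd. (ii) Let $\chi$ be a character of $T$ of odd conductor $2j+1>1$. Then there exists $a\in\mathcal{O}''^\times\setminus(\varpi'\mathcal{O}'+\mathcal{O}'\nu)$ such that $$\chi(t)=\psi\bigl(-\tfrac14\mathrm{tr}_{k''/k}(\varpi'^{\mu-(2j+1)}aa^\tau u\,t)\bigr)\quad\text{for all }t\in T_{j+1},$$ and the subspace of vectors of weight $\chi$ of $\mathcal{H}^A_\psi$ is spanned by $$\varphi_\chi=\sum_{g\in T/T_{j+1}}\chi(g^{-1})S^A_\psi(g)\,\delta_{\varpi'^{\frac{\mu-1}2-j}a}.$$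
   Context: $k$ is a non-archimedean local field of characteristic $0$ with ring of integers $\mathcal{O}$, uniformizer $\varpi$, residue field $\mathbb{F}_q$ of characteristic $p\neq2$; $\psi$ is a non-trivial unitary character of $(k,+)$ with conductor $\lambda_\psi$ (trivial on $\varpi^{\lambda_\psi}\mathcal{O}$, not on $\varpi^{\lambda_\psi-1}\mathcal{O}$); $\overline\psi$ is the character of $\mathbb{F}_q$ with $\overline\psi(x\bmod\varpi)=\psi(\varpi^{\lambda_\psi-1}x)$. $k'$ is an extension of $k$ of degree $r$, with ring of integers $\mathcal{O}'$, uniformizer $\varpi'$, residue field $\mathbb{F}_{q'}$; $k''$ is the unramified quadratic extension of $k'$, with ring of integers $\mathcal{O}''$, normalized valuation $v''$, and uniformizer $\varpi''=\varpi'$; $\tau$ is the non-trivial element of $\mathrm{Gal}(k''/k')$. $u\in k''^\times$ has trace $0$ over $k'$ and $v''(u)\in\{0,1\}$; $\nu\in\mathcal{O}''^\times$ is defined by $u=\varpi'^{v''(u)}\nu$. $W$ is the $k$-space $k''$ with symplectic form $\beta(x,y)=\beta_u(x,y)=\frac12\mathrm{tr}_{k''/k}(u\,x^\tau y)$; $T=\{t\in k''^\times:tt^\tau=1\}$ acts by multiplication, a maximal elliptic torus of $Sp(W)$. $e$ is the ramification index of $k'/k$, $\varpi'^\delta\mathcal{O}'$ the different of $k'/k$, $\mu=e\lambda_\psi-\delta-v''(u)$, assumed odd. $B=\varpi'^{\frac{\mu+1}2}\mathcal{O}''$. For a lattice $L$, $L^*=\{v\in W:\beta(v,b)\in\varpi^{\lambda_\psi}\mathcal{O}\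 \forall b\in L\}$; here $B^*=\varpi'^{\frac{\mu-1}2}\mathcal{O}''$ and $A=\varpi'^{\frac{\mu-1}2}(\mathcal{O}'+\mathcal{O}'\varpi'\nu)$ satisfies $A=A^*$, $B\subset A\subset B^*$. $K_B\supset T$ is the stabilizer of $B$ in $Sp(W)$. **Weil representation on $K_B$.** $\mathrm{b}^*=B^*/B$ has the $\mathbb{F}_q$-symplectic form $\varpi^{1-\lambda_\psi}\beta\bmod\varpi$ and dimension $2l$; $\mathrm{x}=A/B$ is a Lagrangian; for $g\in K_B$ let $\bar g$ be its image in $Sp(\mathrm{b}^* )$. Put $j(h)=l-\dim_{\mathbb F_q}(\mathrm{x}\cap h\mathrm{x})$ for $h\in Sp(\mathrm b^* )$, $\omega(a)=q^{-1/2}\sum_{t\in\mathbb{F}_q}\overline\psi(\frac12at^2)$ for $a\in\mathbb F_q^\times$ (depends only on $a$ mod squares), and let $\theta:Sp(\mathrm{b}^* )\to\mathbb{F}_q^\times/(\mathbb{F}_q^\times)^2$ be the function with $\theta(p_1hp_2)=\theta(p_1)\theta(h)\theta(p_2)$ for $p_1,p_2$ in the stabilizer $P$ of $\mathrm{x}$, $\theta(p)=\det(p_{|\mathrm{x}})$ for $p\in P$, and $\theta(\tau_S)=1$ for $S\subset\{1,\dots,l\}$, where, for a symplectic basis $(\epsilon_i,\phi_i)$ of $\mathrm b^*$ with the $\epsilon_i$ spanning $\mathrm{x}$, $\tau_S\epsilon_i=\phi_i$, $\tau_S\phi_i=-\epsilon_i$ for $i\in S$ and $\tau_S$ fixes the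 other basis vectors. Put $m(h)=\omega(\theta(h))^{-1}\omega(1)^{1-j(h)}$. $\mathcal{H}^A_\psi$ is the Hilbert space of functions $\varphi:W\to\mathbb{C}$ with $\varphi(a+w)=\psi(\frac12\beta(w,a))\varphi(w)$ ($a\in A$), $\int_{W/A}|\varphi|^2<\infty$ (lattice model of the Weil representation). $K_B$ is lifted to the metaplectic group $Mp(W)$ by the section for which the Weil representation restricted to $K_B$ is $$S^A_\psi(g)\varphi(w)=m(\bar g)q^{j(\bar g)/2}[A:A\cap gA]^{-1}\sum_{a\in A/(A\cap gA)}\psi(\tfrac12\beta(a,w))\varphi(g^{-1}(a+w)).$$ For $v\in W$, $\delta_v\in\mathcal{H}^A_\psi$ is supported on $v+A$ with $\delta_v(w)=\psi(\frac12\beta(v,w-v))$ there. **Characters of $T$.** $T_j=\{g\in T:g-1\in\varpi'^j\mathcal{O}''\}$ for $j\in\mathbb{N}$; the conductor of a character $\chi$ of $T$ is the smallest integer $\lambda\ge0$ with $T_\lambda\subset\ker\chi$. Every $g\in T$ can be written $g=z(z^{-1})^\tau$ with $z\in\mathcal{O}''^\times$, and $\eta_0(g)=\left(\frac{zz^\tau\bmod\varpi'}{q'}\right)$ (quadratic character of $\mathbb{F}_{q'}^\times$) is a well-defined character of $T$ of conductor $1$. A vector of weight $\chi$ is a $\varphi$ with $S^A_\psi(g)\varphi=\chi(g)\varphi$ for $g\in T$; $\chi$ occurs if such a $\varphi\ne0$ exists. *)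

(* Defs.v *)
From HB Require Import structures.
From mathcomp Require Import all_boot all_order all_algebra all_field.
From mathcomp Require Import finmap complex.
From mathcomp Require Import all_classical all_reals all_analysis.

Set Implicit Arguments.
Unset Strict Implicit.
Unset Printing Implicit Defensive.

Import Order.TTheory GRing.Theory Num.Theory.
Local Open Scope classical_set_scope.
Local Open Scope ring_scope.

(* [v 0] carries no information: the valuation of 0 is [+oo], and every
   definition below treats 0 separately. *)
Record normalized_valuation (F : fieldType) (v : F -> int) : Prop := {
  valM : forall x y, x != 0 -> y != 0 -> v (x * y) = v x + v y;
  valD : forall x y, x != 0 -> y != 0 -> x + y != 0 ->
    Num.min (v x) (v y) <= v (x + y);
  val_surj : exists2 x, x != 0 & v x = 1 }.

Definition val_ge (F : fieldType) (v : F -> int) (n : int) : set F :=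
  [set x | x = 0 \/ n <= v x].

Definition integers (F : fieldType) (v : F -> int) : set F := val_ge v 0.

Definition integer_units (F : fieldType) (v : F -> int) : set F :=
  [set x | x <> 0 /\ v x = 0].

Definition uniformizer (F : fieldType) (v : F -> int) (x : F) : Prop :=
  x <> 0 /\ v x = 1.

Definition val_complete (F : fieldType) (v : F -> int) : Prop :=
  forall s : nat -> F,
    (forall N : int, exists n0 : nat, forall m n : nat,
       (n0 <= m)%N -> (n0 <= n)%N -> val_ge v N (s m - s n)) ->
    exists l : F, forall N : int, exists n0 : nat, forall n : nat,
       (n0 <= n)%N -> val_ge v N (s n - l).

Definition val_continuous (R : realType) (F : fieldType) (v : F -> int)
    (D : set F) (f : F -> R[i]) : Prop :=
  forall x, D x -> forall eps : R, 0 < eps ->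
    exists N : int, forall y, D y -> val_ge v N (y - x) ->
      `|f y - f x| < eps%:C%C.

(* [red], restricted to the subring [O], is a ring morphism onto [kappa] with
   kernel [m]: it presents [kappa] as [O / m]. *)
Record residue_map (F : fieldType) (kappa : finFieldType) (O m : set F)
    (red : F -> kappa) : Prop := {
  red1 : red 1 = 1;
  redD : forall x y, O x -> O y -> red (x + y) = red x + red y;
  redM : forall x y, O x -> O y -> red (x * y) = red x * red y;
  red_surj : forall a, exists2 x, O x & red x = a;
  red_ker : forall x, O x -> (red x = 0 <-> m x) }.

(* Non-archimedean local field of characteristic 0 and odd residual
   characteristic. *)
Record local_field (k : fieldType) (v : k -> int) (kappa : finFieldType)
    (red : k -> kappa) : Prop := {
  lf_val : normalized_valuation v;
  lf_complete : val_complete v;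
  lf_residue : residue_map (integers v) (val_ge v 1) red;
  lf_char0 : [pchar k] =i pred0;
  lf_odd : 2%N \notin [pchar kappa] }.

Definition field_trace (F : fieldType) (E : fieldExtType F) (x : E) : F :=
  \tr (passmx.mxof (vbasis {:E}) (vbasis {:E}) (amull x)).

Definition scaled (F : pzRingType) (c : F) (M : set F) : set F :=
  [set c * x | x in M].

Definition add_cosets (V : zmodType) (M N : set V) : set (set V) :=
  [set [set m + n | n in N] | m in M].

Definition mul_cosets (F : pzRingType) (M N : set F) : set (set F) :=
  [set [set m * n | n in N] | m in M].

Section Different.
Variables (k : fieldType) (v : k -> int) (L : fieldExtType k).
Variables (vL : L -> int) (K : {subfield L}).

Definition sub_integers : set L := [set x | x \in K /\ integers vL x].

Definition codifferent : set L :=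
  [set x | x \in K /\
     forall y, sub_integers y -> integers v (field_trace (vsproj K (x * y)))].

Definition different : set L :=
  [set x | x \in K /\ forall y, codifferent y -> sub_integers (x * y)].

End Different.

(* [k'] is the intermediate field [Kfield] of [Lfield = k''], and [k] sits in
   [Lfield] through [x |-> x%:A].  Since [varpi'] lies in [Kfield] and has
   [Lval]-valuation 1, the restriction of [Lval] to [Kfield] is the normalized
   valuation of [k'], and [k''/k'] has ramification index 1. *)
Record torus_setting (R : realType) := TorusSetting {
  kfield : fieldType;
  kval : kfield -> int;
  kappa : finFieldType;
  red : kfield -> kappa;
  k_local : local_field kval red;
  varpi : kfield;
  varpiP : uniformizer kval varpi;

  psi : kfield -> R[i];
  psiD : forall x y, psi (x + y) = psi x * psi y;
  psi_unitary : forall x, `|psi x| = 1;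
  psi_continuous : val_continuous kval setT psi;
  lam_psi : int;
  psi_trivial : forall x, integers kval x -> psi (varpi ^ lam_psi * x) = 1;
  psi_nontrivial :
    exists2 x, integers kval x & psi (varpi ^ (lam_psi - 1) * x) <> 1;

  Lfield : fieldExtType kfield;
  Kfield : {subfield Lfield};
  quadratic : \dim_Kfield {:Lfield} = 2%N;
  Lval : Lfield -> int;
  Lval_val : normalized_valuation Lval;
  ram : nat;
  ram_gt0 : (0 < ram)%N;
  Lval_ext : forall x : kfield, x != 0 -> Lval x%:A = ram%:Z * kval x;
  varpi' : Lfield;
  varpi'K : varpi' \in Kfield;
  varpi'P : uniformizer Lval varpi';
  kappa' : finFieldType;
  red' : Lfield -> kappa';
  red'P : residue_map (sub_integers Lval Kfield)
            [set x | x \in Kfield /\ val_ge Lval 1 x] red';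
  dexp : nat;
  dexpP : different kval Lval Kfield =
            scaled (varpi' ^+ dexp) (sub_integers Lval Kfield);

  tau : 'End(Lfield);
  tau_aut : kAut Kfield {:Lfield} tau;
  tau_neq1 : tau <> \1%VF;

  uelt : Lfield;
  u_neq0 : uelt <> 0;
  (* the trace to [k'], as the sum over [Gal(k''/k') = {1, tau}] *)
  u_trace0 : uelt + tau uelt = 0;
  u_val : Lval uelt = 0 \/ Lval uelt = 1 }.

Arguments kval {R} D _ : rename.
Arguments Lval {R} D _ : rename.

Section Lattices.
Variables (R : realType) (D : torus_setting R).

Local Notation L := (Lfield D).
Local Notation O := (integers (kval D)).
Local Notation O' := (sub_integers (Lval D) (Kfield D)).
Local Notation O'' := (integers (Lval D)).

Definition nu : L := uelt D / varpi' D ^ Lval D (uelt D).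

Definition mu : int := (ram D)%:Z * lam_psi D - (dexp D)%:Z - Lval D (uelt D).

Definition beta (x y : L) : kfield D :=
  2%:R^-1 * field_trace (uelt D * tau D x * y).

Definition dual_lattice (M : set L) : set L :=
  [set x | forall b, M b -> scaled (varpi D ^ lam_psi D) O (beta x b)].

Definition latB : set L := scaled (varpi' D ^ ((mu + 1) %/ 2)%Z) O''.

Definition latBs : set L := dual_lattice latB.

Definition latA : set L :=
  scaled (varpi' D ^ ((mu - 1) %/ 2)%Z)
    [set x + y * varpi' D * nu | x in O' & y in O'].

Definition torus : set L := [set t | t * tau D t = 1].

Definition torus_filtration (j : nat) : set L :=
  [set g | torus g /\ scaled (varpi' D ^+ j) O'' (g - 1)].

Record torus_character (chi : L -> R[i]) : Prop := {
  torus_charM : forall s t, torus s -> torus t -> chi (s * t) = chi s * chi t;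
  torus_char_neq0 : forall t, torus t -> chi t <> 0;
  torus_char_cont : val_continuous (Lval D) torus chi }.

Definition conductor (chi : L -> R[i]) (c : nat) : Prop :=
  (forall t, torus_filtration c t -> chi t = 1) /\
  (forall j, (forall t, torus_filtration j t -> chi t = 1) -> (c <= j)%N).

Definition quadratic_char (kap : finFieldType) (a : kap) : R[i] :=
  if a == 0 then 0 else if [exists b : kap, a == b ^+ 2] then 1 else - 1.

(* Well defined on [torus]: the value does not depend on the chosen [z]. *)
Definition eta0 (g : L) : R[i] :=
  let z := xget 1 [set z | integer_units (Lval D) z /\ g = z * tau D z^-1] in
  quadratic_char (red' (z * tau D z)).

(* The reduction of [psi], computed on any lift of [a]. *)
Definition psibar (a : kappa D) : R[i] :=
  psi (varpi D ^ (lam_psi D - 1) * xget 0 [set x | O x /\ red x = a]).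

Definition sqrtq : R[i] := ((Num.sqrt #|kappa D|%:R : R)%:C)%C.

Definition omega (a : kappa D) : R[i] :=
  sqrtq^-1 * \sum_(t : kappa D) psibar (2%:R^-1 * a * t ^+ 2).

(* [pi], restricted to [B*], presents the [kappa]-space [b] as [B*/B]. *)
Record lattice_reduction (b : vectType (kappa D)) (pi : L -> b) : Prop := {
  piD : forall x y, latBs x -> latBs y -> pi (x + y) = pi x + pi y;
  piZ : forall c x, O c -> latBs x -> pi (c *: x) = red c *: pi x;
  pi_surj : forall y, exists2 x, latBs x & pi x = y;
  pi_ker : forall x, latBs x -> (pi x = 0 <-> latB x) }.

End Lattices.

Arguments latB {R} D _.
Arguments latBs {R} D _.
Arguments latA {R} D _.
Arguments torus {R} D _.
Arguments torus_filtration {R} D j _.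

Section FiniteSymplectic.
Variables (F : finFieldType) (b : vectType F) (form : b -> b -> F).
Variable X : {vspace b}.

Definition symplectic (h : 'End(b)) : Prop :=
  forall y z, form (h y) (h z) = form y z.

Definition parabolic (h : 'End(b)) : Prop :=
  symplectic h /\ (h @: X)%VS = X.

Definition det_on (h : 'End(b)) : F :=
  \det (\matrix_(i < \dim X, j < \dim X)
          coord (vbasis X) j (h (tnth (vbasis X) i))).

Definition same_square_class (a c : F) : Prop :=
  exists2 d, d != 0 & a = c * d ^+ 2.

(* The sign [form eps_i phi_i = 1] matters: with the opposite one, requiring
   [theta tau_S = 1] does not make [weil] multiplicative. *)
Definition symplectic_basis (l : nat) (eps phi : l.-tuple b) : Prop :=
  [/\ basis_of fullv (eps ++ phi), basis_of X eps &
   forall i j : 'I_l,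
     [/\ form (tnth eps i) (tnth eps j) = 0,
         form (tnth phi i) (tnth phi j) = 0,
         form (tnth eps i) (tnth phi j) = (i == j)%:R &
         form (tnth phi j) (tnth eps i) = - (i == j)%:R]].

Definition is_tau_S (l : nat) (eps phi : l.-tuple b) (S : {set 'I_l})
    (h : 'End(b)) : Prop :=
  forall i : 'I_l,
    if i \in S then h (tnth eps i) = tnth phi i /\ h (tnth phi i) = - tnth eps i
    else h (tnth eps i) = tnth eps i /\ h (tnth phi i) = tnth phi i.

(* The map to [F^* / (F^* )^2] is given by representatives in [F^*], equalities
   being up to squares. *)
Record theta_function (theta : 'End(b) -> F) : Prop := {
  theta_neq0 : forall h, symplectic h -> theta h != 0;
  thetaM : forall p1 h p2, parabolic p1 -> symplectic h -> parabolic p2 ->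
    same_square_class (theta (p1 \o h \o p2)%VF) (theta p1 * theta h * theta p2);
  theta_parabolic : forall p, parabolic p ->
    same_square_class (theta p) (det_on p);
  theta_tau_S : exists (l : nat) (eps phi : l.-tuple b),
    symplectic_basis eps phi /\
    forall (S : {set 'I_l}) h, is_tau_S eps phi S h ->
      same_square_class (theta h) 1 }.

End FiniteSymplectic.

Definition pi_lift (R : realType) (D : torus_setting R)
    (b : vectType (kappa D)) (pi : Lfield D -> b) (y : b) : Lfield D :=
  xget 0 [set x | latBs D x /\ pi x = y].

Definition red_form (R : realType) (D : torus_setting R)
    (b : vectType (kappa D)) (pi : Lfield D -> b) (y z : b) : kappa D :=
  red (varpi D ^ (1 - lam_psi D) * beta (pi_lift pi y) (pi_lift pi z)).

Record reduction_data (R : realType) (D : torus_setting R) := ReductionData {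
  bs : vectType (kappa D);
  redB : Lfield D -> bs;
  redBP : lattice_reduction redB;
  xs : {vspace bs};
  xsP : forall y, y \in xs <-> exists2 a, latA D a & redB a = y;
  theta : 'End(bs) -> kappa D;
  thetaP : theta_function (red_form redB) xs theta }.

Arguments redB {R D} M _ : rename.

Section WeilRepresentation.
Variables (R : realType) (D : torus_setting R) (M : reduction_data D).

Local Notation L := (Lfield D).

Definition jdim (h : 'End(bs M)) : nat :=
  ((\dim {: bs M})./2 - \dim (xs M :&: h @: xs M)%VS)%N.

Definition weil_m (h : 'End(bs M)) : R[i] :=
  (omega (theta h))^-1 * omega (1 : kappa D) ^ (1 - (jdim h)%:Z).

(* The image in [Sp(B*/B)] of an element [g] of [K_B]. *)
Definition bar (g : 'End(L)) : 'End(bs M) :=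
  linfun (fun y : bs M => redB M (g (pi_lift (redB M) y))).

(* The operator [S^A_psi(g)], for [g] in [K_B]: the sum runs over
   [A / (A \cap gA)], [a] being any representative of the class [c]. *)
Definition weil (g : 'End(L)) (phi : L -> R[i]) (w : L) : R[i] :=
  let Q := add_cosets (latA D) (latA D `&` [set g x | x in latA D]) in
  weil_m (bar g) * sqrtq D ^+ jdim (bar g) * (#|` fset_set Q|)%fset%:R^-1 *
  \sum_(c \in Q) (let a := xget 0 c in
     psi (2%:R^-1 * beta a w) * phi ((g^-1)%VF (a + w))).

(* [W/A] is discrete, so the integral is a sum over the cosets. *)
Definition lattice_model (phi : L -> R[i]) : Prop :=
  (forall a w, latA D a -> phi (a + w) = psi (2%:R^-1 * beta w a) * phi w) /\
  (\esum_(c in add_cosets setT (latA D))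
     ((ComplexField.Normc.normc (phi (xget 0 c))) ^+ 2)%:E < +oo)%E.

Definition delta_fun (x w : L) : R[i] :=
  if `[< latA D (w - x) >] then psi (2%:R^-1 * beta x (w - x)) else 0.

Definition weight_vector (chi phi : L -> R[i]) : Prop :=
  lattice_model phi /\
  forall g, torus D g -> forall w, weil (amull g) phi w = chi g * phi w.

Definition occurs (chi : L -> R[i]) : Prop :=
  exists phi, weight_vector chi phi /\ exists w, phi w <> 0.

Definition weight_space_spanned_by (chi phi0 : L -> R[i]) : Prop :=
  forall phi, weight_vector chi phi <->
    exists c : R[i], forall w, phi w = c * phi0 w.

(* The summand is evaluated at a chosen representative [g] of the class [c] in
   [T / T_j]; it does not depend on that choice when [chi] and [delta_x] are as
   in the theorem. *)
Definition phi_chi (chi : L -> R[i]) (j : nat) (x w : L) : R[i] :=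
  \sum_(c \in mul_cosets (torus D) (torus_filtration D j))
    (let g := xget 1 c in chi g^-1 * weil (amull g) (delta_fun x) w).

End WeilRepresentation.

(* Main.v *)
Require Import Defs.
From HB Require Import structures.
From mathcomp Require Import all_boot all_order all_algebra all_field.
From mathcomp Require Import finmap complex ring zify.
From mathcomp Require Import all_classical all_reals all_analysis.

(** In the coordinates of [Lfield = K (+) K nu], the operator [S(g)] of an element
    [g] of the torus is, up to a constant, a sum of [q'] terms indexed by the
    residue field of [k'].  The normalisation [m(g)] turns that constant into the
    inverse of a one-variable Gauss sum, which makes [g |-> S(g)] multiplicative on
    the torus.

    For [g] close to [1], [S(g)] acts at [w] as multiplication by [Xi (- w w^tau g)],
    where [Xi x = psi (tr (u x) / 4)].  A vector of weight [chi] is therefore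
    supported on those [w] for which [chi] is given by [w w^tau] near [1]; comparing
    valuations, the conductor of [chi] is odd or at most [1].

    If the conductor is [2 j + 1 > 1], duality for the finite quotients of the torus
    and the surjectivity of the norm on units produce such a [w = varpi'^(h - j) a],
    with [h = (mu - 1) / 2].  The torus moves [w] through all classes modulo [A] on
    which a vector of weight [chi] can live, so such a vector is determined by its
    value at [w], and averaging [delta_w] gives one with value [1] there.

    If the conductor is at most [1], the weight space is the image of an idempotent
    on the [q']-dimensional space of functions supported on [B*].  As
    [tr S(g) = - eta_0(g)] for [g] outside [T_1], its trace, hence its rank, is [0]
    for [chi = eta_0] and [1] otherwise. *)

Set Implicit Arguments.
Unset Strict Implicit.
Unset Printing Implicit Defensive.

Import Order.TTheory GRing.Theory Num.Theory.
Local Open Scope classical_set_scope.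
Local Open Scope ring_scope.

(** * Gauss sums over finite fields *)

(** The argument on the lattice model rests on two records, [unramified_quadratic] and
    [weil_character], which know nothing of [k], of traces or of [theta]. The setting is shown to be
    an instance afterwards. The 1/4 in [Xi] is the 1/2 of [beta] times the 1/2 of the lattice model.
    As [mu = 2 h + 1], [Xi] is trivial from valuation [2 h + 1] on but not on [pi^(2 h) O' nu], so
    the pairing is perfect on [B* / B], a plane over the residue field of [k']. Elements of the
    torus are measured by their coordinate along [nu]: on [T_m] with [m > 0] it is additive up to an
    error of valuation [3 m], and serves as a logarithm. The main obstacle is [m(g)], built from
    Gauss sums over the residue field of [k], whereas multiplicativity of [S] is visible over that
    of [k']. The bridge is the symmetric matrix [C] of the form [<x, g y>] on [A / B]: for generic
    [g] a Bruhat decomposition gives [theta = det C], and diagonalising [C] evaluates the Gauss sum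
    over the residue field of [k']. *)

Lemma mxtrace_idempotent (F : fieldType) (n : nat) (P : 'M[F]_n) :
  P *m P = P -> \tr P = (\rank P)%:R.
Proof.
have : P = col_base P *m row_base P by rewrite mulmx_base.
have /row_freeP : row_free (row_base P) by exact: row_base_free.
have /row_fullP : row_full (col_base P) by exact: col_base_full.
move: (\rank P) (col_base P) (row_base P) => r U V [Y YU] [X VX] PE PP.
(* Cancelling the full-rank factors in [U V U V = U V] leaves [V U = 1], whose trace is the rank. *)
have VU : V *m U = 1%:M.
  have := congr1 (fun Z => Y *m Z *m X) PP; rewrite /= PE !mulmxA YU mul1mx.
  by rewrite -!mulmxA VX mulmx1.
by rewrite [in LHS]PE mxtrace_mulC VU mxtrace1.
Qed.

(** * The quadratic character of a finite field of odd order *)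

Section QuadraticCharacter.
Variables (R : realType) (F : finFieldType).
Hypothesis F2 : (2%:R : F) != 0.

Local Notation eta := (@quadratic_char R F).

Lemma quadratic_char0 : eta 0 = 0.
Proof. by rewrite /quadratic_char eqxx. Qed.

Lemma quadratic_char_sqr (a : F) : a != 0 -> eta (a ^+ 2) = 1.
Proof.
move=> a0; rewrite /quadratic_char expf_eq0 /= (negbTE a0).
by case: ifP => // /negbT/existsPn/(_ a); rewrite eqxx.
Qed.

Lemma quadratic_char_sqrE (a : F) : a != 0 -> eta a = 1 <-> exists b, a = b ^+ 2.
Proof.
move=> a0; split=> [|[b ab]]; last first.
  by rewrite ab quadratic_char_sqr//; apply: contra_neq a0 => b0; rewrite ab b0 expr0n.
rewrite /quadratic_char (negbTE a0); case: ifP => [/existsP[b /eqP->] _|_]; first by exists b.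
by move/eqP; rewrite eq_sym -subr_eq0 opprK (_ : 1 + 1 = 2%:R) ?pnatr_eq0// -[2%:R]natr1.
Qed.

Lemma quadratic_char_pm (a : F) : a != 0 -> eta a = 1 \/ eta a = -1.
Proof. by move=> a0; rewrite /quadratic_char (negbTE a0); case: ifP; [left|right]. Qed.

Lemma quadratic_char_neq0 (a : F) : a != 0 -> eta a != 0.
Proof. by case/quadratic_char_pm => ->; rewrite ?oppr_eq0 oner_eq0. Qed.

Lemma quadratic_char_expr2 (a : F) : a != 0 -> eta a ^+ 2 = 1.
Proof. by case/quadratic_char_pm => ->; rewrite ?sqrrN expr1n. Qed.

Let sq := [set t ^+ 2 | t in [set~ (0 : F)]]%SET.

Let mem_sq (s : F) : s != 0 -> reflect (exists b, s = b ^+ 2) (s \in sq).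
Proof.
move=> s0; apply: (iffP imsetP) => [[t _ ->]|[b sb]]; first by exists t.
by exists b => //; rewrite !inE; apply: contraNneq s0 => b0; rewrite sb b0 expr0n.
Qed.

Let card_fiber (s : F) : s != 0 ->
  #|[set t | t ^+ 2 == s]%SET| = (2 * (s \in sq))%N.
Proof.
move=> s0; case: (mem_sq s0) => [[t st]|ns].
  have t0 : t != 0 by apply: contraNneq s0 => t0; rewrite st t0 expr0n.
  rewrite (_ : [set _ | _]%SET = [set t; -t]%SET); last first.
    by apply/setP=> x; rewrite !inE st eqf_sqr.
  rewrite cards2; case: eqVneq => // /eqP.
  by rewrite -subr_eq0 opprK -mulr2n -mulr_natl mulf_eq0 (negbTE F2) (negbTE t0).
apply/eqP; rewrite muln0 cards_eq0; apply/eqP/setP => x; rewrite !inE.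
by apply/negP => /eqP sx; apply: ns; exists x.
Qed.

Let card_sq : #|[set~ (0 : F)]%SET| = (2 * #|sq|)%N.
Proof.
rewrite -sum1_card (partition_big (fun t => t ^+ 2) (mem sq)) /=; last first.
  by move=> t t0; apply: imset_f.
rewrite mulnC -sum_nat_const; apply: eq_bigr => s ssq.
have s0 : s != 0.
  by case/imsetP: ssq => t; rewrite !inE => t0 ->; rewrite expf_eq0.
transitivity #|[set t | t ^+ 2 == s]%SET|; last by rewrite card_fiber// ssq.
rewrite sum1_card; apply: eq_card => t; rewrite !inE.
apply/andP/idP=> [[]//|/eqP ts]; split; last by rewrite ts.
by rewrite !inE; apply: contraNneq s0 => t0; rewrite -ts t0 expr0n.
Qed.

(** The real case is a product of two non-squares. The non-zero squares are exactly half of the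
    units, so multiplication by a non-square [a] maps them onto the non-squares; then [b = a s] with
    [s] a square, and [a b = a^2 s]. *)
Lemma quadratic_charM (a b : F) : eta (a * b) = eta a * eta b.
Proof.
have [->|a0] := eqVneq a 0; first by rewrite mul0r quadratic_char0 mul0r.
have [->|b0] := eqVneq b 0; first by rewrite mulr0 quadratic_char0 mulr0.
have ab0 : a * b != 0 by rewrite mulf_neq0.
have etaE (c : F) : c != 0 -> eta c = if c \in sq then 1 else -1.
  move=> c0; case: (mem_sq c0) => [/quadratic_char_sqrE->//|nc].
  by case: (quadratic_char_pm c0) => // /quadratic_char_sqrE-/(_ c0).
rewrite !etaE//.
have sqM (c x : F) : c != 0 -> x != 0 -> c \in sq -> (c * x \in sq) = (x \in sq).
  move=> c0 x0 /(mem_sq c0)[t ct].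
  have t0 : t != 0 by apply: contraNneq c0 => t0; rewrite ct t0 expr0n.
  apply/(mem_sq (mulf_neq0 c0 x0))/(mem_sq x0) => -[y yE].
    by exists (y / t); rewrite expr_div_n -yE ct mulrAC divff ?mul1r// expf_neq0.
  by exists (t * y); rewrite exprMn -yE -ct.
have [asq|nasq] := boolP (a \in sq).
  by rewrite sqM// mul1r.
have [bsq|nbsq] := boolP (b \in sq).
  by rewrite mulrC sqM// (negbTE nasq) mulr1.
rewrite mulrNN mulr1.
suff /imsetP[s ssq bE] : b \in [set a * s | s in sq]%SET.
  have s0 : s != 0 by apply: contraNneq b0 => s0; rewrite bE s0 mulr0.
  rewrite bE mulrA -expr2 sqM ?expf_neq0//; last by apply: imset_f; rewrite !inE.
  by rewrite ssq.
have sub : [set a * s | s in sq]%SET \subset ([set~ 0] :\: sq)%SET.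
  apply/fintype.subsetP=> x /imsetP[s ssq ->]; have s0 : s != 0.
    by case/imsetP: ssq => t; rewrite !inE => t0 ->; rewrite expf_eq0.
  by rewrite !inE mulf_neq0// andbT mulrC sqM.
have /eqP -> : [set a * s | s in sq]%SET == ([set~ 0] :\: sq)%SET.
  rewrite eqEcard sub /= card_imset; last exact: mulfI.
  rewrite cardsD (finset.setIidPr _) ?card_sq; first by rewrite mul2n -addnn addnK.
  by apply/fintype.subsetP=> x /imsetP[t]; rewrite !inE => t0 ->; rewrite expf_eq0.
by rewrite !inE nbsq.
Qed.

Lemma quadratic_charV (a : F) : eta a^-1 = eta a.
Proof.
have [->|a0] := eqVneq a 0; first by rewrite invr0.
apply: (mulfI (quadratic_char_neq0 a0)).
by rewrite -quadratic_charM divff// -expr2 quadratic_char_expr2// -(expr1n _ 2) quadratic_char_sqr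
  ?oner_eq0.
Qed.

(** [1 + eta s] is the number of square roots of [s], also for [s = 0]. *)
Lemma sum_comp_sqr (f : F -> R[i]) :
  \sum_t f (t ^+ 2) = \sum_s (1 + eta s) * f s.
Proof.
rewrite (partition_big (fun t => t ^+ 2) predT) //=; apply: eq_bigr => s _.
under eq_bigr => t /eqP -> do [].
rewrite sumr_const -mulr_natl; congr (_ * _).
have [->|s0] := eqVneq s 0.
  rewrite quadratic_char0 addr0 (_ : #|_| = 1%N)//.
  by apply: etrans (card1 (0 : F)); apply: eq_card => t; rewrite !inE; exact: expf_eq0.
rewrite -(@eq_card _ [set t | t ^+ 2 == s]%SET); last by move=> t; rewrite !inE.
rewrite card_fiber//; case: (mem_sq s0) => [/quadratic_char_sqrE->//|ns].
case: (quadratic_char_pm s0) => [/quadratic_char_sqrE-/(_ s0)//|->].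
by rewrite /= ?muln0 subrr.
Qed.

End QuadraticCharacter.

(** * One-variable Gauss sums and duality for the additive group *)

Section GaussSums.
Variables (R : realType) (F : finFieldType).
Hypothesis F2 : (2%:R : F) != 0.
Variable psi : F -> R[i].
Hypothesis psiD : forall x y, psi (x + y) = psi x * psi y.
Hypothesis psi_neq0 : forall x, psi x != 0.
Hypothesis psi_nontrivial : exists x, psi x != 1.

Local Notation eta := (@quadratic_char R F).

Lemma additive_char0 : psi 0 = 1.
Proof. by apply: (mulfI (psi_neq0 0)); rewrite -psiD addr0 mulr1. Qed.

Lemma additive_charN x : psi (- x) = (psi x)^-1.
Proof. by apply: (mulfI (psi_neq0 x)); rewrite -psiD subrr additive_char0 divff. Qed.

Lemma sum_additive_char (a : F) : \sum_t psi (a * t) = (a == 0)%:R * #|F|%:R.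
Proof.
have [->|a0] := eqVneq a 0.
  under eq_bigr do rewrite mul0r additive_char0.
  by rewrite sumr_const mul1r.
rewrite mul0r; have [x xP] := psi_nontrivial.
have : (psi x - 1) * \sum_t psi (a * t) = 0.
  rewrite mulrBl mul1r mulr_sumr; apply/eqP; rewrite subr_eq0; apply/eqP.
  rewrite [RHS](reindex_inj (@addrI _ (x / a))) /=; apply: eq_bigr => t _.
  by rewrite -psiD mulrDr mulrCA divff// mulr1.
by move/eqP; rewrite mulf_eq0 subr_eq0 (negbTE xP) => /eqP.
Qed.

Definition gauss (a : F) : R[i] := \sum_t psi (a * t ^+ 2).

Lemma card_field_neq0 : #|F|%:R != 0 :> R[i].
Proof. by rewrite pnatr_eq0 -lt0n; apply/card_gt0P; exists 0. Qed.

(** After [sum_comp_sqr] the part without [eta] is a vanishing character sum; what is left is the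
    sum of [eta s * psi (b * s)], and rescaling [s] pulls out [eta]. *)
Lemma gaussE (a : F) : a != 0 -> gauss a = eta a * gauss 1.
Proof.
have aux (b : F) : b != 0 -> gauss b = \sum_s eta s * psi (b * s).
  move=> b0; rewrite /gauss (sum_comp_sqr F2 (fun s => psi (b * s))).
  under eq_bigr do rewrite mulrDl mul1r.
  by rewrite big_split /= sum_additive_char (negbTE b0) mul0r add0r.
move=> a0; rewrite !aux ?oner_eq0// mulr_sumr.
rewrite [RHS](reindex_inj (mulfI a0)) /=; apply: eq_bigr => s _.
by rewrite mul1r quadratic_charM// !mulrA -expr2 quadratic_char_expr2// mul1r.
Qed.

(** The substitution [s := s + t] makes [s ^+ 2 - t ^+ 2] linear in [t], and orthogonality keeps
    only [s = 0]. In later computations this takes the place of the absolute value of a Gauss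
    sum. *)
Lemma gaussN (a : F) : a != 0 -> gauss a * gauss (- a) = #|F|%:R.
Proof.
move=> a0; rewrite /gauss mulr_suml.
transitivity (\sum_(s : F) \sum_(t : F) psi (a * s ^+ 2) * psi (2%:R * a * s * t)).
  rewrite exchange_big /=.
  transitivity (\sum_t \sum_s psi (a * s ^+ 2) * psi (- a * t ^+ 2)).
    by rewrite exchange_big; apply: eq_bigr => s _; rewrite mulr_sumr.
  apply: eq_bigr => t _; rewrite (reindex_inj (@addIr _ t)) /=.
  apply: eq_bigr => s _; rewrite -!psiD; congr psi; ring.
under eq_bigr do rewrite -mulr_sumr sum_additive_char.
rewrite (bigD1 0) //= mulr0 eqxx mul1r expr0n mulr0 additive_char0 mul1r.
rewrite big1 ?addr0// => s s0.
by rewrite !mulf_eq0 (negbTE F2) (negbTE a0) (negbTE s0) mul0r mulr0.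
Qed.

Lemma gauss_neq0 (a : F) : a != 0 -> gauss a != 0.
Proof.
move=> a0; have := gaussN a0; apply: contra_eq_neq => ->.
by rewrite mul0r eq_sym card_field_neq0.
Qed.

Lemma gaussM (a b : F) : a != 0 -> b != 0 -> gauss (a * b) * gauss 1 = gauss a * gauss b.
Proof.
move=> a0 b0; rewrite (gaussE (mulf_neq0 a0 b0)) (gaussE a0) (gaussE b0) quadratic_charM//.
by ring.
Qed.

Lemma gauss_sqr (a b : F) : b != 0 -> gauss (a * b ^+ 2) = gauss a.
Proof.
move=> b0; rewrite /gauss [RHS](reindex_inj (mulfI b0)) /=.
by apply: eq_bigr => t _; congr psi; ring.
Qed.

(** If [f] differed from every [psi (n * x)], all its Fourier coefficients would vanish; but summed
    over [n] they give [f 0] times the order of the field. *)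
Lemma additive_char_dual (f : F -> R[i]) :
  (forall x y, f (x + y) = f x * f y) -> (forall x, f x != 0) ->
  exists n : F, forall x : F, f x = psi (n * x).
Proof.
move=> fD f0; apply: contrapT => nex.
have S0 n : \sum_x f x * psi (- n * x) = 0.
  have [x xP] : exists x, f x * psi (- n * x) != 1.
    apply: contrapT => nx; apply: nex; exists n => x.
    have /eqP : f x * psi (- n * x) = 1 by apply/eqP/negP => h; apply: nx; exists x; apply/negP.
    by rewrite mulNr additive_charN => /eqP/divr1_eq.
  have : (f x * psi (- n * x) - 1) * \sum_x f x * psi (- n * x) = 0.
    rewrite mulrBl mul1r mulr_sumr; apply/eqP; rewrite subr_eq0; apply/eqP.
    rewrite [RHS](reindex_inj (@addrI _ x)) /=; apply: eq_bigr => t _.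
    by rewrite mulrDr psiD fD; ring.
  by move/eqP; rewrite mulf_eq0 subr_eq0 (negbTE xP) => /eqP.
have : \sum_n \sum_x f x * psi (- n * x) = 0 by rewrite big1.
rewrite exchange_big /= (bigD1 0) //= [X in _ + X]big1 => [|x x0].
  under eq_bigr do rewrite mulr0 additive_char0 mulr1.
  rewrite addr0 sumr_const -mulr_natl => /eqP.
  by rewrite mulf_eq0 (negbTE (f0 0)) (negbTE card_field_neq0).
rewrite -mulr_sumr.
under eq_bigr => n _ do rewrite mulNr mulrC -mulNr.
by rewrite sum_additive_char oppr_eq0 (negbTE x0) mul0r mulr0.
Qed.

End GaussSums.

(** * Diagonalisation of symmetric matrices, and Gauss sums of quadratic forms *)

Section QuadraticForms.
Variable F : fieldType.
Hypothesis F2 : (2%:R : F) != 0.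

(** Polarisation: a quadratic form that vanishes everywhere has [2 C i j = 0]. *)
Lemma symmetric_anisotropic_vector (l : nat) (C : 'M[F]_l) :
  C^T = C -> C != 0 -> exists x : 'rV_l, (x *m C *m x^T) 0 0 != 0.
Proof.
move=> Csym C0; apply: contrapT => nex.
have Q0 (x : 'rV_l) : (x *m C *m x^T) 0 0 = 0.
  by apply/eqP/negP => /negP h; apply: nex; exists x.
case/eqP: C0; apply/matrixP => i j; rewrite mxE.
have CE (a b : 'I_l) : ((delta_mx 0 a : 'rV_l) *m C *m (delta_mx 0 b : 'rV_l)^T) 0 0 = C a b.
  by rewrite -rowE trmx_delta -colE !mxE.
have := Q0 (delta_mx 0 i + delta_mx 0 j).
have addE (A B : 'M[F]_1) : (A + B) 0 0 = A 0 0 + B 0 0 by rewrite mxE.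
rewrite linearD /= !mulmxDl !mulmxDr !addE !CE.
have dg a : C a a = 0 by rewrite -CE Q0.
rewrite !dg add0r addr0 -{2}Csym mxE -mulr2n -mulr_natl => /eqP.
by rewrite mulf_eq0 (negbTE F2) => /eqP.
Qed.

(** One step of orthogonal diagonalisation: an anisotropic vector becomes the first basis vector,
    and [P1] clears the rest of its row and column. *)
Lemma symmetric_split (l : nat) (C : 'M[F]_(1 + l)) :
  C^T = C -> C \in unitmx ->
  exists (P : 'M[F]_(1 + l)) (a : F) (D : 'M[F]_l),
    [/\ P \in unitmx, D^T = D, a != 0 & P *m C *m P^T = block_mx a%:M 0 0 D].
Proof.
move=> Csym Cu.
have [|x x0] := symmetric_anisotropic_vector Csym.
  apply: contraTneq Cu => ->; rewrite unitmxE det0 unitr0 //.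
(* [row_ebase x] is an invertible matrix whose first row is proportional to [x]. *)
pose P0 := row_ebase x; have P0u : P0 \in unitmx by exact: row_ebase_unit.
have xn0 : x != 0 by apply: contraNneq x0 => ->; rewrite !mul0mx mxE.
have [c xE] : exists c : F, x = c *: row 0 P0.
  have := mulmx_ebase x; rewrite rank_rV xn0 => xE.
  exists (col_ebase x 0 0); rewrite -{1}xE -/P0; apply/rowP => j.
  rewrite -mulmxA mxE big_ord1 !mxE; congr (_ * _).
  rewrite (bigD1 0) //= big1 => [|k k0]; rewrite !mxE /=.
    by rewrite !mul1r addr0.
  have -> : (0%N == k) = false.
    by rewrite eq_sym; apply: negbTE; apply: contraNneq k0 => k0; apply/eqP/val_inj.
  by rewrite mul0r.
pose C1 := P0 *m C *m P0^T.
have C1sym : C1^T = C1 by rewrite /C1 !trmx_mul trmxK Csym mulmxA.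
pose a := C1 0 0.
have a0 : a != 0.
  have aE : (x *m C *m x^T) 0 0 = c ^+ 2 * a.
    rewrite xE linearZ /= -!scalemxAl -scalemxAr scalerA mxE -expr2 /a /C1.
    congr (_ * _); rewrite -row_mul !mxE.
    by apply: eq_bigr => k _; rewrite !mxE.
  by apply: contraNneq x0 => a0; rewrite aE a0 mulr0.
pose b := dlsubmx C1.
have C1E : C1 = block_mx a%:M b^T b (drsubmx C1).
  rewrite -{1}(submxK C1); congr block_mx.
    have aS : ulsubmx C1 0 0 = a by rewrite 2![LHS]mxE; congr (C1 _ _); apply/val_inj.
    by rewrite [LHS]mx11_scalar aS.
  by rewrite /b trmx_dlsub C1sym.
pose P1 : 'M[F]_(1 + l) := block_mx 1%:M 0 (- a^-1 *: b) 1%:M.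
exists (P1 *m P0), a, (drsubmx C1 - a^-1 *: (b *m b^T)); split => //.
- rewrite unitmx_mul P0u andbT unitmxE det_lblock !det1 mulr1 unitr1 //.
- rewrite linearB /= linearZ /= trmx_mul trmxK; congr (_ - _).
  by rewrite trmx_drsub C1sym.
rewrite trmx_mul !mulmxA -(mulmxA P1) -(mulmxA P1) -/C1 C1E /P1.
rewrite tr_block_mx !mulmx_block ?(trmx0, trmx1) ?(mul1mx, mul0mx, mulmx0, mulmx1, addr0, add0r).
have ba : (- a^-1 *: b) *m a%:M + b = 0.
  by rewrite mul_mx_scalar scalerA mulrN divff// scaleN1r addNr.
rewrite ba mul0mx add0r linearZ /=; congr block_mx.
  by rewrite mul_scalar_mx scalerA mulrN divff// scaleN1r addNr.
by rewrite block_mxKdr -scalemxAl scaleNr addrC.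
Qed.

End QuadraticForms.

Section QuadraticGaussSums.
Variables (R : realType) (F : finFieldType).
Hypothesis F2 : (2%:R : F) != 0.
Variable psi : F -> R[i].
Hypothesis psiD : forall x y, psi (x + y) = psi x * psi y.
Hypothesis psi_neq0 : forall x, psi x != 0.
Hypothesis psi_nontrivial : exists x, psi x != 1.

(** Each diagonal entry contributes its own Gauss sum, and [gaussM] merges these into one that sees
    only the determinant up to squares. The factor [gauss psi 1] on the left avoids the exponent
    [l - 1], which would fail for [l = 0]. *)
Lemma gauss_sum_form (l : nat) (C : 'M[F]_l) : C^T = C -> C \in unitmx ->
  (\sum_(x : 'rV_l) psi ((x *m C *m x^T) 0 0)) * gauss psi 1 =
  gauss psi (\det C) * gauss psi 1 ^+ l.
Proof.
elim: l C => [|l IHl] C Csym Cu.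
  rewrite (bigD1 0) //= big1 => [|x]; last by rewrite thinmx0 eqxx.
  by rewrite !mul0mx mxE additive_char0// addr0 mul1r det_mx00 expr0 mulr1.
have [P [a [D [Pu Dsym a0 PE]]]] := symmetric_split F2 Csym Cu.
have detE : \det C * \det P ^+ 2 = a * \det D.
  have := congr1 determinant PE.
  rewrite (@det_ublock _ 1 l) det_scalar1 !det_mulmx det_tr => <-; ring.
have Pn0 : \det P != 0 by move: Pu; rewrite unitmxE unitfE.
have Cn0 : \det C != 0 by move: Cu; rewrite unitmxE unitfE.
have Dn0 : \det D != 0.
  have : a * \det D != 0 by rewrite -detE mulf_neq0// expf_neq0.
  by rewrite mulf_eq0 negb_or => /andP[].
have Du : D \in unitmx by rewrite unitmxE unitfE.
rewrite -(gauss_sqr psi (\det C) Pn0) detE exprS mulrA gaussM//.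
rewrite -mulrA -IHl// mulrA; congr (_ * _).
rewrite (reindex (fun x : 'rV_(1 + l) => x *m P)) /=; last first.
  by exists (mulmx^~ (invmx P)) => x _; rewrite ?mulmxK ?mulmxKV.
transitivity (\sum_(x : 'rV_(1 + l)) psi ((x *m block_mx a%:M 0 0 D *m x^T) 0 0)).
  by apply: eq_bigr => x _; rewrite -PE trmx_mul !mulmxA.
rewrite /gauss mulr_suml.
rewrite (reindex (fun p : F * 'rV_l => row_mx (p.1%:M : 'rV_1) p.2)) /=; last first.
  exists (fun x : 'rV_(1 + l) => (lsubmx x 0 0, rsubmx x)) => [[t x]|x] _ /=.
    by rewrite row_mxKl row_mxKr mxE /= mulr1n.
  by rewrite -mx11_scalar hsubmxK.
rewrite -(pair_bigA _ (fun t x => psi ((row_mx (t%:M : 'rV_1) x *m block_mx a%:M 0 0 D *m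
            (row_mx (t%:M : 'rV_1) x)^T) 0 0))) /=.
apply: eq_bigr => t _; rewrite mulr_sumr; apply: eq_bigr => x _.
rewrite -psiD mul_row_block !mulmx0 addr0 add0r tr_row_mx mul_row_col mxE; congr (psi (_ + _)).
rewrite tr_scalar_mx -!scalar_mxM mxE /= mulr1n; ring.
Qed.

(** Points are counted with additive characters. As [d] is not a square, [gauss t * gauss (- d * t)]
    equals [- q] for every non-zero [t], so that [q] times the count is [q^2 + q]. The count serves
    twice: for the surjectivity of the norm on residues and for the order of [T / T_1]. *)
Lemma card_norm_form (d c : F) : (forall b : F, b ^+ 2 != d) -> c != 0 ->
  #|[set p : F * F | p.1 ^+ 2 - d * p.2 ^+ 2 == c]%SET| = #|F|.+1.
Proof.
move=> nsq c0; have d0 : d != 0 by have := nsq 0; rewrite expr0n eq_sym.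
have q0 := card_field_neq0 R F.
have sumE := sum_additive_char psiD psi_neq0 psi_nontrivial.
have gE := gaussE F2 psiD psi_neq0 psi_nontrivial.
have etad : @quadratic_char R F d = -1.
  case: (@quadratic_char_pm R F _ d0) => // /(quadratic_char_sqrE R d0)[b db].
  by have := nsq b; rewrite db eqxx.
set S := [set _ | _]%SET.
have SE : #|S|%:R * #|F|%:R = \sum_t \sum_(p : F * F) psi (t * (p.1 ^+ 2 - d * p.2 ^+ 2 - c)).
  rewrite exchange_big /= -sumr_const mulr_suml [RHS](bigID (mem S)) /= [X in _ = _ + X]big1 ?addr0.
    apply: eq_bigr => p; rewrite inE => /eqP ->; rewrite subrr mul1r.
    under eq_bigr do rewrite mulr0 additive_char0//.
    by rewrite sumr_const.
  move=> p; rewrite inE => pc.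
  under eq_bigr do rewrite mulrC.
  by rewrite sumE subr_eq0 (negbTE pc) mul0r.
have tE (t : F) : \sum_(p : F * F) psi (t * (p.1 ^+ 2 - d * p.2 ^+ 2 - c)) =
    psi (- c * t) * (gauss psi t * gauss psi (- d * t)).
  rewrite /gauss mulr_suml mulr_sumr -(pair_bigA _ (fun x y => psi (t * (x ^+ 2 - d * y ^+ 2 -
    c)))) /=.
  apply: eq_bigr => x _; rewrite mulr_sumr mulr_sumr; apply: eq_bigr => y _.
  by rewrite -!psiD; congr psi; ring.
have g1 : gauss psi 1 * gauss psi (- d) = - #|F|%:R.
  rewrite -(gaussN F2 psiD psi_neq0 psi_nontrivial (oner_neq0 F)).
  rewrite (gE (- d)) ?oppr_eq0// (gE (- 1)) ?oppr_eq0 ?oner_eq0//.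
  by rewrite -[- d]mulN1r quadratic_charM// etad; ring.
apply/eqP; rewrite -(eqr_nat R[i]) -(inj_eq (mulIf q0)) SE (bigD1 0) //= tE.
rewrite !mulr0 additive_char0// mul1r.
have -> : gauss psi 0 = #|F|%:R.
  rewrite /gauss; under eq_bigr do rewrite mul0r additive_char0//.
  by rewrite sumr_const.
have -> : \sum_(t | t != 0) \sum_(p : F * F) psi (t * (p.1 ^+ 2 - d * p.2 ^+ 2 - c)) =
    \sum_(t | t != 0) psi (- c * t) * - #|F|%:R.
  apply: eq_bigr => t t0; rewrite tE -g1; congr (_ * _).
  rewrite (gE t)// (gE (- d * t)) ?mulf_neq0 ?oppr_eq0// (gE (- d)) ?oppr_eq0// quadratic_charM//.
  rewrite [RHS]mulrC -[RHS]mul1r -(quadratic_char_expr2 R t0); ring.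
rewrite -mulr_suml.
have : \sum_t psi (- c * t) = 0 by rewrite sumE oppr_eq0 (negbTE c0) mul0r.
rewrite (bigD1 0) //= mulr0 additive_char0// => /eqP; rewrite addrC addr_eq0 => /eqP ->.
by apply/eqP; rewrite -natr1; ring.
Qed.

End QuadraticGaussSums.

(** * Discrete valuations and their extensions *)

Section Valuations.
Variables (F : fieldType) (v : F -> int).
Hypothesis vP : normalized_valuation v.

Local Notation vge := (val_ge v).

Lemma val_one : v 1 = 0.
Proof.
have : v (1 * 1) = v 1 + v 1 := Defs.valM vP (oner_neq0 F) (oner_neq0 F).
by rewrite mulr1; lia.
Qed.

Lemma val_expr (x : F) n : x != 0 -> v (x ^+ n) = v x * n%:Z.
Proof.
move=> x0; elim: n => [|n IHn]; first by rewrite expr0 val_one mulr0.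
by rewrite exprS (Defs.valM vP) ?expf_neq0// IHn; lia.
Qed.

Lemma val_opp x : v (- x) = v x.
Proof.
have [->|x0] := eqVneq x 0; first by rewrite oppr0.
have N10 : (-1 : F) != 0 by rewrite oppr_eq0 oner_eq0.
have := Defs.valM vP N10 N10; rewrite mulrNN mulr1 val_one => vN1.
by rewrite -mulN1r (Defs.valM vP)//; lia.
Qed.

Lemma val_inv (x : F) : x != 0 -> v x^-1 = - v x.
Proof.
move=> x0; have := Defs.valM vP x0 (invr_neq0 x0); rewrite divff// val_one; lia.
Qed.

Lemma val_exprz (x : F) (n : int) : x != 0 -> v (x ^ n) = v x * n.
Proof.
move=> x0; case: n => n; first by rewrite -exprnP val_expr.
by rewrite NegzE -exprnN val_inv ?expf_neq0// val_expr//; lia.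
Qed.

Lemma val_ge0 n : vge n 0.
Proof. by left. Qed.

Lemma val_geE n (x : F) : x != 0 -> vge n x <-> n <= v x.
Proof. by move=> /eqP x0; split=> [[]//|]; right. Qed.

Lemma val_geW m n x : m <= n -> vge n x -> vge m x.
Proof. by move=> mn [->|h]; [left|right; apply: le_trans h]. Qed.

Lemma val_geN n x : vge n x -> vge n (- x).
Proof. by move=> [->|h]; [left; rewrite oppr0|right; rewrite val_opp]. Qed.

Lemma val_geD n x y : vge n x -> vge n y -> vge n (x + y).
Proof.
move=> [->|hx]; first by rewrite add0r.
have [->|x0] := eqVneq x 0; first by rewrite add0r.
move=> [->|hy]; first by rewrite addr0; right.
have [->|y0] := eqVneq y 0; first by rewrite addr0; right.
have [->|xy0] := eqVneq (x + y) 0; first by left.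
by right; apply: le_trans (Defs.valD vP x0 y0 xy0); rewrite le_min hx.
Qed.

Lemma val_geB n x y : vge n x -> vge n y -> vge n (x - y).
Proof. by move=> hx hy; apply: val_geD => //; apply: val_geN. Qed.

Lemma val_geM m n x y : vge m x -> vge n y -> vge (m + n) (x * y).
Proof.
move=> [->|hx]; first by rewrite mul0r; left.
have [->|x0] := eqVneq x 0; first by rewrite mul0r; left.
move=> [->|hy]; first by rewrite mulr0; left.
have [->|y0] := eqVneq y 0; first by rewrite mulr0; left.
by right; rewrite (Defs.valM vP)// lerD.
Qed.

Lemma val_ge_sum n (I : Type) (r : seq I) (P : pred I) (f : I -> F) :
  (forall i, P i -> vge n (f i)) -> vge n (\sum_(i <- r | P i) f i).
Proof. by move=> h; apply: (big_ind (vge n)) => //; [exact: val_ge0|exact: val_geD]. Qed.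

Lemma val_ge_eq0 x : (forall n, vge n x) -> x = 0.
Proof. by move=> h; case: (h (v x + 1)) => // ; lia. Qed.

Lemma val_ge_refl x : vge (v x) x.
Proof. by right. Qed.

Lemma val_geMl (x : F) n y : x != 0 -> vge (v x + n) (x * y) <-> vge n y.
Proof.
move=> x0; split=> [h|]; last exact: val_geM (val_ge_refl x).
rewrite (_ : y = x^-1 * (x * y)); last by rewrite mulKf.
have := val_geM (val_ge_refl x^-1) h; rewrite val_inv//; apply: val_geW; lia.
Qed.

Lemma val_unitD (x y : F) : x != 0 -> vge (v x + 1) y -> x + y != 0 /\ v (x + y) = v x.
Proof.
move=> x0 hy; have xy0 : x + y != 0.
  apply/negP; rewrite addr_eq0 => /eqP xy; case: hy => [y0|].
    by move: x0; rewrite xy y0 oppr0 eqxx.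
  by rewrite xy val_opp; lia.
split=> //; apply/eqP; rewrite eq_le; apply/andP; split.
  rewrite leNgt; apply/negP => lt.
  have : vge (v x + 1) (x + y - y) by apply: val_geB => //; right; lia.
  by rewrite addrK; case=> [/eqP|]; [rewrite (negbTE x0)|lia].
have : vge (v x) (x + y).
  by apply: val_geD (val_ge_refl x) _; apply: val_geW hy; lia.
by case=> // /eqP; rewrite (negbTE xy0).
Qed.

End Valuations.

(* Over a complete field all norms on a finite-dimensional space are
   equivalent; hence two extensions of the valuation have the same open unit
   ball. *)
Section ValuationExtension.
Variables (k : fieldType) (kv : k -> int) (L : fieldExtType k).
Hypotheses (kvP : normalized_valuation kv) (k_complete : val_complete kv).

Section Bounds.
Variables (v : L -> int) (e : nat).
Hypotheses (vP : normalized_valuation v) (e_gt0 : (0 < e)%N).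
Hypothesis v_ext : forall x : k, x != 0 -> v x%:A = e%:Z * kv x.

Lemma val_geZ N M a (x : L) : val_ge kv N a -> val_ge v M x ->
  val_ge v (e%:Z * N + M) (a *: x).
Proof.
move=> ha hx; rewrite -mulr_algl; apply: val_geM => //.
have [->|a0] := eqVneq a 0; first by rewrite scale0r; left.
right; rewrite v_ext//; move: ha => [/eqP|]; first by rewrite (negbTE a0).
by move=> ?; rewrite ler_pM2l.
Qed.

(** Induction on the dimension. The complement [V] stays at positive distance from [b]: otherwise
    vectors of [V] approach [- b], their coordinates are Cauchy by the induction hypothesis, and
    completeness puts the limit [- b] in [V]. This distance bounds the coefficient of [b] in a small
    vector. *)
Lemma val_linear_bound (U : {vspace L}) (f : {scalar L}) :
  exists C : int, forall (N : int) (x : L), x \in U ->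
    val_ge v (e%:Z * N + C) x -> val_ge kv N (f x).
Proof.
move: {2}(\dim U) (erefl (\dim U)) => n; elim: n U f => [|n IHn] U f dimU.
  exists 0 => N x; move/eqP: dimU; rewrite dimv_eq0 => /eqP ->.
  by rewrite memv0 => /eqP -> _; rewrite linear0; left.
pose b := vpick U.
have b0 : b != 0 by rewrite vpick0 -dimv_eq0 dimU.
have bU : b \in U by exact: memv_pick.
pose V := (U :\: <[b]>)%VS.
have dimV : \dim V = n.
  have := dimv_cap_compl U <[b]>%VS; rewrite (capv_idPr _) ?dim_vline ?b0 ?dimU//.
  by rewrite -[X in _ = X]add1n => /eqP; rewrite eqn_add2l => /eqP.
have bV : b \notin V.
  apply/negP => bV; have : b \in (V :&: <[b]>)%VS by rewrite memv_cap bV memv_line.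
  by rewrite capv_diff memv0 (negbTE b0).
have [C0 C0P] : exists C0 : int, forall y, y \in V -> ~ val_ge v C0 (b + y).
  apply: contrapT => nC0.
  have /choice[y yP] : forall n : nat, exists y, y \in V /\ val_ge v n%:Z (b + y).
    move=> m; apply: contrapT => ny; apply: nC0; exists m%:Z => y yV h.
    by apply: ny; exists y.
  have yV m : y m \in V by case: (yP m).
  pose c i : {scalar L} := coord (vbasis V) i.
  have /choice[Cc CcP] := fun i => IHn V (c i) dimV.
  have /choice[l lP] : forall i, exists l : k, forall N : int, exists n0 : nat,
      forall m : nat, (n0 <= m)%N -> val_ge kv N (c i (y m) - l).
    move=> i; apply: k_complete => N; exists (absz (e%:Z * N + Cc i)) => m m' hm hm'.
    rewrite -linearB; apply: CcP; first by rewrite rpredB.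
    rewrite (_ : y m - y m' = (b + y m) - (b + y m')); last by ring.
    apply: val_geB => //; [apply: val_geW (yP m).2|apply: val_geW (yP m').2]; lia.
  pose z := \sum_(i < \dim V) l i *: (vbasis V)`_i.
  have zV : z \in V.
    apply: rpred_sum => i _; apply: rpredZ; apply: vbasis_mem.
    by rewrite mem_nth ?size_tuple.
  suff bz : b + z = 0 by case/negP: bV; rewrite (_ : b = - z) ?rpredN//; apply/eqP;
    rewrite -addr_eq0 bz.
  apply: (val_ge_eq0 (v := v)) => M.
  pose N i : int := (`|M| + `|v (vbasis V)`_i|)%R.
  have /choice[n0 n0P] := fun i => lP i (N i).
  pose m := maxn (absz M) (\max_i n0 i)%N.
  rewrite (_ : b + z = (b + y m) - \sum_(i < \dim V) (c i (y m) - l i) *: (vbasis V)`_i).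
    apply: val_geB => //; first by apply: val_geW (yP m).2; rewrite /m; lia.
    apply: val_ge_sum => // i _.
    apply: val_geW (val_geZ (n0P i m _) (val_ge_refl v _)); last first.
      by apply: leq_trans (leq_maxr _ _); exact: leq_bigmax.
    rewrite /N; nia.
  rewrite {1}(coord_vbasis (yV m)) -addrA -sumrB; congr (_ + _).
  by apply: eq_bigr => i _; rewrite -scalerBl opprB addrC subrK.
have [C1 C1P] := IHn V f dimV.
(* The three lower bounds on [C] control the term [a * f b], then [x] and [a *: b] as the two parts
   of [y = x - a *: b], to which the bound [C1] applies. *)
have [C [h0 h1 h2]] : exists C : int,
    [/\ C0 - e%:Z * kv (f b) <= C, C1 <= C & C1 + C0 - v b <= C].
  by exists (`|C0| + `|e%:Z * kv (f b)| + `|C1| + `|v b|); split; lia.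
exists C => N x xU hx.
have : x \in (V + <[b]>)%VS by rewrite addv_diff (addv_idPl _)// -memvE.
case/memv_addP => y yV [_ /vlineP[a ->] xE].
have [a0|a0] := eqVneq a 0.
  by rewrite xE a0 scale0r addr0; apply: C1P => //; move: hx; rewrite xE a0 scale0r addr0;
    apply: val_geW; lia.
have a0' : a%:A != 0 :> L by rewrite scaler_eq0 negb_or a0 oner_eq0.
have byE : a%:A * (b + a^-1 *: y) = x.
  by rewrite mulr_algl scalerDr scalerA divff// scale1r addrC.
(* Otherwise [a^-1 *: x = b + a^-1 *: y] would be closer to zero than [C0] allows. *)
have lt : e%:Z * N + C - C0 < e%:Z * kv a.
  rewrite ltNge; apply/negP => le; apply: (C0P (a^-1 *: y)); first exact: rpredZ.
  apply/(val_geMl vP _ _ a0'); rewrite byE v_ext//; apply: val_geW hx; lia.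
rewrite xE linearD linearZ /= addrC; apply: val_geD => //.
  have [->|fb0] := eqVneq (f b) 0; first by rewrite mulr0; left.
  right; rewrite (Defs.valM kvP)//.
  have : e%:Z * N < e%:Z * (kv a + kv (f b)) + 1 by lia.
  move: e_gt0; clear; nia.
apply: C1P => //; rewrite (_ : y = x - a *: b); last by rewrite xE addrK.
apply: val_geB => //; first by apply: val_geW hx; lia.
rewrite -mulr_algl; right; rewrite (Defs.valM vP)// v_ext//; lia.
Qed.

End Bounds.

(** A high power of [x] is so small for [v1] that its coordinates in a fixed basis are small in [k],
    which makes it small for [v2]. It is meant for a valuation and its conjugate under [tau]. *)
Lemma val_extension_gt0 (v1 v2 : L -> int) (e1 e2 : nat) :
  normalized_valuation v1 -> normalized_valuation v2 ->
  (0 < e1)%N -> (0 < e2)%N ->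
  (forall x : k, x != 0 -> v1 x%:A = e1%:Z * kv x) ->
  (forall x : k, x != 0 -> v2 x%:A = e2%:Z * kv x) ->
  forall x : L, x != 0 -> 0 < v1 x -> 0 < v2 x.
Proof.
move=> v1P v2P e1_gt0 e2_gt0 v1_ext v2_ext x x0 vx.
have /choice[C CP] := fun i => val_linear_bound v1P e1_gt0 v1_ext fullv (coord (vbasis {:L}) i).
pose N (i : 'I_(\dim {:L})) : int := `|v2 (vbasis {:L})`_i| + 1.
pose m := (\max_i absz (e1%:Z * N i + C i)%R)%N.
have : val_ge v2 1 (x ^+ m).
  rewrite {1}(coord_vbasis (memvf (x ^+ m))); apply: val_ge_sum => // i _.
  apply: val_geW (val_geZ v2P e2_gt0 v2_ext (CP i (N i) _ (memvf _) _) (val_ge_refl v2 _)).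
    rewrite /N; move: (v2 _) e2_gt0; clear => z e2_gt0.
    have : 0 <= (e2%:Z - 1) * (`|z| + 1) by rewrite mulr_ge0; lia.
    lia.
  right; rewrite val_expr//.
  have : (absz (e1%:Z * N i + C i)%R <= m)%N by rewrite /m; exact: (leq_bigmax i).
  by move: vx; clear; nia.
case=> [/eqP|]; first by rewrite expf_eq0 (negbTE x0) andbF.
by rewrite val_expr//; nia.
Qed.

End ValuationExtension.

(** * The lattice model restricted to the torus *)

(** The fixed field of [tau] plays the role of [k']. That the residue of [nu ^+ 2] is not a square
    expresses that the residue extension is quadratic, hence that [L] is unramified over the fixed
    field. *)
Record unramified_quadratic (L : fieldType) (v : L -> int)
    (tau : {rmorphism L -> L}) (nu pi : L) (E : finFieldType) (red : L -> E) :
    Prop := UnramifiedQuadratic {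
  uq_val : normalized_valuation v;
  uq_tauK : forall x, tau (tau x) = x;
  uq_v_tau : forall x, v (tau x) = v x;
  uq_two : (2%:R : L) != 0 /\ v 2%:R = 0;
  uq_nu : [/\ nu != 0, tau nu = - nu & v nu = 0];
  uq_pi : [/\ pi != 0, tau pi = pi & v pi = 1];
  uq_red : residue_map [set x | tau x = x /\ val_ge v 0 x]
             [set x | tau x = x /\ val_ge v 1 x] red;
  uq_nonsquare : forall b : E, b ^+ 2 != red (nu ^+ 2) }.

(** [Xi x] stands for [psi (tr (u x) / 4)]. Inversion under [tau] reflects [tau u = - u], and
    [2 * h + 1] is [mu]. *)
Record weil_character (R : realType) (L : fieldType) (v : L -> int)
    (tau : {rmorphism L -> L}) (nu pi : L) (Xi : L -> R[i]) (h : int) : Prop :=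
    WeilCharacter {
  wc_add : forall x y, Xi (x + y) = Xi x * Xi y;
  wc_neq0 : forall x, Xi x != 0;
  wc_tau : forall x, Xi (tau x) = (Xi x)^-1;
  wc_trivial : forall x, val_ge v (2 * h + 1) x -> Xi x = 1;
  wc_nontrivial : exists2 z, tau z = z /\ val_ge v 0 z & Xi (pi ^ h * pi ^ h * (z * nu)) != 1 }.

Section UnramifiedQuadratic.
Variables (R : realType) (L : fieldType) (v : L -> int) (tau : {rmorphism L -> L}).
Variables (nu pi : L) (E : finFieldType) (red : L -> E).
Hypothesis UQ : unramified_quadratic v tau nu pi red.

Local Notation vge := (val_ge v).
Local Notation eta := (@quadratic_char R E).

Let vP := uq_val UQ.
Let tauK := uq_tauK UQ.
Let two0 : (2%:R : L) != 0. Proof. by case: (uq_two UQ). Qed.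
Let v_two : v 2%:R = 0. Proof. by case: (uq_two UQ). Qed.
Let nu0 : nu != 0. Proof. by case: (uq_nu UQ). Qed.
Let tau_nu : tau nu = - nu. Proof. by case: (uq_nu UQ). Qed.
Let v_nu : v nu = 0. Proof. by case: (uq_nu UQ). Qed.
Let pi0 : pi != 0. Proof. by case: (uq_pi UQ). Qed.
Let tau_pi : tau pi = pi. Proof. by case: (uq_pi UQ). Qed.
Let v_pi : v pi = 1. Proof. by case: (uq_pi UQ). Qed.

Lemma val_ge_tau n x : vge n (tau x) <-> vge n x.
Proof.
have aux y : vge n y -> vge n (tau y).
  by move=> [->|h]; [left; rewrite rmorph0|right; rewrite (uq_v_tau UQ)].
by split=> /aux; rewrite ?tauK.
Qed.

(** * Coordinates with respect to [1] and [nu], and their residues *)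

Definition qcoord0 (x : L) : L := (x + tau x) / 2%:R.
Definition qcoord1 (x : L) : L := (x - tau x) / (2%:R * nu).

Lemma coordE x : x = qcoord0 x + qcoord1 x * nu.
Proof. by rewrite /qcoord0 /qcoord1; field; rewrite two0 nu0. Qed.

Lemma tau_qcoord0 x : tau (qcoord0 x) = qcoord0 x.
Proof. by rewrite /qcoord0 fmorph_div rmorphD /= tauK rmorph_nat addrC. Qed.

Lemma tau_qcoord1 x : tau (qcoord1 x) = qcoord1 x.
Proof.
rewrite /qcoord1 fmorph_div rmorphB rmorphM /= tauK rmorph_nat tau_nu.
by field; rewrite oppr_eq0 two0 nu0.
Qed.

Lemma coord_eq a b : tau a = a -> tau b = b -> qcoord0 (a + b * nu) = a /\ qcoord1 (a + b * nu) = b.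
Proof.
move=> ta tb; rewrite /qcoord0 /qcoord1 rmorphD rmorphM /= ta tb tau_nu.
by split; field; rewrite ?two0 ?nu0.
Qed.

Lemma qcoord0_fix a : tau a = a -> qcoord0 a = a.
Proof. by move=> ta; rewrite /qcoord0 ta; field. Qed.

Lemma qcoord1_fix a : tau a = a -> qcoord1 a = 0.
Proof. by move=> ta; rewrite /qcoord1 ta subrr mul0r. Qed.

Lemma qcoord0D x y : qcoord0 (x + y) = qcoord0 x + qcoord0 y.
Proof. by rewrite /qcoord0 rmorphD /=; field. Qed.
Lemma qcoord1D x y : qcoord1 (x + y) = qcoord1 x + qcoord1 y.
Proof. by rewrite /qcoord1 rmorphD /=; field; rewrite two0 nu0. Qed.
Lemma qcoord0N x : qcoord0 (- x) = - qcoord0 x.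
Proof. by rewrite /qcoord0 rmorphN /=; field. Qed.
Lemma qcoord1N x : qcoord1 (- x) = - qcoord1 x.
Proof. by rewrite /qcoord1 rmorphN /=; field; rewrite two0 nu0. Qed.

Lemma qcoord0M x y : qcoord0 (x * y) = qcoord0 x * qcoord0 y + qcoord1 x * qcoord1 y * nu ^+ 2.
Proof. by rewrite /qcoord0 /qcoord1 rmorphM /=; field; rewrite two0 nu0. Qed.
Lemma qcoord1M x y : qcoord1 (x * y) = qcoord0 x * qcoord1 y + qcoord1 x * qcoord0 y.
Proof. by rewrite /qcoord0 /qcoord1 rmorphM /=; field; rewrite two0 nu0. Qed.

Lemma qcoord0_tau x : qcoord0 (tau x) = qcoord0 x.
Proof. by rewrite /qcoord0 tauK addrC. Qed.
Lemma qcoord1_tau x : qcoord1 (tau x) = - qcoord1 x.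
Proof. by rewrite /qcoord1 tauK -mulNr opprB. Qed.

Lemma qcoord0Mf a x : tau a = a -> qcoord0 (a * x) = a * qcoord0 x.
Proof. by move=> ta; rewrite qcoord0M (qcoord0_fix ta) (qcoord1_fix ta) mul0r mul0r addr0. Qed.
Lemma qcoord1Mf a x : tau a = a -> qcoord1 (a * x) = a * qcoord1 x.
Proof. by move=> ta; rewrite qcoord1M (qcoord0_fix ta) (qcoord1_fix ta) mul0r addr0. Qed.

Lemma nu2_fix : tau (nu ^+ 2) = nu ^+ 2.
Proof. by rewrite rmorphXn /= tau_nu sqrrN. Qed.

(** [2] and [nu] are units and [tau] preserves the valuation, so nothing is lost in passing between
    [x] and the pair [x + tau x], [x - tau x]. *)
Lemma val_ge_coord n x : vge n x <-> vge n (qcoord0 x) /\ vge n (qcoord1 x).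
Proof.
have v2 : v 2%:R^-1 = 0 by rewrite (val_inv vP)// (uq_two UQ).2 oppr0.
split=> [h|[h0 h1]].
  have ht : vge n (tau x) by apply/val_ge_tau.
  split; rewrite -[n]addr0; apply: val_geM => //.
  - exact: val_geD.
  - by right; rewrite v2.
  - exact: val_geB.
  right; rewrite (val_inv vP) ?mulf_neq0// (Defs.valM vP)// (uq_two UQ).2.
  by have [_ _ ->] := uq_nu UQ.
rewrite (coordE x); apply: val_geD => //; rewrite -[n]addr0; apply: val_geM => //.
by right; have [_ _ ->] := uq_nu UQ.
Qed.

Definition fixed_integer x := tau x = x /\ vge 0 x.

Lemma fixed_integer_qcoord0 x : vge 0 x -> fixed_integer (qcoord0 x).
Proof. by move=> /val_ge_coord[h _]; split=> //; exact: tau_qcoord0. Qed.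
Lemma fixed_integer_qcoord1 x : vge 0 x -> fixed_integer (qcoord1 x).
Proof. by move=> /val_ge_coord[_ h]; split=> //; exact: tau_qcoord1. Qed.

Lemma fixed_integerD x y : fixed_integer x -> fixed_integer y -> fixed_integer (x + y).
Proof.
by move=> [tx hx] [ty hy]; split; [rewrite rmorphD /= tx ty|exact: val_geD].
Qed.
Lemma fixed_integerM x y : fixed_integer x -> fixed_integer y -> fixed_integer (x * y).
Proof.
by move=> [tx hx] [ty hy]; split; [rewrite rmorphM /= tx ty|rewrite -[0]addr0; exact: val_geM].
Qed.
Lemma fixed_integerN x : fixed_integer x -> fixed_integer (- x).
Proof. by move=> [tx hx]; split; [rewrite rmorphN /= tx|exact: val_geN]. Qed.
Lemma fixed_integer1 : fixed_integer 1.
Proof. by split; [exact: rmorph1|right; rewrite (val_one vP)]. Qed.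
Lemma fixed_integer0 : fixed_integer 0.
Proof. by split; [exact: rmorph0|left]. Qed.
Lemma fixed_integer_nat n : fixed_integer n%:R.
Proof.
elim: n => [|n IHn]; first exact: fixed_integer0.
by rewrite -natr1; apply: fixed_integerD => //; exact: fixed_integer1.
Qed.
Lemma fixed_integer_nu2 : fixed_integer (nu ^+ 2).
Proof.
split; first exact: nu2_fix.
by right; rewrite (val_expr vP)//; have [_ _ ->] := uq_nu UQ.
Qed.
Hint Resolve fixed_integer_qcoord0 fixed_integer_qcoord1 fixed_integerM fixed_integerD
  fixed_integerN
  fixed_integer_nu2 fixed_integer_nat fixed_integer1 fixed_integer0 : core.

Lemma red_add x y : fixed_integer x -> fixed_integer y -> red (x + y) = red x + red y.
Proof. by move=> hx hy; apply: (Defs.redD (uq_red UQ)). Qed.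
Lemma red_mul x y : fixed_integer x -> fixed_integer y -> red (x * y) = red x * red y.
Proof. by move=> hx hy; apply: (Defs.redM (uq_red UQ)). Qed.
Lemma red_one : red 1 = 1.
Proof. exact: (Defs.red1 (uq_red UQ)). Qed.
Lemma red_zero : red 0 = 0.
Proof. by apply/(red_ker (uq_red UQ)); (split; [exact: rmorph0|left]). Qed.
Lemma red_opp x : fixed_integer x -> red (- x) = - red x.
Proof.
by move=> hx; apply/eqP; rewrite -addr_eq0 -red_add ?addNr ?red_zero//; apply: fixed_integerN.
Qed.
Lemma red_nat n : red n%:R = n%:R.
Proof. by elim: n => [|n IHn]; rewrite ?red_zero// -!natr1 red_add// IHn red_one. Qed.
Lemma red_eq0 x : fixed_integer x -> red x = 0 <-> vge 1 x.
Proof.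
move=> hx; split; first by move/(red_ker (uq_red UQ)) => /(_ hx)[].
by move=> h1; apply/(red_ker (uq_red UQ)) => //; split=> //; case: hx.
Qed.

Definition lift_red (t : E) : L := projT1 (cid2 (red_surj (uq_red UQ) t)).
Lemma lift_redP t : fixed_integer (lift_red t).
Proof. by rewrite /lift_red; case: cid2. Qed.
Lemma lift_redK t : red (lift_red t) = t.
Proof. by rewrite /lift_red; case: cid2. Qed.
Hint Resolve lift_redP : core.

Lemma E_two : (2%:R : E) != 0.
Proof.
apply/eqP; rewrite -red_nat => /red_eq0; case=> // [/eqP|]; first by rewrite (negbTE two0).
by rewrite (uq_two UQ).2.
Qed.

(** The quadratic extension of [E] is never formed: an integer reduces to the pair of [res0] and
    [res1], multiplied as if a square root of [nu2_res] were adjoined to [E]. *)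
Definition res0 x : E := red (qcoord0 x).
Definition res1 x : E := red (qcoord1 x).
Definition nu2_res : E := red (nu ^+ 2).

Lemma res0D x y : vge 0 x -> vge 0 y -> res0 (x + y) = res0 x + res0 y.
Proof. by move=> hx hy; rewrite /res0 qcoord0D red_add; auto. Qed.
Lemma res1D x y : vge 0 x -> vge 0 y -> res1 (x + y) = res1 x + res1 y.
Proof. by move=> hx hy; rewrite /res1 qcoord1D red_add; auto. Qed.
Lemma res0N x : vge 0 x -> res0 (- x) = - res0 x.
Proof. by move=> hx; rewrite /res0 qcoord0N red_opp; auto. Qed.
Lemma res1N x : vge 0 x -> res1 (- x) = - res1 x.
Proof. by move=> hx; rewrite /res1 qcoord1N red_opp; auto. Qed.
Lemma res0M x y : vge 0 x -> vge 0 y -> res0 (x * y) = res0 x * res0 y + nu2_res * res1 x * res1 y.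
Proof.
move=> hx hy; have [x0 x1] := (fixed_integer_qcoord0 hx, fixed_integer_qcoord1 hx).
have [y0 y1] := (fixed_integer_qcoord0 hy, fixed_integer_qcoord1 hy).
rewrite /res0 /res1 /nu2_res qcoord0M red_add; auto.
rewrite (red_mul x0 y0) (red_mul (fixed_integerM x1 y1)); last exact: fixed_integer_nu2.
by rewrite (red_mul x1 y1); ring.
Qed.
Lemma res1M x y : vge 0 x -> vge 0 y -> res1 (x * y) = res0 x * res1 y + res1 x * res0 y.
Proof.
move=> hx hy; have [x0 x1] := (fixed_integer_qcoord0 hx, fixed_integer_qcoord1 hx).
have [y0 y1] := (fixed_integer_qcoord0 hy, fixed_integer_qcoord1 hy).
by rewrite /res0 /res1 qcoord1M red_add ?(red_mul x0 y1) ?(red_mul x1 y0); auto.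
Qed.
Lemma res0_fix x : tau x = x -> res0 x = red x.
Proof. by move=> h; rewrite /res0 qcoord0_fix. Qed.
Lemma res1_fix x : tau x = x -> res1 x = 0.
Proof. by move=> h; rewrite /res1 qcoord1_fix// red_zero. Qed.
Lemma res01_eq0 x : vge 0 x -> (res0 x = 0 /\ res1 x = 0) <-> vge 1 x.
Proof. by move=> hx; rewrite val_ge_coord /res0 /res1 !red_eq0; auto. Qed.
Lemma res0_1 : res0 1 = 1. Proof. by rewrite res0_fix ?rmorph1// red_one. Qed.
Lemma res1_1 : res1 1 = 0. Proof. by rewrite res1_fix ?rmorph1. Qed.

(** * The norm-one group and its filtration *)

Definition unitary (g : L) := g * tau g = 1.

Lemma unitary1 : unitary 1. Proof. by rewrite /unitary rmorph1 mulr1. Qed.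
Lemma unitaryN1 : unitary (-1). Proof. by rewrite /unitary rmorphN1 mulrNN mulr1. Qed.
Lemma unitaryM x y : unitary x -> unitary y -> unitary (x * y).
Proof. by rewrite /unitary => hx hy; rewrite rmorphM /= mulrACA hx hy mulr1. Qed.
Lemma unitary_neq0 g : unitary g -> g != 0.
Proof. by move=> h; apply: contra_eq_neq h => ->; rewrite mul0r eq_sym oner_neq0. Qed.
Lemma unitary_inv g : unitary g -> g^-1 = tau g.
Proof. by move=> h; apply: (mulfI (unitary_neq0 h)); rewrite h divff// unitary_neq0. Qed.
Lemma unitaryV g : unitary g -> unitary g^-1.
Proof. by move=> h; rewrite (unitary_inv h) /unitary tauK mulrC. Qed.
Lemma unitary_val g : unitary g -> v g = 0.
Proof.
move=> h; have := Defs.valM vP (unitary_neq0 h) (unitary_neq0 (unitaryV h)).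
by rewrite divff ?unitary_neq0// (val_one vP) (unitary_inv h) (uq_v_tau UQ); lia.
Qed.
Lemma unitary_integer g : unitary g -> vge 0 g.
Proof. by move=> h; right; rewrite unitary_val. Qed.
Hint Resolve unitary_integer : core.
Lemma unitary_val_geMl g n x : unitary g -> vge n (g * x) <-> vge n x.
Proof. by move=> h; rewrite -{1}[n]add0r -(unitary_val h); apply: val_geMl => //;
  exact: unitary_neq0. Qed.
Lemma res0V g : unitary g -> res0 g^-1 = res0 g.
Proof. by move=> h; rewrite /res0 unitary_inv// qcoord0_tau. Qed.
Lemma res1V g : unitary g -> res1 g^-1 = - res1 g.
Proof. by move=> h; rewrite /res1 unitary_inv// qcoord1_tau red_opp; auto. Qed.
Lemma unitary_coord g : unitary g -> qcoord0 g ^+ 2 - nu ^+ 2 * qcoord1 g ^+ 2 = 1.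
Proof.
move=> h; have := qcoord0M g (tau g); rewrite h qcoord0_fix ?rmorph1// qcoord0_tau qcoord1_tau =>
  ->.
by ring.
Qed.
Lemma unitary_red g : unitary g -> res0 g ^+ 2 - nu2_res * res1 g ^+ 2 = 1.
Proof.
move=> h; have := res0M (unitary_integer h) (unitary_integer (unitaryV h)).
rewrite divff ?unitary_neq0// res0_1 res0V// res1V// => ->; by ring.
Qed.
(** Such elements are those that will preserve the lattice [A]; modulo [T_1] only [1] and [-1]
    remain. *)
Lemma res1_eq0 g : unitary g -> res1 g = 0 -> res0 g = 1 \/ res0 g = -1.
Proof.
move=> /unitary_red; move=> + h; rewrite h expr0n mulr0 subr0 => /eqP.
by rewrite sqrf_eq1 => /orP[]/eqP; [left|right].
Qed.

Lemma nu2_res_neq0 : nu2_res != 0.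
Proof. by have := uq_nonsquare UQ 0; rewrite expr0n eq_sym. Qed.

Definition ulevel (i : nat) (g : L) := unitary g /\ vge i%:Z (g - 1).

Lemma ulevel_unitary i g : ulevel i g -> unitary g. Proof. by case. Qed.
Lemma ulevel_le i j g : (i <= j)%N -> ulevel j g -> ulevel i g.
Proof. by move=> ij [Tg hg]; split=> //; apply: val_geW hg; rewrite lez_nat. Qed.
Lemma ulevel1 i : ulevel i 1.
Proof. by split; [exact: unitary1|left; rewrite subrr]. Qed.
Lemma ulevelM i g k : ulevel i g -> ulevel i k -> ulevel i (g * k).
Proof.
move=> [Tg hg] [Tk hk]; split; first exact: unitaryM.
have -> : g * k - 1 = g * (k - 1) + (g - 1) by ring.
by apply: val_geD => //; apply/unitary_val_geMl.
Qed.
Lemma ulevelV i g : ulevel i g -> ulevel i g^-1.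
Proof.
move=> [Tg hg]; split; first exact: unitaryV.
have -> : g^-1 - 1 = g^-1 * - (g - 1) by field; exact: (unitary_neq0 Tg).
by apply/(unitary_val_geMl _ _ (unitaryV Tg)); apply: val_geN.
Qed.

Lemma ulevel_res i g : (0 < i)%N -> ulevel i g -> res0 g = 1 /\ res1 g = 0.
Proof.
move=> i0 /(ulevel_le i0)[Tg hg].
have h1 : vge 0 (g - 1) by apply: val_geW hg.
have [e0 e1] := (res01_eq0 h1).2 hg.
have -> : g = (g - 1) + 1 by rewrite subrK.
have v1 : vge 0 1 by right; rewrite (val_one vP).
by rewrite res0D// res1D// e0 e1 res0_1 res1_1 !add0r.
Qed.

Lemma res_ulevel1 g : unitary g -> res0 g = 1 -> res1 g = 0 -> ulevel 1 g.
Proof.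
move=> Tg g0 g1; split=> //; have v1 : vge 0 (-1) by right; rewrite val_opp// (val_one vP).
have Ig := unitary_integer Tg.
apply/res01_eq0; first exact: val_geD.
rewrite res0D// res1D// res0N ?res1N ?res0_1 ?res1_1 ?g0 ?g1 ?subrr//;
  by right; rewrite (val_one vP).
Qed.

Lemma val_two_add x : vge 1 (x - 1) -> x + 1 != 0 /\ v (x + 1) = 0.
Proof.
move=> hx; have -> : x + 1 = 2%:R + (x - 1) by ring.
by have := val_unitD vP two0; rewrite v_two; apply.
Qed.

Lemma qcoord1_sub1 g : qcoord1 (g - 1) = qcoord1 g.
Proof. by rewrite qcoord1D qcoord1N (qcoord1_fix (rmorph1 tau)) oppr0 addr0. Qed.
Lemma qcoord0_sub1 g : qcoord0 (g - 1) = qcoord0 g - 1.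
Proof. by rewrite qcoord0D qcoord0N (qcoord0_fix (rmorph1 tau)). Qed.

(** In [(c0 + 1) (c0 - 1) = c1^2 nu^2] the first factor is [2] plus a small term, hence a unit. So
    inside [T_1] the level of [g] is read off from [c1] alone. *)
Lemma ulevel_qcoord0 (m : nat) g : ulevel 1 g -> vge m%:Z (qcoord1 g) ->
  vge (2 * m%:Z) (qcoord0 g - 1).
Proof.
move=> [Tg hg] h1; have hc : vge 1 (qcoord0 g - 1).
  have := (val_ge_coord _ _).1 hg => -[+ _].
  by rewrite qcoord0_sub1.
have [s0 vs] := val_two_add hc.
apply/(val_geMl vP _ _ s0); rewrite vs add0r.
have -> : (qcoord0 g + 1) * (qcoord0 g - 1) = qcoord1 g * qcoord1 g * nu ^+ 2.
  transitivity (qcoord0 g ^+ 2 - 1); first by ring.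
  by rewrite -(unitary_coord Tg); ring.
rewrite mulr_natl mulr2n -[_ + _]addr0; apply: val_geM => //; first exact: val_geM.
by right; rewrite (val_expr vP)// v_nu.
Qed.

Lemma ulevel_qcoord1 m g : ulevel m g -> vge m%:Z (qcoord1 g).
Proof. by move=> [_ /val_ge_coord[_]]; rewrite qcoord1_sub1. Qed.

Lemma qcoord1_ulevel m g : ulevel 1 g -> vge m%:Z (qcoord1 g) -> ulevel m g.
Proof.
move=> T1g h1; split; first exact: ulevel_unitary T1g.
apply/val_ge_coord; rewrite qcoord1_sub1 qcoord0_sub1; split=> //.
by apply: val_geW (ulevel_qcoord0 T1g h1); lia.
Qed.

(** [qcoord1] is a logarithm up to third order: the error multiplies some [qcoord0 - 1], of order
    [2 m], by a [qcoord1] of order [m]. *)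
Lemma ulevel_qcoord1M (m : nat) g k : (0 < m)%N -> ulevel m g -> ulevel m k ->
  vge (3 * m%:Z) (qcoord1 (g * k) - (qcoord1 g + qcoord1 k)).
Proof.
move=> m0 Tg Tk; have [g1 k1] := (ulevel_qcoord1 Tg, ulevel_qcoord1 Tk).
have [g0 k0] := (ulevel_qcoord0 (ulevel_le m0 Tg) g1, ulevel_qcoord0 (ulevel_le m0 Tk) k1).
have -> : qcoord1 (g * k) - (qcoord1 g + qcoord1 k) =
  (qcoord0 g - 1) * qcoord1 k + qcoord1 g * (qcoord0 k - 1).
  by rewrite qcoord1M; ring.
have -> : 3 * m%:Z = 2 * m%:Z + m%:Z by lia.
apply: val_geD => //; first exact: val_geM.
by rewrite addrC; apply: val_geM.
Qed.

(** Cayley transform: a rational parametrisation that produces norm-one elements with prescribed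
    leading coefficient, without solving equations. *)
Definition cayley s : L := (1 + s * nu) / (1 - s * nu).

(** A zero of [1 - s^2 nu^2] modulo the uniformizer would make the residue of [nu ^+ 2] a square. *)
Lemma cayley_unit s : fixed_integer s -> 1 - s ^+ 2 * nu ^+ 2 != 0 /\ v (1 - s ^+ 2 * nu ^+ 2) = 0.
Proof.
move=> Os; have Os2 : fixed_integer (s ^+ 2) by rewrite expr2; apply: fixed_integerM.
have On := fixed_integer_nu2; have O1 := fixed_integer1.
have Osn : fixed_integer (s ^+ 2 * nu ^+ 2) by apply: fixed_integerM.
have O1s : fixed_integer (1 - s ^+ 2 * nu ^+ 2) by apply: fixed_integerD => //;
  apply: fixed_integerN.
have : red (1 - s ^+ 2 * nu ^+ 2) != 0.
  rewrite red_add ?red_opp ?(red_mul Os2 On) ?red_one//; last exact: fixed_integerN.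
  rewrite subr_eq0 eq_sym expr2 (red_mul Os Os) -expr2.
  have [->|s0] := eqVneq (red s) 0; first by rewrite expr0n mul0r eq_sym oner_eq0.
  have := uq_nonsquare UQ (red s)^-1; rewrite exprVn; apply: contra_neq => h.
  by rewrite -[LHS]mulr1 -h mulKf// expf_neq0.
have [_ h0] := O1s; move=> sres0.
have n0 : 1 - s ^+ 2 * nu ^+ 2 != 0 by apply: contraNneq sres0 => ->; rewrite red_zero.
split=> //; case: h0 => [/eqP|h0]; first by rewrite (negbTE n0).
apply/eqP; rewrite eq_le h0 andbT leNgt; apply/negP => h1.
by case/eqP: sres0; apply/red_eq0 => //; right; lia.
Qed.

Lemma cayley_neq0 s : fixed_integer s -> 1 - s * nu != 0 /\ 1 + s * nu != 0.
Proof.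
move=> /cayley_unit[+ _].
have -> : 1 - s ^+ 2 * nu ^+ 2 = (1 - s * nu) * (1 + s * nu) by ring.
by rewrite mulf_eq0 negb_or => /andP.
Qed.

Lemma cayley_unitary s : fixed_integer s -> unitary (cayley s).
Proof.
move=> Os; have [n1 n2] := cayley_neq0 Os.
rewrite /unitary /cayley fmorph_div rmorphB rmorphD rmorph1 rmorphM /= Os.1 tau_nu.
by field; rewrite mulrN opprK n1 n2.
Qed.

Lemma cayley_coord s : fixed_integer s ->
  qcoord0 (cayley s) = (1 + s ^+ 2 * nu ^+ 2) / (1 - s ^+ 2 * nu ^+ 2) /\
  qcoord1 (cayley s) = 2%:R * s / (1 - s ^+ 2 * nu ^+ 2).
Proof.
move=> Os; have [n1 n2] := cayley_neq0 Os; have [n3 _] := cayley_unit Os.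
have -> : cayley s = (1 + s ^+ 2 * nu ^+ 2) / (1 - s ^+ 2 * nu ^+ 2) +
    (2%:R * s / (1 - s ^+ 2 * nu ^+ 2)) * nu.
  by rewrite /cayley; field; rewrite exprMn n1 n3.
have ts2 : tau (s ^+ 2 * nu ^+ 2) = s ^+ 2 * nu ^+ 2.
  by rewrite rmorphM !rmorphXn /= Os.1 tau_nu sqrrN.
apply: coord_eq.
  by rewrite fmorph_div rmorphD rmorphB rmorph1 /= ts2.
by rewrite fmorph_div rmorphM rmorphB rmorph1 rmorph_nat /= ts2 Os.1.
Qed.

(** The second coordinate of [cayley x] is [2 x / (1 - x^2 nu^2)], so [x = s / 2] meets [s] up to
    third order. *)
Lemma ulevel_lift_red (m : nat) s : (0 < m)%N -> tau s = s -> vge m%:Z s ->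
  exists2 g, ulevel m g & vge (3 * m%:Z) (qcoord1 g - s).
Proof.
move=> m0 ts hs; pose x := s / 2%:R.
have hx : vge m%:Z x.
  rewrite -[m%:Z]addr0; apply: val_geM => //; by right; rewrite (val_inv vP)// v_two.
have Ox : fixed_integer x.
  split; first by rewrite fmorph_div rmorph_nat /= ts.
  by apply: val_geW hx; lia.
have [n1 n2] := cayley_neq0 Ox; have [n3 v3] := cayley_unit Ox.
have vi : vge 0 (1 - x ^+ 2 * nu ^+ 2)^-1 by right; rewrite (val_inv vP)// v3.
exists (cayley x).
  split; first exact: cayley_unitary.
  have -> : cayley x - 1 = x * (2%:R * nu * (1 + x * nu) * (1 - x ^+ 2 * nu ^+ 2)^-1).
    by rewrite /cayley; field; rewrite exprMn n1 n3.
  rewrite -[m%:Z]addr0; apply: val_geM => //.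
  rewrite -[0]addr0; apply: val_geM => //; rewrite -[0]addr0; apply: val_geM => //.
    by right; rewrite (Defs.valM vP)// v_two v_nu.
  apply: val_geD => //; first by right; rewrite (val_one vP).
  rewrite -[0]addr0; apply: val_geM => //; [by case: Ox|by right; rewrite v_nu].
have [_ ->] := cayley_coord Ox.
have -> : 2%:R * x / (1 - x ^+ 2 * nu ^+ 2) - s = x * x * x * (2%:R * nu ^+ 2 * (1 - x ^+ 2 * nu ^+
  2)^-1).
  have -> : s = 2%:R * x by rewrite /x; field.
  by move: (x) n3 => y n3; field; rewrite exprMn n3.
have -> : 3 * m%:Z = m%:Z + m%:Z + m%:Z + 0 by lia.
apply: val_geM => //; first by do 2![apply: val_geM => //].
rewrite -[0]addr0; apply: val_geM => //.
by right; rewrite (Defs.valM vP) ?expf_neq0// (val_expr vP)// v_two v_nu.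
Qed.

(** For [t = (1 + r) / (1 + tau r)] one has [r - t = (r * tau r - 1) / (1 + tau r)], which is small
    if [1 + r] is a unit. If it is not, [1 - r = 2 - (1 + r)] is one, and [- r] is approximated
    instead. *)
Lemma unitary_approx (j : nat) r : (0 < j)%N -> vge 0 r -> vge j%:Z (r * tau r - 1) ->
  exists2 t, unitary t & vge j%:Z (r - t).
Proof.
move=> j0.
have main s : vge 0 s -> vge j%:Z (s * tau s - 1) -> 1 + s != 0 -> v (1 + s) = 0 ->
    exists2 t, unitary t & vge j%:Z (s - t).
  move=> hs hN s0 vs.
  have ts0 : 1 + tau s != 0 by rewrite -(rmorph1 tau) -rmorphD fmorph_eq0.
  exists ((1 + s) / (1 + tau s)).
    rewrite /unitary fmorph_div !rmorphD rmorph1 /= tauK; field; exact/andP.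
  have -> : s - (1 + s) / (1 + tau s) = (s * tau s - 1) * (1 + tau s)^-1 by field.
  rewrite -[j%:Z]addr0; apply: val_geM => //.
  by right; rewrite (val_inv vP)// -(rmorph1 tau) -rmorphD (uq_v_tau UQ) vs.
move=> hr hN.
have h1 : vge 0 (1 + r) by apply: val_geD => //; right; rewrite (val_one vP).
have [h1'|h1'] := EM (vge 1 (1 + r)).
  have rE : 1 + - r = 2%:R + - (1 + r) by ring.
  have [|n0 v0] := val_unitD (y := - (1 + r)) vP two0.
    by rewrite v_two; apply: val_geN.
  have [||||t Tt ht] := main (- r); rewrite ?rE ?v0//; first exact: val_geN.
    by rewrite rmorphN mulrNN.
  exists (- t); first by rewrite -mulN1r; apply: unitaryM => //; exact: unitaryN1.
  by rewrite (_ : r - - t = - (- r - t)); [apply: val_geN|ring].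
have n0 : 1 + r != 0 by apply: contra_notN h1' => /eqP ->; left.
apply: main => //; case: h1 => [/eqP|h1]; first by rewrite (negbTE n0).
apply/eqP; rewrite eq_le h1 andbT leNgt; apply/negP => h2; apply: h1'; right; lia.
Qed.

(** * Finite nets and finiteness of coset spaces *)

Lemma val_net (m : int) (k : nat) : exists s : seq L,
  forall x, vge m x -> exists2 y, y \in s & vge (m + k%:Z) (x - y).
Proof.
elim: k => [|k [s sP]].
  exists [:: 0] => x hx; exists 0; first by rewrite inE.
  by rewrite !subr0.
pose q := pi ^ (m + k%:Z); have q0 : q != 0 by apply: expfz_neq0.
have vq : v q = m + k%:Z by rewrite (val_exprz vP)// v_pi mul1r.
have tq : tau q = q by rewrite fmorphXz /= tau_pi.
exists [seq y + q * (lift_red p.1 + lift_red p.2 * nu) | y <- s, p <- enum {: E * E}].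
move=> x /sP[y ys hy].
have hz : vge 0 ((x - y) / q).
  by apply/(val_geMl vP _ _ q0); rewrite vq addr0 mulrCA divff// mulr1.
pose p := (res0 ((x - y) / q), res1 ((x - y) / q)).
exists (y + q * (lift_red p.1 + lift_red p.2 * nu)).
  by apply/allpairsP; exists (y, p); rewrite mem_enum.
have -> : x - (y + q * (lift_red p.1 + lift_red p.2 * nu)) =
    q * ((x - y) / q - (lift_red p.1 + lift_red p.2 * nu)) by field.
rewrite -addn1 PoszD addrA -vq; apply/(val_geMl vP) => //.
have [f0 f1] := (lift_redP p.1, lift_redP p.2).
have [e0 e1] := coord_eq f0.1 f1.1.
have hl : vge 0 (lift_red p.1 + lift_red p.2 * nu).
  by apply/val_ge_coord; rewrite e0 e1; split; [case: f0|case: f1].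
have hNl := val_geN vP hl.
apply/res01_eq0; first exact: val_geD.
rewrite res0D// res1D// res0N// res1N// /res0 /res1 e0 e1 !lift_redK.
by rewrite /p /= !subrr.
Qed.

Lemma finite_cosets (M : set L) (m n : int) (cos : L -> set L) :
  (forall g, M g -> vge m g) ->
  (forall g k, M g -> M k -> vge n (g - k) -> cos g = cos k) ->
  finite_set [set cos g | g in M].
Proof.
move=> Mm cosE.
have [s sP] := val_net m (absz (n - m)).
(* Points of the net need not lie in [M]: each is replaced by a nearby element of [M], or by the
   default [0] if there is none, which can only enlarge a finite set. *)
pose rep y := xget 0 [set g | M g /\ vge n (g - y)].
apply: (@sub_finite_set _ _ [set cos (rep y) | y in [set` s]]); last first.
  by apply: finite_image; exact: finite_seq.
move=> _ [g Mg <-]; have [y ys hy] := sP _ (Mm _ Mg).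
have hy' : vge n (g - y) by apply: val_geW hy; lia.
have [Mr hr] : M (rep y) /\ vge n (rep y - y).
  exact: (@xgetPex _ 0 [set g | M g /\ vge n (g - y)] (ex_intro _ g (conj Mg hy'))).
exists y => //; apply: cosE => //.
by rewrite (_ : _ - g = (rep y - y) - (g - y)); [exact: val_geB|ring].
Qed.

(** * The character [Xi], the lattice [A] and the symplectic pairing *)

Variables (Xi : L -> R[i]) (h : int).
Hypothesis WC : weil_character v tau nu pi Xi h.

Lemma XiD x y : Xi (x + y) = Xi x * Xi y. Proof. exact: (wc_add WC). Qed.
Lemma Xi_neq0 x : Xi x != 0. Proof. exact: (wc_neq0 WC). Qed.
Lemma Xi0 : Xi 0 = 1.
Proof. by apply: (mulfI (Xi_neq0 0)); rewrite -XiD addr0 mulr1. Qed.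
Lemma XiN x : Xi (- x) = (Xi x)^-1.
Proof. by apply: (mulfI (Xi_neq0 x)); rewrite -XiD subrr Xi0 divff// Xi_neq0. Qed.
Lemma XiB x y : Xi (x - y) = Xi x / Xi y. Proof. by rewrite XiD XiN. Qed.
Lemma Xi_triv x : vge (2 * h + 1) x -> Xi x = 1. Proof. exact: (wc_trivial WC). Qed.
(** [Xi x] is the square of [Xi (x / 2)], and the latter is its own inverse because [tau] fixes
    [x / 2]. *)
Lemma Xi_fix x : tau x = x -> Xi x = 1.
Proof.
move=> tx; have half : x / 2%:R + x / 2%:R = x by field.
have := wc_tau WC (x / 2%:R); rewrite fmorph_div /= rmorph_nat tx => Xh.
by rewrite -half XiD {1}Xh mulVf// Xi_neq0.
Qed.
Lemma Xi_congr x y : vge (2 * h + 1) (x - y) -> Xi x = Xi y.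
Proof. by move=> /Xi_triv; rewrite XiB => /divr1_eq. Qed.
Lemma Xi_qcoord1 x : Xi x = Xi (qcoord1 x * nu).
Proof. by rewrite {1}(coordE x) XiD Xi_fix ?mul1r// tau_qcoord0. Qed.

Definition pih : L := pi ^ h.
Lemma pih_neq0 : pih != 0. Proof. exact: expfz_neq0. Qed.
Lemma val_pih : v pih = h.
Proof. by rewrite (val_exprz vP)//; have [_ _ ->] := uq_pi UQ; rewrite mul1r. Qed.
Lemma tau_pih : tau pih = pih.
Proof. by rewrite /pih fmorphXz /=; have [_ -> _] := uq_pi UQ. Qed.

Definition sres0 x : E := res0 (x / pih).
Definition sres1 x : E := res1 (x / pih).

Lemma val_ge_divP n x : vge n (x / pih) <-> vge (h + n) x.
Proof. by rewrite -(val_geMl vP n (x / pih) pih_neq0) val_pih mulrC divfK// pih_neq0. Qed.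
Lemma Bs_divP x : vge h x -> vge 0 (x / pih).
Proof. by move=> hx; apply/val_ge_divP; rewrite addr0. Qed.
Hint Resolve Bs_divP : core.

Lemma sres0D x y : vge h x -> vge h y -> sres0 (x + y) = sres0 x + sres0 y.
Proof. by move=> hx hy; rewrite /sres0 mulrDl res0D; auto. Qed.
Lemma sres1D x y : vge h x -> vge h y -> sres1 (x + y) = sres1 x + sres1 y.
Proof. by move=> hx hy; rewrite /sres1 mulrDl res1D; auto. Qed.
Lemma sres0N x : vge h x -> sres0 (- x) = - sres0 x.
Proof. by move=> hx; rewrite /sres0 mulNr res0N; auto. Qed.
Lemma sres1N x : vge h x -> sres1 (- x) = - sres1 x.
Proof. by move=> hx; rewrite /sres1 mulNr res1N; auto. Qed.
Lemma sres0M g x : vge 0 g -> vge h x -> sres0 (g * x) =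
  res0 g * sres0 x + nu2_res * res1 g * sres1 x.
Proof. by move=> hg hx; rewrite /sres0 /sres1 -(mulrA g) (res0M hg); auto. Qed.
Lemma sres1M g x : vge 0 g -> vge h x -> sres1 (g * x) = res0 g * sres1 x + res1 g * sres0 x.
Proof. by move=> hg hx; rewrite /sres0 /sres1 -(mulrA g) (res1M hg); auto. Qed.
Lemma sres01_eq0 x : vge h x -> (sres0 x = 0 /\ sres1 x = 0) <-> vge (h + 1) x.
Proof. by move=> hx; rewrite -val_ge_divP; apply: res01_eq0; auto. Qed.

(* The lattice [A]; the lattices [B] and [B*] are [vge (h + 1)] and [vge h]. *)
Definition latticeA (x : L) := vge h (qcoord0 x) /\ vge (h + 1) (qcoord1 x).

Lemma latticeA_Bs x : latticeA x -> vge h x.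
Proof. by move=> [h0 h1]; apply/val_ge_coord; split=> //; apply: val_geW h1; lia. Qed.
Lemma B_latticeA x : vge (h + 1) x -> latticeA x.
Proof. by move=> /val_ge_coord[h0 h1]; split=> //; apply: val_geW h0; lia. Qed.
Lemma B_Bs x : vge (h + 1) x -> vge h x.
Proof. by apply: val_geW; lia. Qed.
Hint Resolve latticeA_Bs B_latticeA B_Bs : core.
Lemma latticeAE x : vge h x -> latticeA x <-> sres1 x = 0.
Proof.
move=> hx; have /val_ge_coord[h0 h1] := hx.
rewrite /sres1 /res1 red_eq0; last by apply: fixed_integer_qcoord1; auto.
rewrite mulrC qcoord1Mf ?fmorphV /= ?tau_pih//.
rewrite mulrC val_ge_divP; split=> [[]//|//].
Qed.
Lemma latticeAD x y : latticeA x -> latticeA y -> latticeA (x + y).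
Proof. by move=> [? ?] [? ?]; split; rewrite ?qcoord0D ?qcoord1D; apply: val_geD. Qed.
Lemma latticeAN x : latticeA x -> latticeA (- x).
Proof. by move=> [? ?]; split; rewrite ?qcoord0N ?qcoord1N; apply: val_geN. Qed.
Lemma latticeA0 : latticeA 0.
Proof. by apply: B_latticeA; left. Qed.
Hint Resolve latticeAD latticeAN latticeA0 : core.

(** The additive character of [E] induced by [Xi] on [pi^(2 h) O' nu]: another lift changes the
    argument by valuation at least [2 h + 1], where [Xi] is trivial. *)
Definition res_char (t : E) : R[i] := Xi (pih * pih * (lift_red t * nu)).

Lemma res_char_red z : fixed_integer z -> Xi (pih * pih * (z * nu)) = res_char (red z).
Proof.
move=> Oz; apply: Xi_congr; rewrite -mulrBr -mulrBl.
have -> : 2 * h + 1 = v (pih * pih) + 1 by rewrite (Defs.valM vP) ?pih_neq0// val_pih; lia.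
apply/(val_geMl vP); first by rewrite mulf_neq0 ?pih_neq0.
rewrite -[1]addr0; apply: val_geM => //; last by right; have [_ _ ->] := uq_nu UQ.
have Ol := lift_redP (red z).
apply/red_eq0; first exact: (fixed_integerD Oz (fixed_integerN Ol)).
by rewrite red_add ?red_opp ?lift_redK ?subrr//; apply: fixed_integerN.
Qed.

Lemma res_charD s t : res_char (s + t) = res_char s * res_char t.
Proof.
rewrite -{1}(lift_redK s) -{1}(lift_redK t).
have [Os Ot] := (lift_redP s, lift_redP t).
rewrite -red_add// -res_char_red; last exact: fixed_integerD.
by rewrite /res_char -XiD; congr Xi; ring.
Qed.
Lemma res_char_neq0 t : res_char t != 0. Proof. exact: Xi_neq0. Qed.
Lemma res_char_nontrivial : exists t, res_char t != 1.
Proof. by have [z Oz hz] := wc_nontrivial WC; exists (red z); rewrite -res_char_red. Qed.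
Lemma res_char0 : res_char 0 = 1. Proof. exact: additive_char0 res_charD res_char_neq0. Qed.

(** In the setting this is [psi (beta x y / 2)], the multiplicative version of the symplectic
    form. *)
Definition pairing (x y : L) : R[i] := Xi (tau x * y).

Lemma pairing_neq0 x y : pairing x y != 0. Proof. exact: Xi_neq0. Qed.
Lemma pairingDl x y z : pairing (x + y) z = pairing x z * pairing y z.
Proof. by rewrite /pairing rmorphD mulrDl XiD. Qed.
Lemma pairingDr x y z : pairing x (y + z) = pairing x y * pairing x z.
Proof. by rewrite /pairing mulrDr XiD. Qed.
Lemma pairingNl x y : pairing (- x) y = (pairing x y)^-1.
Proof. by rewrite /pairing rmorphN mulNr XiN. Qed.
Lemma pairingNr x y : pairing x (- y) = (pairing x y)^-1.
Proof. by rewrite /pairing mulrN XiN. Qed.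
Lemma pairing_sym x y : pairing y x = (pairing x y)^-1.
Proof. by rewrite /pairing -(wc_tau WC) rmorphM /= tauK mulrC. Qed.
Lemma pairing_unitary g x y : unitary g -> pairing (g * x) (g * y) = pairing x y.
Proof.
by move=> Tg; rewrite /pairing rmorphM /= mulrACA [tau g * g]mulrC Tg mul1r.
Qed.
Lemma pairing_unitaryVr g x y : unitary g -> pairing x (g^-1 * y) = pairing (g * x) y.
Proof. by move=> Tg; rewrite -(pairing_unitary x (g^-1 * y) Tg) mulVKf// (unitary_neq0 Tg). Qed.
Lemma pairing_fix x y : tau x = x -> tau y = y -> pairing x y = 1.
Proof. by move=> tx ty; apply: Xi_fix; rewrite rmorphM /= tauK tx ty. Qed.
Lemma pairing_val m n x y : vge m x -> vge n y -> 2 * h + 1 <= m + n -> pairing x y = 1.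
Proof.
move=> hx hy mn; apply: Xi_triv; apply: val_geW mn _.
by apply: val_geM => //; apply/val_ge_tau.
Qed.
(** [Xi] sees only the coordinate of [tau x * y] along [nu], and this reduces to the standard
    symplectic form of a plane over [E]. In that plane [A / B] is the line where the second
    coordinate vanishes. *)
Lemma pairing_res_char x y : vge h x -> vge h y -> pairing x y =
  res_char (sres0 x * sres1 y - sres1 x * sres0 y).
Proof.
move=> hx hy; have [vx vy] := (Bs_divP hx, Bs_divP hy).
have vtx : vge 0 (tau (x / pih)) by apply/val_ge_tau.
have -> : pairing x y = Xi (pih * pih * (qcoord1 (tau (x / pih) * (y / pih)) * nu)).
  rewrite /pairing Xi_qcoord1; congr Xi; rewrite mulrA; congr (_ * nu).
  rewrite -qcoord1Mf ?rmorphM /= ?tau_pih//; congr qcoord1.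
  by rewrite fmorphV /= tau_pih; field; rewrite pih_neq0.
have vxy : vge 0 (tau (x / pih) * (y / pih)) by rewrite -[0]addr0; apply: val_geM.
rewrite res_char_red; last exact: fixed_integer_qcoord1.
congr res_char; rewrite -/(res1 _) res1M// /sres0 /sres1 /res0 /res1 qcoord0_tau qcoord1_tau
  red_opp ?mulNr//.
exact: fixed_integer_qcoord1.
Qed.
Lemma pairing_latticeA x y : latticeA x -> latticeA y -> pairing x y = 1.
Proof.
move=> Ax Ay; rewrite pairing_res_char; auto.
by rewrite (latticeAE (latticeA_Bs Ax)).1// (latticeAE (latticeA_Bs Ay)).1// mulr0 mul0r subrr
  res_char0.
Qed.

(** Representatives of [A / B], while [lift_anti] represents [B* / A]. Neither map need be additive;
    only the residues are. *)
Definition lift_fix (t : E) : L := pih * lift_red t.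
Definition lift_anti (t : E) : L := pih * lift_red t * nu.

Lemma tau_lift_fix t : tau (lift_fix t) = lift_fix t.
Proof. by rewrite rmorphM /= tau_pih (lift_redP t).1. Qed.
Lemma lift_fix_Bs t : vge h (lift_fix t).
Proof.
rewrite -[h]addr0 -{1}val_pih; apply/(val_geMl vP); first exact: pih_neq0.
exact: (lift_redP t).2.
Qed.
Lemma sres0_lift_fix t : sres0 (lift_fix t) = t.
Proof. by rewrite /sres0 /lift_fix mulrC mulKf ?pih_neq0// res0_fix ?lift_redK// (lift_redP t).1.
  Qed.
Lemma sres1_lift_fix t : sres1 (lift_fix t) = 0.
Proof. by rewrite /sres1 /lift_fix mulrC mulKf ?pih_neq0// res1_fix// (lift_redP t).1. Qed.
Lemma lift_fix_latticeA t : latticeA (lift_fix t).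
Proof. by apply/latticeAE; [exact: lift_fix_Bs|exact: sres1_lift_fix]. Qed.
Lemma lift_anti_Bs t : vge h (lift_anti t).
Proof.
rewrite /lift_anti -[h]addr0; apply: val_geM => //; first exact: lift_fix_Bs.
by right; have [_ _ ->] := uq_nu UQ.
Qed.
Lemma sres01_lift_anti t : sres0 (lift_anti t) = 0 /\ sres1 (lift_anti t) = t.
Proof.
rewrite /sres0 /sres1 /res0 /res1 /lift_anti mulrAC [pih * _]mulrC mulfK ?pih_neq0//.
have /= := coord_eq (rmorph0 _) (lift_redP t).1.
by rewrite add0r => -[-> ->]; rewrite red_zero lift_redK.
Qed.
Lemma sres0_lift_anti t : sres0 (lift_anti t) = 0. Proof. by case: (sres01_lift_anti t). Qed.
Lemma sres1_lift_anti t : sres1 (lift_anti t) = t. Proof. by case: (sres01_lift_anti t). Qed.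
Hint Resolve lift_fix_Bs lift_fix_latticeA lift_anti_Bs : core.

Lemma Bs_sres_eq x y : vge h x -> vge h y -> sres0 x = sres0 y -> sres1 x = sres1 y ->
  vge (h + 1) (x - y).
Proof.
move=> hx hy e0 e1; have hN : vge h (- y) by apply: val_geN.
by apply/sres01_eq0; [exact: val_geB|rewrite sres0D// sres1D// sres0N// sres1N// e0 e1 !subrr].
Qed.
Lemma latticeA_sres1_eq x y : vge h x -> vge h y -> sres1 x = sres1 y -> latticeA (x - y).
Proof.
move=> hx hy e1; have hN : vge h (- y) by apply: val_geN.
by apply/latticeAE; [exact: val_geB|rewrite sres1D// sres1N// e1 subrr].
Qed.

(** * The operators of the torus and their composition *)

Definition quasi_inv (phi : L -> R[i]) :=
  forall a w, latticeA a -> phi (a + w) = pairing w a * phi w.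

Definition weil_term g (phi : L -> R[i]) (w a : L) := pairing a w * phi (g^-1 * (a + w)).

(** The phase that [phi] acquires under translation by [g^-1 * b] cancels the factor [pairing b w],
    up to [pairing a b]. The summand thus depends only on [a] modulo [A \cap g A]. *)
Lemma weil_term_shift g phi w a b : unitary g -> quasi_inv phi -> latticeA (g^-1 * b) ->
  pairing a b = 1 ->
  weil_term g phi w (a + b) = weil_term g phi w a.
Proof.
move=> Tg Mphi Ab eab; rewrite /weil_term.
have -> : g^-1 * (a + b + w) = g^-1 * b + g^-1 * (a + w) by ring.
rewrite Mphi//.
rewrite pairing_unitary; last exact: unitaryV.
rewrite !pairingDl eab (pairing_sym b w); field; exact: pairing_neq0.
Qed.

(** The sum always runs over [A / B]. This is [A / (A \cap g A)] when [res1 g] is non-zero; when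
    [g A = A] its [#|E|] terms are equal, and [weil_const] divides by their number. *)
Definition weil_sum g phi w := \sum_t weil_term g phi w (lift_fix t).

Lemma weil_sum_reindex g phi w (s : E -> E) (a : E -> L) : unitary g -> quasi_inv phi ->
  injective s -> (forall t, latticeA (a t)) -> (forall t, sres0 (a t) = s t) ->
  \sum_t weil_term g phi w (a t) = weil_sum g phi w.
Proof.
move=> Tg Mphi s_inj aA as_; rewrite /weil_sum [RHS](reindex_inj s_inj) /=; apply: eq_bigr => t _.
have aB : vge (h + 1) (a t - lift_fix (s t)).
  by apply: Bs_sres_eq; rewrite ?sres0_lift_fix ?sres1_lift_fix //; auto; apply/latticeAE; auto.
rewrite -{1}(subrK (lift_fix (s t)) (a t)) addrC weil_term_shift//.
  by apply: B_latticeA; apply/(unitary_val_geMl _ _ (unitaryV Tg)).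
by apply: (pairing_val (lift_fix_Bs _) aB); lia.
Qed.

Lemma latticeA_unitary g b : unitary g -> res1 g = 0 -> latticeA b -> latticeA (g * b).
Proof.
move=> Tg g1 Ab; have hb := latticeA_Bs Ab.
have hgb : vge h (g * b) by apply/unitary_val_geMl.
by apply/(latticeAE hgb); rewrite (sres1M (unitary_integer Tg))// g1 mul0r (latticeAE hb).1// mulr0
  addr0.
Qed.

Lemma weil_sum_parabolic g phi w : unitary g -> quasi_inv phi -> res1 g = 0 ->
  weil_sum g phi w = #|E|%:R * phi (g^-1 * w).
Proof.
move=> Tg Mphi g1; rewrite mulr_natl -sumr_const; apply: eq_bigr => t _.
rewrite -[lift_fix t]add0r weil_term_shift//; first
  by rewrite /weil_term add0r /pairing rmorph0 mul0r Xi0 mul1r.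
  by apply: latticeA_unitary; rewrite ?res1V// ?g1 ?oppr0//; exact: unitaryV.
by rewrite /pairing rmorph0 mul0r Xi0.
Qed.

Lemma quasi_inv_weil_sum g phi : unitary g -> quasi_inv phi -> quasi_inv (weil_sum g phi).
Proof.
move=> Tg Mphi a w Aa.
rewrite -(@weil_sum_reindex g phi w (fun t => t + sres0 a) (fun t => lift_fix t + a)) //.
- rewrite mulr_sumr; apply: eq_bigr => t _; rewrite /weil_term addrA.
  rewrite pairingDl pairingDr (pairing_latticeA (lift_fix_latticeA t) Aa) (pairing_sym w a);
    field; exact: pairing_neq0.
- exact: addIr.
- by auto.
by move=> t; rewrite sres0D ?sres0_lift_fix; auto.
Qed.

Local Notation G := (gauss res_char).

(** The value later found for [m(g) q^(j / 2) / [A : A \cap g A]], with a further factor [1 / #|E|]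
    when [g A = A] to make up for the repetitions in [weil_sum]. *)
Definition weil_const g : R[i] :=
  if res1 g != 0 then (G (res1 g))^-1
  else if res0 g == 1 then #|E|%:R^-1 else eta (-1) / #|E|%:R.

Definition weilS g phi w := weil_const g * weil_sum g phi w.

Lemma quasi_inv_S g phi : unitary g -> quasi_inv phi -> quasi_inv (weilS g phi).
Proof. by move=> Tg Mphi a w Aa; rewrite /weilS quasi_inv_weil_sum//; ring. Qed.

Let cardE_neq0 : #|E|%:R != 0 :> R[i] := card_field_neq0 R E.
Let E2 := E_two.
Let res_char_gaussE := gaussE E2 res_charD res_char_neq0 res_char_nontrivial.
Let res_char_gauss_neq0 := gauss_neq0 E2 res_charD res_char_neq0 res_char_nontrivial.

Lemma weil_sum_comp_parabolic_l g k phi w : unitary g -> unitary k -> quasi_inv phi -> res1 g = 0 ->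
  weil_sum g (weil_sum k phi) w = #|E|%:R * weil_sum (g * k) phi w.
Proof.
move=> Tg Tk Mphi g1; rewrite weil_sum_parabolic//; last exact: quasi_inv_weil_sum.
congr (_ * _).
rewrite -(@weil_sum_reindex (g * k) phi w (fun t => res0 g * t) (fun t => g * lift_fix t)) //.
- apply: eq_bigr => t _; rewrite /weil_term pairing_unitaryVr//; congr (_ * phi _).
  by field; rewrite (unitary_neq0 Tg) (unitary_neq0 Tk).
- exact: unitaryM.
- apply: mulfI; apply/eqP => g0; have := unitary_red Tg.
  by rewrite g0 g1 !expr0n /= mulr0 subr0 => /eqP; rewrite eq_sym oner_eq0.
- by move=> t; apply: latticeA_unitary.
by move=> t; rewrite sres0M ?sres0_lift_fix ?sres1_lift_fix ?mulr0 ?addr0//; exact: unitary_integer.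
Qed.

Lemma weil_sum_comp_parabolic_r g k phi w : unitary g -> unitary k -> quasi_inv phi -> res1 k = 0 ->
  weil_sum g (weil_sum k phi) w = #|E|%:R * weil_sum (g * k) phi w.
Proof.
move=> Tg Tk Mphi k1; rewrite [in RHS]/weil_sum mulr_sumr; apply: eq_bigr => t _.
by rewrite /weil_term weil_sum_parabolic// mulrCA; congr (_ * (_ * phi _)); field;
  rewrite (unitary_neq0 Tg) (unitary_neq0 Tk).
Qed.

Lemma weil_sum_comp_weil_term g k phi w : unitary g -> unitary k -> quasi_inv phi ->
  weil_sum g (weil_sum k phi) w = \sum_b \sum_a
    pairing (lift_fix a) w * pairing (g * lift_fix b) (lift_fix a + w) * phi ((g * k)^-1 * (g *
      lift_fix b + lift_fix a + w)).
Proof.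
move=> Tg Tk Mphi; rewrite exchange_big; apply: eq_bigr => a _.
rewrite /weil_term /weil_sum mulr_sumr; apply: eq_bigr => b _;
  rewrite /weil_term pairing_unitaryVr// mulrA; congr (_ * phi _).
by field; rewrite (unitary_neq0 Tg) (unitary_neq0 Tk).
Qed.

(** Here [g k] preserves [A], so the vector [a] leaves [phi] as a phase, and the sum over [a] is a
    full character sum that forces [b = 0]. *)
Lemma weil_sum_comp_inverse g k phi w : unitary g -> unitary k -> quasi_inv phi -> res1 g != 0 ->
  res1 (g * k) = 0 ->
  weil_sum g (weil_sum k phi) w = weil_sum (g * k) phi w.
Proof.
move=> Tg Tk Mphi g1 gk1; have Tgk := unitaryM Tg Tk.
rewrite weil_sum_comp_weil_term//.
transitivity (\sum_b pairing (g * lift_fix b) w * phi ((g * k)^-1 * (g * lift_fix b + w)) *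
   \sum_a res_char (- (2%:R * res1 g * b) * a)).
  apply: eq_bigr => b _; rewrite mulr_sumr; apply: eq_bigr => a _.
  have -> : (g * k)^-1 * (g * lift_fix b + lift_fix a + w) =
      (g * k)^-1 * lift_fix a + (g * k)^-1 * (g * lift_fix b + w) by ring.
  rewrite Mphi; last by apply: latticeA_unitary; rewrite ?res1V// ?gk1 ?oppr0//; exact: unitaryV.
  rewrite pairing_unitary; last exact: unitaryV.
  (* The phase produced by [phi] repeats the one already present, whence the square and the factor
     [2]; the phases in [w] cancel. *)
  have -> : res_char (- (2%:R * res1 g * b) * a) = pairing (g * lift_fix b) (lift_fix a) ^+ 2.
    have hgb : vge h (g * lift_fix b) by apply/unitary_val_geMl.
    rewrite pairing_res_char// expr2 -res_charD sres0_lift_fix sres1_lift_fix mulr0 sub0r.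
    rewrite sres1M ?sres0_lift_fix ?sres1_lift_fix ?mulr0 ?add0r//; last exact: unitary_integer.
    by congr res_char; ring.
  rewrite pairingDr pairingDl (pairing_sym (lift_fix a) w); field; exact: pairing_neq0.
under eq_bigr => b _ do rewrite (sum_additive_char res_charD res_char_neq0 res_char_nontrivial).
rewrite (bigD1 0) //= big1 => [|b b0]; last first.
  by rewrite oppr_eq0 !mulf_eq0 (negbTE E2) (negbTE g1) (negbTE b0) mul0r mulr0.
rewrite mulr0 oppr0 eqxx mul1r addr0.
rewrite weil_sum_parabolic// mulrC; congr (_ * _).
have a0B : vge (h + 1) (g * lift_fix 0).
  apply/(unitary_val_geMl _ _ Tg); apply/sres01_eq0; first exact: lift_fix_Bs.
  by rewrite sres0_lift_fix sres1_lift_fix.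
rewrite -[g * lift_fix 0]add0r -/(weil_term _ _ _ _) weil_term_shift//.
- by rewrite /weil_term add0r /pairing rmorph0 mul0r Xi0 mul1r.
- by apply: B_latticeA; apply/(unitary_val_geMl _ _ (unitaryV Tgk)).
by rewrite /pairing rmorph0 mul0r Xi0.
Qed.

(** Modulo [g k A] the vector [g b + a] can be replaced by a vector of [A]. This completes the
    square: what remains besides the summand of [g k] is a phase quadratic in [b] alone, and its sum
    is the Gauss sum. *)
Lemma weil_sum_comp_generic g k phi w : unitary g -> unitary k -> quasi_inv phi ->
  res1 g != 0 -> res1 k != 0 -> res1 (g * k) != 0 ->
  weil_sum g (weil_sum k phi) w = G (res1 g * res1 k / res1 (g * k)) * weil_sum (g * k) phi w.
Proof.
move=> Tg Tk Mphi g1 k1 l1; have Tl := unitaryM Tg Tk; set l := g * k.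
have [Ig Ik Il] := And3 (unitary_integer Tg) (unitary_integer Tk) (unitary_integer Tl).
rewrite weil_sum_comp_weil_term// /gauss mulr_suml; apply: eq_bigr => b _.
(* The multiple of [b] is forced by the requirement that [l^-1 * (g b + a - c a)] lie in [A]; the
   identity [key] below confirms it. *)
pose c t := lift_fix (t + res1 k / res1 l * b).
have hgb : vge h (g * lift_fix b) by apply/unitary_val_geMl.
rewrite -(@weil_sum_reindex l phi w (fun t => t + res1 k / res1 l * b) c) //; last first.
- by move=> t; rewrite sres0_lift_fix.
- by move=> t; exact: lift_fix_latticeA.
- exact: addIr.
rewrite mulr_sumr; apply: eq_bigr => a _.
pose z := g * lift_fix b + lift_fix a - c a.
have Az : latticeA (l^-1 * z).
  have hz : vge h z by apply: val_geB => //; [apply: val_geD => //; auto|exact: lift_fix_Bs].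
  have hlz : vge h (l^-1 * z) by apply/(unitary_val_geMl _ _ (unitaryV Tl)).
  apply/(latticeAE hlz); rewrite sres1M//; last exact: (unitary_integer (unitaryV Tl)).
  rewrite res0V// res1V//.
  have hc : vge h (- c a) by apply: val_geN => //; exact: lift_fix_Bs.
  have hga : vge h (g * lift_fix b + lift_fix a) by apply: val_geD.
  rewrite /z !(sres0D, sres1D)// sres0N ?sres1N; try exact: lift_fix_Bs.
  rewrite (sres0M Ig (lift_fix_Bs b)) (sres1M Ig (lift_fix_Bs b)) !(sres0_lift_fix, sres1_lift_fix).
  have key : res1 k = res1 l * res0 g - res0 l * res1 g.
    rewrite /l res0M// res1M// -{1}[res1 k]mulr1 -(unitary_red Tg); ring.
  by rewrite key; field; exact: l1.
have -> : l^-1 * (g * lift_fix b + lift_fix a + w) = l^-1 * z + l^-1 * (c a + w) by rewrite /z;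
  ring.
rewrite Mphi// pairing_unitary; last exact: unitaryV.
have -> : res_char (res1 g * res1 k / res1 l * b ^+ 2) =
  pairing (c a - lift_fix a) (g * lift_fix b).
  have hN : vge h (- lift_fix a) by apply: val_geN => //; exact: lift_fix_Bs.
  have hc : vge h (c a) by exact: lift_fix_Bs.
  rewrite pairing_res_char ?sres0D ?sres1D ?sres0N ?sres1N//; try (by auto); last exact: val_geD.
  rewrite (sres0M Ig (lift_fix_Bs b)) (sres1M Ig (lift_fix_Bs b)) !(sres0_lift_fix, sres1_lift_fix).
  by congr res_char; field; exact: l1.
rewrite /weil_term /z.
have eca : pairing (c a) (lift_fix a) = 1 by apply: pairing_fix; exact: tau_lift_fix.
have ecc : pairing (c a) (c a) = 1 by apply: pairing_fix; exact: tau_lift_fix.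
rewrite !(pairingDl, pairingDr, pairingNl, pairingNr) eca ecc (pairing_sym (c a) w) (pairing_sym
  (lift_fix a) w) (pairing_sym (lift_fix a) (g * lift_fix b)) (pairing_sym w (g * lift_fix b)).
by field; rewrite ?pairing_neq0.
Qed.

(** The four composition formulas above define a cocycle, and [weil_const] trivialises it by means
    of [G x * G (- x) = #|E|] and [G x = eta x * G 1]. *)
Lemma weilS_comp g k phi w : unitary g -> unitary k -> quasi_inv phi ->
  weilS g (weilS k phi) w = weilS (g * k) phi w.
Proof.
move=> Tg Tk Mphi; have Tl := unitaryM Tg Tk.
have [Ig Ik] := (unitary_integer Tg, unitary_integer Tk).
have Sl : weilS g (weilS k phi) w = weil_const g * weil_const k * weil_sum g (weil_sum k phi) w.
  rewrite -mulrA; congr (_ * _).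
  have -> : weil_sum g (weil_sum k phi) w = \sum_t weil_term g (weil_sum k phi) w (lift_fix t)
    by [].
  by rewrite mulr_sumr; apply: eq_bigr => t _; rewrite /weil_term /weilS mulrCA.
rewrite Sl /weilS.
have etaN1 : eta (-1) ^+ 2 = 1 by apply: quadratic_char_expr2; rewrite oppr_eq0 oner_eq0.
have GN (x : E) : x != 0 -> G (- x) = eta (-1) * G x.
  move=> x0; have gE := gaussE E2 res_charD res_char_neq0 res_char_nontrivial.
  rewrite (gE (- x)) ?oppr_eq0// (gE x)// mulrA -quadratic_charM//.
  by rewrite mulN1r.
have eta0 : eta (-1) != 0 by apply: quadratic_char_neq0; rewrite oppr_eq0 oner_eq0.
have etaV : (eta (-1))^-1 = eta (-1).
  by apply: (mulfI eta0); rewrite divff// -expr2 etaN1.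
have N11 : (-1 : E) != 1.
  by rewrite eq_sym -subr_eq0 opprK -(natrD _ 1 1).
have cst_par_l (x y : L) : unitary x -> unitary y -> res1 x = 0 ->
  weil_const x * weil_const y * #|E|%:R = weil_const (x * y).
  move=> Tx Ty x1; have [Ix Iy] := (unitary_integer Tx, unitary_integer Ty).
  rewrite /weil_const res1M// res0M// x1 eqxx /= !(mulr0, mul0r, addr0).
  have [->|->] := res1_eq0 Tx x1.
    by rewrite eqxx !mul1r mulrAC mulVf// mul1r.
  rewrite (negbTE N11) !mulN1r oppr_eq0 mulrAC divfK//; case: ifP => y1.
    by rewrite GN// invfM etaV.
  have [->|->] := res1_eq0 Ty (eqP (negbFE y1)).
    by rewrite eqxx (negbTE N11).
  by rewrite opprK eqxx (negbTE N11) mulrA -expr2 etaN1 mul1r.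
have [g1|g1] := eqVneq (res1 g) 0.
  by rewrite weil_sum_comp_parabolic_l// mulrA cst_par_l.
have [k1|k1] := eqVneq (res1 k) 0.
  by rewrite weil_sum_comp_parabolic_r// mulrA [weil_const g * _]mulrC cst_par_l// [k * g]mulrC.
have [l1|l1] := eqVneq (res1 (g * k)) 0.
  rewrite weil_sum_comp_inverse//; congr (_ * _); rewrite /weil_const g1 k1 l1 eqxx /=.
  have Ni : res0 g ^+ 2 - nu2_res * res1 g ^+ 2 = 1 := unitary_red Tg.
  have kE : k = g^-1 * (g * k) by rewrite mulKf// (unitary_neq0 Tg).
  have [Igi Il] := (unitary_integer (unitaryV Tg), unitary_integer Tl).
  have k1E : res1 k = - res1 g * res0 (g * k).
    by rewrite {1}kE res1M// l1 mulr0 add0r res1V.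
  have [l0|l0] := res1_eq0 Tl l1; rewrite k1E l0.
    rewrite eqxx mulr1 -invfM; congr (_^-1).
    exact: (gaussN E2 res_charD res_char_neq0 res_char_nontrivial g1).
  rewrite (negbTE N11) mulrN1 opprK -(gaussN E2 res_charD res_char_neq0 res_char_nontrivial g1)
    GN//.
  by field; rewrite eta0 res_char_gauss_neq0.
rewrite weil_sum_comp_generic// mulrA; congr (_ * _); rewrite /weil_const g1 k1 l1.
have gE := gaussE E2 res_charD res_char_neq0 res_char_nontrivial.
have G10 : G 1 != 0 by apply: res_char_gauss_neq0; exact: oner_neq0.
have e0 (x : E) : x != 0 -> eta x != 0 := @quadratic_char_neq0 R E x.
rewrite (gE (res1 g))// (gE (res1 k))// (gE (res1 (g * k)))// (gE (_ / _)); last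
  by rewrite !mulf_neq0 ?invr_eq0.
have eV (x : E) : x != 0 -> eta x^-1 = (eta x)^-1.
  move=> x0; rewrite quadratic_charV//; apply: (mulfI (e0 _ x0)).
  by rewrite divff ?e0// -expr2 quadratic_char_expr2.
rewrite !quadratic_charM// eV//.
by field; rewrite G10 !e0.
Qed.

(** * Action near the identity, support of weight vectors, and norms *)

Lemma val_ge_norm n w : vge n w -> vge (n + n) (w * tau w).
Proof. by move=> hw; apply: val_geM => //; apply/val_ge_tau. Qed.

Lemma norm_fix w : tau (w * tau w) = w * tau w.
Proof. by rewrite rmorphM /= tauK mulrC. Qed.

Lemma weilS_unipotent g phi w : ulevel 1 g -> quasi_inv phi -> weilS g phi w = phi (g^-1 * w).
Proof.
move=> Tg Mphi; have [g0 g1] := ulevel_res (ltn0Sn 0) Tg.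
rewrite /weilS (weil_sum_parabolic _ (ulevel_unitary Tg) Mphi g1) /weil_const g1 g0 !eqxx /=
  mulKf//.
Qed.

(** [g^-1 * w - w] lies in [B], so quasi-invariance turns the translation into the phase
    [Xi (tau w * (g^-1 - 1) * w)], in which [w] enters only through its norm. *)
Lemma weilS_small (j : nat) g phi w : ulevel j.+1 g -> quasi_inv phi -> vge (h - j%:Z) w ->
  weilS g phi w = Xi (- (w * tau w * g)) * phi w.
Proof.
move=> Tg Mphi hw; have Tgi := ulevelV Tg.
rewrite (weilS_unipotent _ (ulevel_le (ltn0Sn j) Tg) Mphi).
have -> : g^-1 * w = (g^-1 - 1) * w + w by ring.
rewrite Mphi; last first.
  apply: B_latticeA; have -> : h + 1 = (j.+1)%:Z + (h - j%:Z) by lia.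
  by apply: val_geM => //; case: Tgi.
congr (_ * _); rewrite /pairing.
have -> : tau w * ((g^-1 - 1) * w) = tau (w * tau w * g) - w * tau w.
  by rewrite !rmorphM /= tauK (unitary_inv (ulevel_unitary Tg)); ring.
by rewrite XiB (Xi_fix (norm_fix w)) divr1 (wc_tau WC) XiN.
Qed.

Lemma Xi_fixM N g : tau N = N -> Xi (- (N * g)) = Xi (- (N * qcoord1 g * nu)).
Proof. by move=> tN; rewrite !XiN (Xi_qcoord1 (N * g)) (qcoord1Mf _ tN). Qed.

Lemma Xi_fixM1 N g n : tau N = N -> vge n N -> vge (2 * h + 1 - n) (qcoord1 g) -> Xi (- (N * g)) =
  1.
Proof.
move=> tN hN hg; rewrite Xi_fixM//; apply: Xi_triv; apply: val_geN => //.
have -> : 2 * h + 1 = n + (2 * h + 1 - n) + 0 by lia.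
by apply: val_geM => //; [exact: val_geM|right; rewrite v_nu].
Qed.

(** [Xi] is non-trivial on [pi^(2 h) O' nu]. If [v N] were smaller, dividing a witness by [N] would
    give a forbidden [s] of valuation at least [m]. *)
Lemma Xi_conductor N m : tau N = N ->
  (forall s, tau s = s -> vge m s -> Xi (N * s * nu) = 1) -> vge (2 * h + 1 - m) N.
Proof.
move=> tN triv; have [z Oz hz] := wc_nontrivial WC.
have [->|N0] := eqVneq N 0; first by left.
right; rewrite leNgt; apply/negP => lt; move/eqP: hz; apply.
have -> : pi ^ h * pi ^ h * (z * nu) = N * (pih * pih * z / N) * nu by rewrite /pih; field.
apply: triv; first by rewrite fmorph_div !rmorphM /= tau_pih Oz.1 tN.
have : vge (v (pih * pih) + 0 - v N) (pih * pih * z / N).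
  apply: val_geM => //; last by right; rewrite (val_inv vP).
  by apply: val_geM => //; [exact: val_ge_refl|case: Oz].
by apply: val_geW; rewrite (Defs.valM vP) ?pih_neq0// val_pih; lia.
Qed.

(** Replacing [s] by the coordinate of a torus element costs an error of valuation
    [2 h - 2 j + 3 i], which exceeds [2 h] because [j < i]. *)
Lemma Xi_ulevel_conductor (i j : nat) N : (j < i)%N -> tau N = N -> vge (2 * h - 2 * j%:Z) N ->
  (forall g, ulevel i g -> Xi (- (N * g)) = 1) -> vge (2 * h + 1 - i%:Z) N.
Proof.
move=> ji tN hN triv; apply: Xi_conductor => // s ts hs.
have [g Tg hg] := ulevel_lift_red (leq_ltn_trans (leq0n j) ji) ts hs.
have := triv _ Tg; rewrite Xi_fixM// XiN => /eqP; rewrite invr_eq1 => /eqP <-.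
apply: Xi_congr.
have -> : N * s * nu - N * qcoord1 g * nu = N * - (qcoord1 g - s) * nu by ring.
have : vge (2 * h - 2 * j%:Z + 3 * i%:Z + 0) (N * - (qcoord1 g - s) * nu).
  apply: val_geM => //; last by right; rewrite v_nu.
  by apply: val_geM => //; apply: val_geN.
by apply: val_geW; lia.
Qed.

Definition torus_weight (chi : L -> R[i]) phi :=
  quasi_inv phi /\ forall g, unitary g -> forall w, weilS g phi w = chi g * phi w.

Definition has_conductor (chi : L -> R[i]) (c : nat) :=
  (forall t, ulevel c t -> chi t = 1) /\
  (forall j, (forall t, ulevel j t -> chi t = 1) -> (c <= j)%N).

(** Near [1] the torus acts at [w] both by [chi] and by [Xi (- (w * tau w * g))]. Outside [B*] the
    norm of [w] has valuation exactly [2 h - 2 j]; that this is even is what makes the conductor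
    odd. *)
Lemma weight_support chi phi w c : torus_weight chi phi -> has_conductor chi c -> phi w <> 0 ->
  (vge h w /\ (c <= 1)%N) \/
  exists j : nat, [/\ (0 < j)%N, c = (2 * j + 1)%N, w != 0, v w = h - j%:Z &
    forall g, ulevel j.+1 g -> chi g = Xi (- (w * tau w * g))].
Proof.
move=> [Mphi wphi] [c_triv c_min] /eqP w0.
have chiE (j : nat) g : vge (h - j%:Z) w -> ulevel j.+1 g -> chi g = Xi (- (w * tau w * g)).
  move=> hw Tg; apply: (mulIf w0); rewrite -wphi; last exact: ulevel_unitary Tg.
  exact: (weilS_small Tg Mphi hw).
have tN := norm_fix w.
have [hw|hw] := EM (vge h w).
  left; split=> //; apply: c_min => g Tg; rewrite (chiE 0%N) ?subr0//.
  by apply: Xi_fixM1 tN (val_ge_norm hw) _; apply: val_geW (ulevel_qcoord1 Tg); lia.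
have wn0 : w != 0 by apply: contra_notN hw => /eqP ->; left.
have lt : v w < h by rewrite ltNge; apply: contra_notN hw => ?; right.
pose j := absz (h - v w); have jE : v w = h - j%:Z by rewrite /j; lia.
have j0 : (0 < j)%N by rewrite /j; lia.
have hw' : vge (h - j%:Z) w by right; rewrite jE.
right; exists j; split=> //; last by move=> g; apply: chiE.
have hN := val_ge_norm hw'.
apply/eqP; rewrite eqn_leq; apply/andP; split.
  apply: c_min => g Tg; rewrite (chiE j)//; last by apply: ulevel_le Tg; lia.
  by apply: Xi_fixM1 tN hN _; apply: val_geW (ulevel_qcoord1 Tg); lia.
rewrite addn1 ltnNge; apply/negP => c2j.
have : vge (2 * h + 1 - (2 * j)%N%:Z) (w * tau w).
  apply: (@Xi_ulevel_conductor (2 * j) j) => //; first lia.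
    by apply: val_geW hN; lia.
  move=> g Tg; rewrite -(chiE j)//; last by apply: ulevel_le Tg; lia.
  by apply: c_triv; apply: ulevel_le Tg.
case=> [/eqP|]; first by rewrite mulf_eq0 fmorph_eq0 (negbTE wn0).
by rewrite (Defs.valM vP) ?fmorph_eq0// (uq_v_tau UQ) jE; lia.
Qed.

(** Surjectivity of the norm on units, to any precision: the residue comes from counting the points
    of the norm form, the higher digits from Newton iteration. *)
Lemma norm_approx (n1 : L) (m : nat) : tau n1 = n1 -> n1 != 0 -> v n1 = 0 -> (0 < m)%N ->
  exists a : L, [/\ a != 0, v a = 0 & vge m%:Z (a * tau a - n1)].
Proof.
move=> tn n0 vn; have On : fixed_integer n1 by split=> //; right; rewrite vn.
have unit_of a : vge 0 a -> vge 1 (a * tau a - n1) -> a != 0 /\ v a = 0.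
  move=> ha hN; have [|N0 vN] := val_unitD (y := a * tau a - n1) vP n0; first by rewrite vn.
  have NE : n1 + (a * tau a - n1) = a * tau a by ring.
  rewrite NE in N0 vN; move: (N0); rewrite mulf_eq0 negb_or => /andP[a0 _].
  split=> //; move: vN; rewrite (Defs.valM vP) ?fmorph_eq0// (uq_v_tau UQ) vn; lia.
elim: m => // m IHm _; case: m IHm => [_|m IHm].
  have : (0 < #|[set p : E * E | (p.1 ^+ 2 - nu2_res * p.2 ^+ 2 == red n1)%R]%SET|)%N.
    rewrite (card_norm_form E2 res_charD res_char_neq0 res_char_nontrivial)//.
      exact: (uq_nonsquare UQ).
    by apply/eqP => /(red_eq0 On); case=> [/eqP|]; [rewrite (negbTE n0)|rewrite vn].
  case/card_gt0P => -[x y]; rewrite inE /= => /eqP xy.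
  have [Ox Oy] := (lift_redP x, lift_redP y).
  pose a := lift_red x + lift_red y * nu.
  have [a0 a1] := coord_eq Ox.1 Oy.1.
  have ha : vge 0 a.
    by apply/val_ge_coord; rewrite a0 a1; split; [case: Ox|case: Oy].
  have ONa : fixed_integer (a * tau a) by split; [exact: norm_fix|exact: (val_ge_norm ha)].
  have hN : vge 1 (a * tau a - n1).
    apply/red_eq0; first by apply: fixed_integerD => //; apply: fixed_integerN.
    rewrite red_add ?red_opp//; last exact: fixed_integerN.
    have hta : vge 0 (tau a) by apply/val_ge_tau.
    rewrite -[red (a * _)](res0_fix (norm_fix a)) res0M//.
    rewrite /res0 /res1 qcoord0_tau qcoord1_tau a0 a1 red_opp// !lift_redK -xy.
    by ring.
  by have [? ?] := unit_of _ ha hN; exists a.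
have [//|a [a0 va ha]] := IHm.
pose N := a * tau a; have N0 : N != 0 by rewrite mulf_neq0 ?fmorph_eq0.
have vN : v N = 0 by rewrite (Defs.valM vP) ?fmorph_eq0// (uq_v_tau UQ) va.
have v2N : v (2%:R * N) = 0 by rewrite (Defs.valM vP)// (uq_two UQ).2 vN.
(* Newton step for the square root of [n1 / N]: the factor [1 + s], fixed by [tau], multiplies the
   norm by [(1 + s)^2] and leaves the error [s^2 N]. *)
pose s : L := - (N - n1) / (2%:R * N).
have hs : vge m.+1%:Z s.
  rewrite -[m.+1%:Z]addr0; apply: val_geM => //; first exact: val_geN.
  by right; rewrite (val_inv vP) ?v2N// mulf_neq0.
have ts : tau s = s.
  by rewrite /s fmorph_div rmorphN rmorphB rmorphM rmorph_nat /= norm_fix tn.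
have hN : vge m.+2%:Z (a * (1 + s) * tau (a * (1 + s)) - n1).
  have -> : a * (1 + s) * tau (a * (1 + s)) - n1 = s * s * N.
    rewrite rmorphM rmorphD rmorph1 /= ts (_ : _ * _ = N * (1 + s) ^+ 2); last by rewrite /N; ring.
    by rewrite /s; field; rewrite two0 N0.
  have : vge (m.+1%:Z + m.+1%:Z + 0) (s * s * N).
    by apply: val_geM => //; [exact: val_geM|right; rewrite vN].
  by apply: val_geW; lia.
have [||b0 vb] := unit_of (a * (1 + s)); last by exists (a * (1 + s)).
  rewrite -[0]addr0; apply: val_geM => //; first by right; rewrite va.
  by apply: val_geD => //; [right; rewrite (val_one vP)|apply: val_geW hs; lia].
by apply: val_geW hN; lia.
Qed.

(** * Characters of the torus given by elements of the fixed field *)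

Section Duality.
Variables (chi : L -> R[i]).
Hypothesis chiM : forall s t, unitary s -> unitary t -> chi (s * t) = chi s * chi t.
Hypothesis chi_neq0 : forall t, unitary t -> chi t <> 0.

Lemma chi1 : chi 1 = 1.
Proof.
have /eqP chi_n0 := chi_neq0 unitary1; apply: (mulfI chi_n0).
by rewrite -chiM ?mulr1//; exact: unitary1.
Qed.
Lemma chiV t : unitary t -> chi t^-1 = (chi t)^-1.
Proof.
move=> Tt; have /eqP chi_n0 := chi_neq0 Tt; apply: (mulfI chi_n0).
by rewrite -chiM ?divff ?chi1//; [exact: (unitary_neq0 Tt)|exact: unitaryV].
Qed.

(** Downward induction from [T_(2 j + 1)], where [n = 0] works, to [T_(j + 1)]. Twisted by the
    current [n], [chi] factors through [T_i / T_(i + 1)], a copy of [E], where [additive_char_dual]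
    supplies the correction. Third-order errors of the logarithm are invisible since [3 i > 2 j]. *)
Lemma char_parameter (j c : nat) : has_conductor chi c -> c = (2 * j + 1)%N ->
  forall i : nat, (i <= j)%N ->
  exists n : L, [/\ tau n = n, vge (2 * h - 2 * j%:Z) n &
    forall g, ulevel (2 * j + 1 - i)%N g -> chi g = Xi (- (n * g))].
Proof.
move=> [c_triv _] cE; elim=> [_|i' IHi ij].
  exists 0; split; [exact: rmorph0|by left|move=> g].
  by rewrite subn0 -cE => /c_triv ->; rewrite mul0r oppr0 Xi0.
have [|n [tn hn nE]] := IHi; first lia.
pose i := (2 * j + 1 - i'.+1)%N.
have iE : (2 * j + 1 - i')%N = i.+1 by rewrite /i; lia.
rewrite iE in nE; rewrite -/i.
have i_gtj : (j < i)%N by rewrite /i; lia.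
have i_le : (i <= 2 * j)%N by rewrite /i; lia.
have i_gt0 : (0 < i)%N by apply: leq_ltn_trans i_gtj.
pose chi' g := chi g * Xi (n * qcoord1 g * nu).
have n_small z : vge (3 * i%:Z) z -> Xi (n * z * nu) = 1.
  move=> hz; apply: Xi_triv.
  have : vge (2 * h - 2 * j%:Z + 3 * i%:Z + 0) (n * z * nu).
    by apply: val_geM => //; [exact: val_geM|right; rewrite v_nu].
  by apply: val_geW; lia.
have chi'M g k : ulevel i g -> ulevel i k -> chi' (g * k) = chi' g * chi' k.
  move=> Tg Tk; rewrite /chi' (chiM (ulevel_unitary Tg) (ulevel_unitary Tk)).
  have -> : n * qcoord1 (g * k) * nu = n * (qcoord1 (g * k) - (qcoord1 g + qcoord1 k)) * nu +
     (n * qcoord1 g * nu + n * qcoord1 k * nu) by ring.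
  rewrite !XiD n_small; last exact: ulevel_qcoord1M.
  by ring.
have chi'1 g : ulevel i.+1 g -> chi' g = 1.
  move=> Tg; rewrite /chi' (nE _ Tg) Xi_fixM// -XiD addNr Xi0 //.
have pii0 : pi ^+ i != 0 by rewrite expf_neq0.
have vpii : v (pi ^+ i) = i%:Z by rewrite (val_expr vP)// v_pi mul1r.
have tpii : tau (pi ^+ i) = pi ^+ i by rewrite rmorphXn /= tau_pi.
have chi'_eq g k : ulevel i g -> ulevel i k -> vge i.+1%:Z (qcoord1 g - qcoord1 k) -> chi' g =
  chi' k.
  move=> Tg Tk hgk; have TgV := ulevelV Tk.
  have -> : g = k * (g * k^-1) by field; exact: (unitary_neq0 (ulevel_unitary Tk)).
  have ucosets : ulevel i (g * k^-1) by apply: ulevelM.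
  rewrite chi'M// (chi'1 (g * k^-1)) ?mulr1//.
  apply: qcoord1_ulevel; first exact: ulevel_le ucosets.
  have -> : qcoord1 (g * k^-1) = (qcoord1 (g * k^-1) - (qcoord1 g + qcoord1 k^-1)) + (qcoord1 g +
    qcoord1 k^-1) by ring.
  apply: val_geD => //; first by apply: val_geW (ulevel_qcoord1M i_gt0 Tg TgV); lia.
  by rewrite (unitary_inv (ulevel_unitary Tk)) qcoord1_tau.
have /choice[gl glP] (t : E) : exists g, ulevel i g /\ vge (3 * i%:Z) (qcoord1 g - pi ^+ i *
  lift_red t).
  have [tl hl] := lift_redP t.
  have t1 : tau (pi ^+ i * lift_red t) = pi ^+ i * lift_red t by rewrite rmorphM /= tpii tl.
  have t2 : vge i%:Z (pi ^+ i * lift_red t).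
    by rewrite -[i%:Z]addr0 -{1}vpii; apply/(val_geMl vP).
  have [g Tg hg] := ulevel_lift_red i_gt0 t1 t2.
  by exists g.
have glE g t : ulevel i g -> vge i.+1%:Z (qcoord1 g - pi ^+ i * lift_red t) -> chi' g = chi' (gl t).
  move=> Tg hg; have [Tl hl] := glP t; apply: chi'_eq => //.
  have -> : qcoord1 g - qcoord1 (gl t) = (qcoord1 g - pi ^+ i * lift_red t) - (qcoord1 (gl t) - pi
    ^+ i * lift_red t) by ring.
  by apply: val_geB => //; apply: val_geW hl; lia.
have lift_close x t : fixed_integer x -> red x = t ->
  vge i.+1%:Z (pi ^+ i * x - pi ^+ i * lift_red t).
  move=> Ox xt; rewrite -mulrBr -addn1 PoszD -{1}vpii; apply/(val_geMl vP) => //.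
  have Ol := lift_redP t.
  apply/red_eq0; first by apply: fixed_integerD => //; apply: fixed_integerN.
  by rewrite red_add ?red_opp ?lift_redK ?xt ?subrr//; apply: fixed_integerN.
have [||m mE] := additive_char_dual res_charD res_char_neq0 res_char_nontrivial
    (f := fun t => chi' (gl t)).
- move=> s t; have [Ts hs] := glP s; have [Tt ht] := glP t.
  rewrite -chi'M//; apply/esym/glE; first exact: ulevelM.
  have -> : qcoord1 (gl s * gl t) - pi ^+ i * lift_red (s + t) =
    (qcoord1 (gl s * gl t) - (qcoord1 (gl s) + qcoord1 (gl t))) + (qcoord1 (gl s) - pi ^+ i *
      lift_red s) +
    (qcoord1 (gl t) - pi ^+ i * lift_red t) + (pi ^+ i * (lift_red s + lift_red t) - pi ^+ i *
      lift_red (s + t)) by ring.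
  have [Os Ot] := (lift_redP s, lift_redP t).
  apply: (val_geD vP).
    apply: (val_geD vP); last by apply: val_geW ht; lia.
    apply: (val_geD vP); last by apply: val_geW hs; lia.
    by apply: val_geW (ulevel_qcoord1M i_gt0 Ts Tt); lia.
  apply: lift_close; first exact: fixed_integerD.
  by rewrite red_add// !lift_redK.
- move=> t; have [Tt _] := glP t; rewrite mulf_neq0 ?Xi_neq0//.
  by apply/eqP/chi_neq0; exact: ulevel_unitary Tt.
have [tm hm] := lift_redP m.
(* Chosen so that [Xi (- (dl * qcoord1 g * nu))] is [res_char (m * t)], where [t] is the residue of
   [qcoord1 g / pi ^+ i]. *)
pose dl := - (pih * pih * lift_red m / pi ^+ i).
have tdl : tau dl = dl.
  by rewrite rmorphN fmorph_div !rmorphM /= tau_pih tm tpii.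
have hdl : vge (2 * h - i%:Z) dl.
  apply: val_geN => //; have : vge (v (pih * pih) + 0 - i%:Z) (pih * pih * lift_red m / pi ^+ i).
    apply: val_geM => //; last by right; rewrite (val_inv vP)// vpii.
    by apply: val_geM => //; exact: val_ge_refl.
  by apply: val_geW; rewrite (Defs.valM vP) ?pih_neq0// val_pih; lia.
exists (n + dl); split.
- by rewrite rmorphD /= tn tdl.
- by apply: val_geD => //; apply: val_geW hdl; lia.
move=> g Tg; have hg := ulevel_qcoord1 Tg.
have Og : fixed_integer (qcoord1 g / pi ^+ i).
  split; first by rewrite fmorph_div /= tau_qcoord1 tpii.
  apply/(val_geMl vP _ _ pii0); rewrite vpii addr0 mulrCA divff// mulr1 //.
pose t := red (qcoord1 g / pi ^+ i).
have chi'E : chi' g = res_char (m * t).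
  rewrite -mE; apply: glE => //.
  have {1}-> : qcoord1 g = pi ^+ i * (qcoord1 g / pi ^+ i) by field.
  exact: lift_close.
rewrite Xi_fixM; last by rewrite rmorphD /= tn tdl.
have -> : - ((n + dl) * qcoord1 g * nu) = - (n * qcoord1 g * nu) + pih * pih * (lift_red m *
  (qcoord1 g / pi ^+ i) * nu).
  by rewrite /dl; field.
rewrite XiD res_char_red; last exact: (fixed_integerM (lift_redP m)).
rewrite (red_mul (lift_redP m) Og) lift_redK -/t -chi'E /chi' XiN mulrCA mulVf ?mulr1//.
exact: Xi_neq0.
Qed.

(** The conductor forces [v n = 2 h - 2 j], an even number, so [n] is a power of [pi] times a unit,
    which is a norm up to [pi^j]; this precision suffices on [T_(j + 1)]. The condition
    [res0 a != 0] keeps [a] out of [pi O' + O' nu]. *)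
Lemma char_vector (j : nat) : has_conductor chi (2 * j + 1)%N -> (0 < j)%N ->
  exists a : L, [/\ a != 0, v a = 0, res0 a != 0 &
    forall g, ulevel j.+1 g -> chi g = Xi (- (pi ^ (2 * h - 2 * j%:Z) * (a * tau a) * g))].
Proof.
move=> cP j0; have [n [tn hn nE]] := char_parameter cP erefl (leqnn j).
have Ej : (2 * j + 1 - j)%N = j.+1 by lia.
rewrite Ej in nE; pose p := pi ^ (2 * h - 2 * j%:Z).
have p0 : p != 0 by apply: expfz_neq0.
have vp : v p = 2 * h - 2 * j%:Z by rewrite (val_exprz vP)// v_pi mul1r.
have tp : tau p = p by rewrite fmorphXz /= tau_pi.
have nsmall : ~ vge (2 * h - 2 * j%:Z + 1) n.
  move=> hn'; suff : (2 * j + 1 <= 2 * j)%N by rewrite addn1 ltnn.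
  apply: cP.2 => t Tt.
  rewrite nE; last by apply: ulevel_le Tt; lia.
  apply: (Xi_fixM1 tn hn'); apply: val_geW (ulevel_qcoord1 Tt); lia.
have n0 : n != 0 by apply: contra_notN nsmall => /eqP ->; left.
have vn : v n = 2 * h - 2 * j%:Z.
  case: hn => [/eqP|hn]; first by rewrite (negbTE n0).
  apply/eqP; rewrite eq_le hn andbT leNgt; apply/negP => lt; apply: nsmall; right; lia.
have tnp : tau (n / p) = n / p by rewrite fmorph_div /= tn tp.
have np0 : n / p != 0 by rewrite mulf_neq0 ?invr_eq0.
have vnp : v (n / p) = 0 by rewrite (Defs.valM vP) ?invr_eq0// (val_inv vP)// vn vp subrr.
have [a [a0 va ha]] := norm_approx tnp np0 vnp j0.
have aE b : b * tau b = a * tau a ->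
    forall g, ulevel j.+1 g -> chi g = Xi (- (p * (b * tau b) * g)).
  move=> -> g Tg; rewrite nE//.
  have -> : - (n * g) = - (p * (a * tau a) * g) + - ((p * - (a * tau a - n / p)) * g) by field.
  rewrite XiD [X in _ * X](@Xi_fixM1 _ _ (2 * h - j%:Z)) ?mulr1//.
  - by rewrite rmorphM rmorphN rmorphB fmorph_div /= norm_fix tn tp.
  - have -> : 2 * h - j%:Z = v p + j%:Z by rewrite vp; lia.
    by apply/(val_geMl vP) => //; apply: val_geN.
  by apply: val_geW (ulevel_qcoord1 Tg); lia.
have [Ra|Ra] := eqVneq (res0 a) 0; last by exists a; split=> //; apply: aE.
have O1 := fixed_integer1.
(* A norm-one factor keeps the norm. As [res1 (cayley 1)] is non-zero, it turns the non-zero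
   [res1 a] into a non-zero first residue. *)
pose t := cayley 1; have Tt : unitary t by apply: cayley_unitary.
have [_ t1] := cayley_coord O1; have [n1 v1] := cayley_unit O1.
have Rt : res1 t != 0.
  apply/eqP => /red_eq0-/(_ (fixed_integer_qcoord1 (unitary_integer Tt))).
  rewrite t1 mulr1 => -[/eqP|].
    by rewrite mulf_eq0 invr_eq0 (negbTE two0) (negbTE n1).
  by rewrite (Defs.valM vP) ?invr_eq0// (val_inv vP)// v1 (uq_two UQ).2.
have ia : vge 0 a by right; rewrite va.
have R1a : res1 a != 0.
  apply/eqP => R1a; have /(res01_eq0 ia) : res0 a = 0 /\ res1 a = 0 by [].
  by case=> [/eqP|]; [rewrite (negbTE a0)|rewrite va].
exists (a * t); split.
- by rewrite mulf_neq0// (unitary_neq0 Tt).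
- by rewrite (Defs.valM vP) ?(unitary_neq0 Tt)// va (unitary_val Tt).
- by rewrite (res0M ia (unitary_integer Tt)) Ra mul0r add0r !mulf_neq0// nu2_res_neq0.
by apply: aE; rewrite rmorphM /= mulrACA Tt mulr1.
Qed.

End Duality.

(** * Sums over [T / T_i] and averages of [delta_at] *)

Definition ucoset i g : set L := [set g * n | n in ulevel i].

Lemma ucoset_eq i g k : unitary g -> unitary k -> ulevel i (g^-1 * k) -> ucoset i g = ucoset i k.
Proof.
move=> Tg Tk Tgk; have [g0 k0] := (unitary_neq0 Tg, unitary_neq0 Tk).
apply/seteqP; split=> _ [n Tn <-].
  exists (k^-1 * g * n); last by field.
  apply: ulevelM => //; rewrite (_ : k^-1 * g = (g^-1 * k)^-1); first exact: ulevelV.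
  by field; rewrite g0 k0.
by exists (g^-1 * k * n); [exact: ulevelM|field].
Qed.

Definition ucosets i := mul_cosets unitary (ulevel i).

Lemma ucosets_finite i : finite_set (ucosets i).
Proof.
apply: (@finite_cosets unitary 0 i%:Z (ucoset i)).
  by move=> g /unitary_integer.
move=> g k Tg Tk hgk; apply: ucoset_eq => //; split; first by apply: unitaryM => //;
  exact: unitaryV.
have -> : g^-1 * k - 1 = g^-1 * - (g - k) by field; exact: (unitary_neq0 Tg).
by apply/(unitary_val_geMl _ _ (unitaryV Tg)); apply: val_geN.
Qed.

Lemma ucoset_xget i g : unitary g -> exists2 t, ulevel i t & xget 1 (ucoset i g) = g * t.
Proof.
move=> Tg; have : ucoset i g (xget 1 (ucoset i g)).
  apply: (@xgetPex _ 1 (ucoset i g)); exists g; exists 1; rewrite ?mulr1//; exact: (ulevel1).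
by case=> t Tt <-; exists t.
Qed.

Lemma ucosets_xget i c : ucosets i c -> unitary (xget 1 c) /\ c = ucoset i (xget 1 c).
Proof.
move=> [g Tg <-]; have [t Tt ->] := ucoset_xget i Tg.
have Tgt : unitary (g * t) by apply: unitaryM => //; exact: ulevel_unitary Tt.
by split=> //; apply: ucoset_eq => //; rewrite mulKf// (unitary_neq0 Tg).
Qed.

(** Translation permutes the cosets but does not commute with the choice of representatives; the
    invariance of [F] absorbs the difference. *)
Lemma ucosets_sum_translate i k (F : L -> R[i]) : unitary k ->
  (forall g t, unitary g -> ulevel i t -> F (g * t) = F g) ->
  \sum_(c \in ucosets i) F (xget 1 c) = \sum_(c \in ucosets i) F (k * xget 1 c).
Proof.
move=> Tk Finv; have Tki := unitaryV Tk; have k0 := unitary_neq0 Tk.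
pose hk c : set L := [set k * x | x in c].
have hk_cos g : unitary g -> hk (ucoset i g) = ucoset i (k * g).
  move=> Tg; apply/seteqP; split=> [_ [_ [n Tn <-] <-]|_ [n Tn <-]].
    by exists n => //; rewrite mulrA.
  by exists (g * n); [exists n|rewrite mulrA].
have hkb : set_bij (ucosets i) (ucosets i) hk.
  split.
  - by move=> _ [g Tg <-]; exists (k * g); [exact: unitaryM|exact: (esym (hk_cos _ Tg))].
  - move=> a b _ _ hab; apply/seteqP; split=> x xa.
      have : hk b (k * x) by rewrite -hab; exists x.
      by case=> y yb /(mulfI k0) <-.
    have : hk a (k * x) by rewrite hab; exists x.
    by case=> y yb /(mulfI k0) <-.
  - move=> _ [g Tg <-]; exists (ucoset i (k^-1 * g)).
      by exists (k^-1 * g) => //; exact: unitaryM.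
    by rewrite hk_cos ?mulVKf//; exact: unitaryM.
rewrite (reindex_fsbig hk (ucosets i) (ucosets i)) //; apply: eq_fsbigr => c /set_mem cQ.
have [Tg cE] := ucosets_xget cQ; rewrite {1}cE hk_cos//.
by have [t Tt ->] := ucoset_xget i (unitaryM Tk Tg); apply: Finv => //; exact: unitaryM.
Qed.

Lemma ucosets_sumE i (F : set L -> R[i]) :
  \sum_(c \in ucosets i) F c = \sum_(c <- fset_set (ucosets i)) F c.
Proof. by rewrite fsbig_finite//; exact: ucosets_finite. Qed.

Lemma quasi_inv_sum (I : Type) (s : seq I) (a : I -> R[i]) (f : I -> L -> R[i]) :
  (forall i, quasi_inv (f i)) -> quasi_inv (fun w => \sum_(i <- s) a i * f i w).
Proof.
move=> Mf b w Ab; rewrite mulr_sumr; apply: eq_bigr => i _.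
by rewrite Mf//; ring.
Qed.

Lemma weilS_sum (I : Type) (s : seq I) (a : I -> R[i]) (f : I -> L -> R[i]) g w :
  weilS g (fun w => \sum_(i <- s) a i * f i w) w = \sum_(i <- s) a i * weilS g (f i) w.
Proof.
rewrite /weilS /weil_sum /weil_term.
under eq_bigr do rewrite mulr_sumr.
rewrite exchange_big mulr_sumr; apply: eq_bigr => i _ /=.
rewrite [RHS]mulrCA; congr (_ * _); rewrite mulr_sumr; apply: eq_bigr => t _; ring.
Qed.

Lemma weilS_scale c (f : L -> R[i]) g w : weilS g (fun w => c * f w) w = c * weilS g f w.
Proof.
have := weilS_sum [:: tt] (fun _ => c) (fun _ => f) g w.
rewrite big_seq1 => <-; rewrite /weilS /weil_sum /weil_term.
by congr (_ * _); apply: eq_bigr => t _; rewrite big_seq1.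
Qed.

Lemma eq_weilS f1 f2 g w : f1 =1 f2 -> weilS g f1 w = weilS g f2 w.
Proof. by move=> ff; congr weilS; apply/funext. Qed.

Definition supported_in (n : int) (phi : L -> R[i]) := forall w, phi w != 0 -> vge n w.

Lemma weilS_supported n g phi : unitary g -> n <= h -> supported_in n phi ->
  supported_in n (weilS g phi).
Proof.
move=> Tg nh sphi w; rewrite /weilS mulf_eq0 negb_or => /andP[_ U0].
have [t t0] : exists t, weil_term g phi w (lift_fix t) != 0.
  apply: contrapT => nt; case/negP: U0; rewrite /weil_sum big1// => t _.
  by apply/eqP/negP => /negP t0; apply: nt; exists t.
move: t0; rewrite /weil_term mulf_eq0 negb_or => /andP[_ /sphi].
move/(unitary_val_geMl _ _ (unitaryV Tg)) => haw.
rewrite (_ : w = (lift_fix t + w) - lift_fix t); last by ring.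
by apply: val_geB => //; apply: val_geW nh (lift_fix_Bs t).
Qed.

Definition delta_at (x w : L) : R[i] := if `[< latticeA (w - x) >] then pairing x (w - x) else 0.

Lemma delta_in x w : latticeA (w - x) -> delta_at x w = pairing x (w - x).
Proof. by move=> h'; rewrite /delta_at asboolT. Qed.
Lemma delta_out x w : ~ latticeA (w - x) -> delta_at x w = 0.
Proof. by move=> h'; rewrite /delta_at asboolF. Qed.
Lemma delta_neq0 x w : delta_at x w != 0 -> latticeA (w - x).
Proof. by rewrite /delta_at; case: asboolP => // _; rewrite eqxx. Qed.
Lemma delta_self x : delta_at x x = 1.
Proof. by rewrite delta_in subrr ?/pairing ?mulr0 ?Xi0//; exact: latticeA0. Qed.

Lemma quasi_inv_delta x : quasi_inv (delta_at x).
Proof.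
move=> a w Aa; have wE : a + w - x = a + (w - x) by ring.
have [Aw|nAw] := EM (latticeA (w - x)).
  rewrite !delta_in ?wE//; last exact: latticeAD.
  rewrite pairingDr (_ : pairing w a = pairing x a)//.
  rewrite -{1}(subrK x w) pairingDl (pairing_latticeA Aw Aa) mul1r //.
rewrite !delta_out ?mulr0// wE => Aaw; apply: nAw.
by rewrite (_ : w - x = a + (w - x) + - a); [apply: latticeAD => //; exact: latticeAN|ring].
Qed.

Lemma delta_supported n x : vge n x -> n <= h -> supported_in n (delta_at x).
Proof.
move=> hx nh w /delta_neq0/latticeA_Bs hw; rewrite -(subrK x w).
by apply: val_geD => //; apply: val_geW hw.
Qed.

Lemma weilS_1 phi w : quasi_inv phi -> weilS 1 phi w = phi w.
Proof. by move=> Mphi; rewrite (weilS_unipotent _ (ulevel1 1)) ?invr1 ?mul1r. Qed.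

(** This is [phi_chi] of the statement, expressed with [weilS]. *)
Definition avg_delta (chi : L -> R[i]) i x w : R[i] :=
  \sum_(c \in ucosets i) (let g := xget 1 c in chi g^-1 * weilS g (delta_at x) w).

Section Averaging.
Variables (chi : L -> R[i]) (i : nat) (x : L).
Hypothesis chiM : forall s t, unitary s -> unitary t -> chi (s * t) = chi s * chi t.
Hypothesis chi_neq0 : forall t, unitary t -> chi t <> 0.
Hypothesis eigen : forall t, ulevel i t -> forall w, weilS t (delta_at x) w = chi t * delta_at x w.

Let Md := quasi_inv_delta x.

(** By [eigen] the factor [chi t] gained by [weilS] cancels the one lost in [chi (g * t)^-1], so the
    choice of representatives does not matter. *)
Lemma avg_delta_invariant w g t : unitary g -> ulevel i t ->
  chi (g * t)^-1 * weilS (g * t) (delta_at x) w = chi g^-1 * weilS g (delta_at x) w.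
Proof.
move=> Tg Tt; have Tt' := ulevel_unitary Tt; have /eqP chi_n0 := chi_neq0 Tt'.
rewrite -weilS_comp// (eq_weilS (f2 := fun w => chi t * delta_at x w)) ?weilS_scale; last first.
  by move=> w'; apply: eigen.
rewrite invfM chiM; try exact: unitaryV.
by rewrite (chiV chiM chi_neq0 Tt'); field.
Qed.

Lemma avg_deltaE w : avg_delta chi i x w =
  \sum_(c <- fset_set (ucosets i)) chi (xget 1 c)^-1 * weilS (xget 1 c) (delta_at x) w.
Proof. exact: ucosets_sumE. Qed.

Lemma ucosets_seq c : c \in fset_set (ucosets i) -> unitary (xget 1 c).
Proof. by rewrite in_fset_set; [move=> /set_mem/ucosets_xget[]|exact: ucosets_finite]. Qed.

Lemma quasi_inv_avg_delta : quasi_inv (avg_delta chi i x).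
Proof.
move=> a w Aa; rewrite !avg_deltaE mulr_sumr !big_seq; apply: eq_bigr => c /ucosets_seq Tc.
by rewrite quasi_inv_S//; ring.
Qed.

Lemma avg_delta_supported n : n <= h -> vge n x -> supported_in n (avg_delta chi i x).
Proof.
move=> nh hx w; rewrite avg_deltaE => w0; apply: contrapT => hw; case/negP: w0.
rewrite big_seq big1// => c /ucosets_seq Tc.
have [->|S0] := eqVneq (weilS (xget 1 c) (delta_at x) w) 0; first by rewrite mulr0.
by case: hw; apply: weilS_supported Tc nh (delta_supported hx nh) _ S0.
Qed.

Lemma weight_avg_delta : torus_weight chi (avg_delta chi i x).
Proof.
split=> [|k Tk w]; first exact: quasi_inv_avg_delta.
rewrite (eq_weilS (f2 := fun w => \sum_(c <- fset_set (ucosets i))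
    chi (xget 1 c)^-1 * weilS (xget 1 c) (delta_at x) w)); last exact: avg_deltaE.
rewrite weilS_sum /avg_delta.
rewrite (ucosets_sum_translate (F := fun g => chi g^-1 * weilS g (delta_at x) w) Tk); last first.
  by move=> g t; apply: avg_delta_invariant.
rewrite ucosets_sumE mulr_sumr !big_seq; apply: eq_bigr => c /ucosets_seq Tc.
have /eqP k0 := chi_neq0 Tk.
rewrite weilS_comp// invfM chiM; try exact: unitaryV.
by rewrite (chiV chiM chi_neq0 Tk); field.
Qed.

End Averaging.

(** * Characters of conductor greater than one *)

Section RamifiedWeights.

Variables (chi : L -> R[i]) (j : nat) (a : L).
Hypothesis chiM : forall s t, unitary s -> unitary t -> chi (s * t) = chi s * chi t.
Hypothesis chi_neq0 : forall t, unitary t -> chi t <> 0.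
Hypothesis chi_cond : has_conductor chi (2 * j + 1)%N.
Hypotheses (j_gt0 : (0 < j)%N) (a0 : a != 0) (va : v a = 0) (R0a : res0 a != 0).
Hypothesis chiE : forall g, ulevel j.+1 g ->
  chi g = Xi (- (pi ^ (2 * h - 2 * j%:Z) * (a * tau a) * g)).

Let x0 : L := pi ^ (h - j%:Z) * a.

Let x0_neq0 : x0 != 0. Proof. by rewrite mulf_neq0// expfz_neq0. Qed.
Let v_x0 : v x0 = h - j%:Z.
Proof. by rewrite (Defs.valM vP) ?expfz_neq0// (val_exprz vP)// v_pi va mul1r addr0. Qed.
Let h_x0 : vge (h - j%:Z) x0. Proof. by right; rewrite v_x0. Qed.
Let hj : h - j%:Z <= h. Proof. lia. Qed.

Let norm_x0 : x0 * tau x0 = pi ^ (2 * h - 2 * j%:Z) * (a * tau a).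
Proof.
rewrite /x0 rmorphM fmorphXz /= tau_pi mulrACA; congr (_ * _).
by rewrite -expfzDr//; congr (pi ^ _); lia.
Qed.

Let chiE' g : ulevel j.+1 g -> chi g = Xi (- (x0 * tau x0 * g)).
Proof. by move=> Tg; rewrite norm_x0 chiE. Qed.

(* For [g] in [T_j], [g x0 - x0] lies in [B*], and modulo [A] it only depends on
   the leading coefficient of [qcoord1 g], through multiplication by [res0 a]. *)
Let sres1_shift g : ulevel j g -> vge h ((g - 1) * x0) /\
  sres1 ((g - 1) * x0) = red (qcoord1 g / pi ^+ j) * res0 a.
Proof.
move=> Tg; have [_ hg] := Tg.
have hgx : vge h ((g - 1) * x0).
  by have -> : h = j%:Z + (h - j%:Z); [lia|apply: val_geM].
split=> //; rewrite /sres1.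
have pj0 : pi ^+ j != 0 by rewrite expf_neq0.
have vpj : v (pi ^+ j) = j%:Z by rewrite (val_expr vP)// v_pi mul1r.
have tpj : tau (pi ^+ j)^-1 = (pi ^+ j)^-1 by rewrite fmorphV rmorphXn /= tau_pi.
have -> : (g - 1) * x0 / pih = ((pi ^+ j)^-1 * (g - 1)) * a.
  rewrite /x0 /pih expfzDr// -exprnN; field.
  by rewrite pj0 expfz_neq0.
have hz : vge 0 ((pi ^+ j)^-1 * (g - 1)).
  by apply/(val_geMl vP _ _ pj0); rewrite vpj addr0 mulVKf.
have ha : vge 0 a by right; rewrite va.
rewrite (res1M hz ha) /res0 /res1 (qcoord0Mf _ tpj) (qcoord1Mf _ tpj) qcoord0_sub1 qcoord1_sub1.
have -> : red ((pi ^+ j)^-1 * (qcoord0 g - 1)) = 0.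
  have hc := ulevel_qcoord0 (ulevel_le j_gt0 Tg) (ulevel_qcoord1 Tg).
  have h1 : vge 1 ((pi ^+ j)^-1 * (qcoord0 g - 1)).
    by apply/(val_geMl vP _ _ pj0); rewrite vpj mulVKf//; apply: val_geW hc; lia.
  apply/red_eq0 => //; split; last by apply: val_geW h1.
  by rewrite rmorphM rmorphB rmorph1 /= tau_qcoord0 tpj.
by rewrite mul0r add0r [_^-1 * _]mulrC.
Qed.

(** On the support [x0 + A] the norm agrees with that of [x0] up to valuation [2 h - j], a
    difference that [Xi] cannot see on [T_(j + 1)]; so [weilS_small] yields the factor [chi t]. *)
Let eigen t : ulevel j.+1 t -> forall w, weilS t (delta_at x0) w = chi t * delta_at x0 w.
Proof.
move=> Tt w; have Md := quasi_inv_delta x0.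
have [hw|hw] := EM (vge (h - j%:Z) w); last first.
  have dout y : ~ vge (h - j%:Z) y -> delta_at x0 y = 0.
    move=> hy; apply/eqP/negP => /negP/(delta_supported h_x0 hj); exact: hy.
  rewrite (weilS_unipotent _ (ulevel_le (ltn0Sn j) Tt) Md) !dout ?mulr0//.
  by move/(unitary_val_geMl _ _ (unitaryV (ulevel_unitary Tt))).
rewrite (weilS_small Tt Md hw).
have [->|d0] := eqVneq (delta_at x0 w) 0; first by rewrite !mulr0.
have hA := latticeA_Bs (delta_neq0 d0).
congr (_ * _); rewrite chiE'//.
have -> : - (w * tau w * t) = - (x0 * tau x0 * t) + - ((w * tau w - x0 * tau x0) * t) by ring.
rewrite XiD [X in _ * X](Xi_fixM1 (n := 2 * h - j%:Z)) ?mulr1//.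
- by rewrite rmorphB /= !norm_fix.
- have -> : w * tau w - x0 * tau x0 = (w - x0) * tau w + x0 * tau (w - x0).
    by rewrite rmorphB /=; ring.
  have -> : 2 * h - j%:Z = h + (h - j%:Z) by lia.
  have hA' := (val_ge_tau _ _).2 hA; have hw' := (val_ge_tau _ _).2 hw.
  by apply: (val_geD vP); [exact: val_geM|rewrite [h + _]addrC; exact: val_geM].
by apply: val_geW (ulevel_qcoord1 Tt); lia.
Qed.

Lemma weight_avg_delta_ramified : torus_weight chi (avg_delta chi j.+1 x0).
Proof. exact: (weight_avg_delta chiM chi_neq0 eigen). Qed.

Lemma avg_delta_ramified_supported : supported_in (h - j%:Z) (avg_delta chi j.+1 x0).
Proof. exact: avg_delta_supported hj h_x0. Qed.

(** A non-zero value puts [(g - 1) x0] in [B*], hence [g] in [T_j]. Then [g^-1 * x0] lies in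
    [x0 + A], and [sres1_shift] with [res0 a != 0] puts [g] in [T_(j + 1)]. *)
Let weilS_delta_x0 g : unitary g -> ~ ulevel j.+1 g -> weilS g (delta_at x0) x0 = 0.
Proof.
move=> Tg nTg; have Md := quasi_inv_delta x0.
have [Tgj|nTgj] := EM (ulevel j g).
  rewrite (weilS_unipotent _ (ulevel_le j_gt0 Tgj) Md).
  apply/eqP/negP => /negP/delta_neq0 Agx; apply: nTg.
  have TgV := ulevelV Tgj; have [hs r1s] := sres1_shift TgV.
  have := Agx; have {1}-> : g^-1 * x0 - x0 = (g^-1 - 1) * x0 by ring.
  move/(latticeAE hs); rewrite r1s => /eqP; rewrite mulf_eq0 (negbTE R0a) orbF => /eqP.
  have pj0 : pi ^+ j != 0 by rewrite expf_neq0.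
  have vpj : v (pi ^+ j) = j%:Z by rewrite (val_expr vP)// v_pi mul1r.
  have hc : vge 0 (qcoord1 g^-1 / pi ^+ j).
    apply/(val_geMl vP _ _ pj0); rewrite vpj addr0 mulrCA divff// mulr1.
    exact: ulevel_qcoord1.
  move/red_eq0; case=> [||h1].
    by split=> //; rewrite fmorph_div rmorphXn /= tau_pi tau_qcoord1.
  - move=> c10; move: c10 => /eqP; rewrite mulf_eq0 invr_eq0 (negbTE pj0) orbF => /eqP c10.
    have := (ulevelV (qcoord1_ulevel (m := j.+1) (ulevel_le j_gt0 TgV) _)); rewrite invrK; apply.
    by rewrite c10; left.
  have := (ulevelV (qcoord1_ulevel (m := j.+1) (ulevel_le j_gt0 TgV) _)); rewrite invrK; apply.
  have : vge 1 (qcoord1 g^-1 / pi ^+ j) by right.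
  move/(val_geMl vP _ _ pj0); rewrite vpj mulrCA divff// mulr1; apply: val_geW; lia.
rewrite /weilS /weil_sum big1 ?mulr0// => t _; rewrite /weil_term.
apply/eqP; rewrite mulf_eq0; apply/orP; right; apply/negP => /negP/delta_neq0/latticeA_Bs hA.
apply: nTgj; split=> //.
have g0 := unitary_neq0 Tg.
have hA' : vge h (lift_fix t - (g - 1) * x0).
  have -> : lift_fix t - (g - 1) * x0 = g * (g^-1 * (lift_fix t + x0) - x0) by field.
  by apply/unitary_val_geMl.
have : vge h (x0 * (g - 1)).
  have -> : x0 * (g - 1) = lift_fix t - (lift_fix t - (g - 1) * x0) by ring.
  by apply: val_geB => //; exact: lift_fix_Bs.
have {1}-> : h = v x0 + j%:Z by rewrite v_x0; lia.
by move/(val_geMl vP _ _ x0_neq0).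
Qed.

Lemma avg_delta_ramified_x0 : avg_delta chi j.+1 x0 x0 = 1.
Proof.
rewrite /avg_delta (fsbigD1 (ucoset j.+1 1)) /=; last 2 first.
- exact: sub_finite_set (ucosets_finite j.+1).
- by exists 1 => //; exact: unitary1.
rewrite fsbig1 ?addr0; last first.
  move=> c [cQ cn]; have [Tg cE] := ucosets_xget cQ.
  rewrite weilS_delta_x0 ?mulr0// => Tgj; apply: cn; rewrite cE.
  by apply: ucoset_eq => //; [exact: unitary1|rewrite mulr1; exact: ulevelV].
have [t Tt ->] := ucoset_xget j.+1 unitary1.
rewrite (avg_delta_invariant chiM chi_neq0 eigen)//; last exact: unitary1.
by rewrite invr1 (chi1 chiM chi_neq0) mul1r weilS_1 ?delta_self//; exact: quasi_inv_delta.
Qed.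

(** As [res0 a != 0], the orbit of [x0] under [T_j] meets every class of [x0 + B*] modulo [A], so
    [phi] vanishes there. Any [w] in the support has the norm of [x0] up to relative precision
    [pi^j], so [w / x0] is close to some [t] of the torus, and [S(t) phi] at [w] involves only
    values on [x0 + B*]. *)
Lemma weight_ramified_eq0 phi : torus_weight chi phi -> phi x0 = 0 -> forall w, phi w = 0.
Proof.
move=> wphi phi0; have [Mphi eqphi] := wphi.
have near b : vge h b -> phi (x0 + b) = 0.
  (* With this [s], an element [k] of [T_j] whose second coordinate is close to [s] satisfies
     [(k - 1) x0 = b] modulo [A]. *)
  move=> hb; pose s := pi ^+ j * lift_red (sres1 b / res0 a).
  have [tl hl] := lift_redP (sres1 b / res0 a).
  have pj0 : pi ^+ j != 0 by rewrite expf_neq0.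
  have vpj : v (pi ^+ j) = j%:Z by rewrite (val_expr vP)// v_pi mul1r.
  have tpj : tau (pi ^+ j) = pi ^+ j by rewrite rmorphXn /= tau_pi.
  have ts : tau s = s by rewrite rmorphM /= tpj tl.
  have hs : vge j%:Z s by rewrite -[j%:Z]addr0 -{1}vpj; apply/(val_geMl vP).
  have [k Tk hk] := ulevel_lift_red j_gt0 ts hs.
  have [hkx r1k] := sres1_shift Tk.
  have r1E : sres1 ((k - 1) * x0) = sres1 b.
    rewrite r1k (_ : red _ = sres1 b / res0 a) ?divfK//.
    have -> : qcoord1 k / pi ^+ j = lift_red (sres1 b / res0 a) + (qcoord1 k - s) / pi ^+ j
      by rewrite /s; field.
    have h1 : vge 1 ((qcoord1 k - s) / pi ^+ j).
      apply/(val_geMl vP _ _ pj0); rewrite vpj mulrCA divff// mulr1; apply: val_geW hk; lia.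
    have Oz : fixed_integer ((qcoord1 k - s) / pi ^+ j).
      by split; [rewrite fmorph_div rmorphB /= tau_qcoord1 ts tpj|apply: val_geW h1].
    by rewrite red_add// lift_redK ((red_eq0 Oz).2 h1) addr0.
  have Ab : latticeA (b - (k - 1) * x0) by apply: latticeA_sres1_eq.
  have -> : x0 + b = (b - (k - 1) * x0) + k * x0 by ring.
  rewrite Mphi//; have Tk1 := ulevelV (ulevel_le j_gt0 Tk).
  have := weilS_unipotent x0 Tk1 Mphi; rewrite invrK => <-.
  by rewrite eqphi ?phi0 ?mulr0//; exact: ulevel_unitary Tk1.
move=> w; apply/eqP/negP => /negP/eqP w0.
have [[_]|[j' [j'0 jE wn0 vw chiw]]] := weight_support wphi chi_cond w0; first by lia.
have {j'0 jE} jj : j' = j by lia.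
rewrite {j'}jj in vw chiw.
have hw : vge (h - j%:Z) w by right; rewrite vw.
have hN : vge (2 * h + 1 - j.+1%:Z) (w * tau w - x0 * tau x0).
  apply: (Xi_ulevel_conductor (ltnSn j)).
  - by rewrite rmorphB /= !norm_fix.
  - apply: val_geB => //; [apply: val_geW (val_ge_norm hw)|apply: val_geW (val_ge_norm h_x0)]; lia.
  move=> g Tg; have -> : - ((w * tau w - x0 * tau x0) * g) = x0 * tau x0 * g - w * tau w * g
    by ring.
  apply: (mulIf (Xi_neq0 (- (x0 * tau x0 * g)))).
  by rewrite -XiD mul1r -chiE'// chiw//; congr Xi; ring.
have tx0 : tau x0 != 0 by rewrite fmorph_eq0.
have hr : vge j%:Z (w / x0 * tau (w / x0) - 1).
  have N0 : x0 * tau x0 != 0 by rewrite mulf_neq0.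
  apply/(val_geMl vP _ _ N0).
  have -> : x0 * tau x0 * (w / x0 * tau (w / x0) - 1) = w * tau w - x0 * tau x0.
    by rewrite fmorph_div /=; field; rewrite tx0 x0_neq0.
  by apply: val_geW hN; rewrite (Defs.valM vP)// (uq_v_tau UQ) v_x0; lia.
have hr0 : vge 0 (w / x0).
  by right; rewrite (Defs.valM vP) ?invr_eq0// (val_inv vP)// vw v_x0 subrr.
have [t Tt ht] := unitary_approx j_gt0 hr0 hr.
have t0 := unitary_neq0 Tt.
have /eqP : chi t * phi w = 0.
  rewrite -eqphi// /weilS /weil_sum big1 ?mulr0// => s _; rewrite /weil_term.
  have -> : t^-1 * (lift_fix s + w) = x0 + (t^-1 * lift_fix s + t^-1 * ((w / x0 - t) * x0)).
    by field; rewrite x0_neq0 t0.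
  rewrite near ?mulr0//; apply: val_geD => //; apply/(unitary_val_geMl _ _ (unitaryV Tt)).
    exact: lift_fix_Bs.
  by have -> : h = j%:Z + (h - j%:Z); [lia|apply: val_geM].
by rewrite mulf_eq0 => /orP[]/eqP //; exact: chi_neq0.
Qed.

Lemma weight_ramified phi : torus_weight chi phi -> forall w, phi w =
  phi x0 * avg_delta chi j.+1 x0 w.
Proof.
move=> wphi w; have [Mphi eqphi] := wphi; have [Mf eqf] := weight_avg_delta_ramified.
pose d w := \sum_(b <- [:: true; false]) (if b then 1 else - phi x0) * (if b then phi else
  avg_delta chi j.+1 x0) w.
have dE w' : d w' = phi w' - phi x0 * avg_delta chi j.+1 x0 w'.
  by rewrite /d big_cons big_seq1 /= mul1r mulNr.
have wd : torus_weight chi d.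
  split; first by apply: quasi_inv_sum => -[].
  move=> g Tg w'; rewrite weilS_sum big_cons big_seq1 /= eqphi// eqf// dE; ring.
have := weight_ramified_eq0 wd; rewrite dE avg_delta_ramified_x0 mulr1 subrr => /(_ erefl w).
by rewrite dE => /eqP; rewrite subr_eq0 => /eqP.
Qed.

End RamifiedWeights.

(** * A closed form of [eta0], and the trace of the torus on functions supported on [B*] *)

Definition sign_char g : R[i] := if res0 g == 1 then 1 else - eta (2%:R * (res0 g - 1)).

Lemma res0_eq1 g : unitary g -> res0 g = 1 -> res1 g = 0.
Proof.
move=> Tg g0; have := unitary_red Tg; rewrite g0 expr1n => /eqP.
rewrite -subr_eq0 addrAC subrr add0r oppr_eq0 mulf_eq0 (negbTE nu2_res_neq0) expf_eq0 /=.
by move/eqP.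
Qed.

Lemma eta_nonsquare : eta nu2_res = -1.
Proof.
case: (@quadratic_char_pm R E _ nu2_res_neq0) => // /(quadratic_char_sqrE R nu2_res_neq0)[b db].
by have := uq_nonsquare UQ b; rewrite -db eqxx.
Qed.

(** In the residue field, [(res0 g - 1) * red (z * tau z) = 2 * nu2_res * res1 z ^+ 2]. Hence the
    symbol of the norm is that of [2 (res0 g - 1)] times that of the non-square [nu2_res], which
    accounts for the minus sign. *)
Lemma sign_charE g z : unitary g -> z != 0 -> v z = 0 -> g = z * tau z^-1 ->
  eta (red (z * tau z)) = sign_char g.
Proof.
move=> Tg z0 vz gzE; have Iz : vge 0 z by right; rewrite vz.
have Itz : vge 0 (tau z) by apply/val_ge_tau.
have tz0 : tau z != 0 by rewrite fmorph_eq0.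
have NE : red (z * tau z) = res0 z ^+ 2 - nu2_res * res1 z ^+ 2.
  rewrite -(res0_fix (norm_fix z)) res0M// /res0 /res1 qcoord0_tau qcoord1_tau.
  by rewrite red_opp; [ring|exact: fixed_integer_qcoord1].
have ON : fixed_integer (z * tau z) by split; [exact: norm_fix|rewrite -[0]addr0; exact: val_geM].
have N0 : red (z * tau z) != 0.
  apply/eqP => /(red_eq0 ON); case=> [/eqP|]; first by rewrite mulf_eq0 (negbTE z0) (negbTE tz0).
  by rewrite (Defs.valM vP)// (uq_v_tau UQ) vz.
have g0E : (res0 g - 1) * red (z * tau z) = 2%:R * nu2_res * res1 z ^+ 2.
  have : res0 (g * (z * tau z)) = res0 (z * z).
    by congr res0; rewrite gzE fmorphV /=; field.
  have IN := ON.2.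
  rewrite (res0M (unitary_integer Tg) IN) (res1_fix (norm_fix z)) mulr0 addr0.
  rewrite (res0_fix (norm_fix z)) res0M// mulrBl => ->; rewrite NE; ring.
rewrite /sign_char; case: ifPn => [/eqP g1|g1].
  have : res1 z = 0.
    move: g0E; rewrite g1 subrr mul0r => /esym/eqP.
    by rewrite !mulf_eq0 (negbTE E2) (negbTE nu2_res_neq0) /= ?orbF ?orbb => /eqP.
  move=> z1; rewrite NE z1 expr0n mulr0 subr0 quadratic_char_sqr//.
  by apply: contraNneq N0 => z00; rewrite NE z1 z00 !expr0n mulr0 subr0.
have z1 : res1 z != 0.
  apply/eqP => z1; move: g0E; rewrite z1 expr0n mulr0 => /eqP.
  by rewrite mulf_eq0 subr_eq0 (negbTE g1) (negbTE N0).
have -> : 2%:R * (res0 g - 1) = nu2_res * (2%:R * res1 z) ^+ 2 * (red (z * tau z))^-1.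
  by apply: (mulIf N0); rewrite mulfVK// -mulrA g0E; ring.
rewrite quadratic_charM// (quadratic_charM R E2 nu2_res)// quadratic_charV// quadratic_char_sqr
  ?mulf_neq0// eta_nonsquare.
by ring.
Qed.

(** [y = 1 + g] works unless [g = -1], where [y = nu] does; a power of [pi], fixed by [tau], then
    makes it a unit. *)
Lemma unitary_hilbert90 g : unitary g -> exists z, [/\ z != 0, v z = 0 & g = z * tau z^-1].
Proof.
move=> Tg; have g0 := unitary_neq0 Tg.
have [y y0 gzE] : exists2 y, y != 0 & g = y * tau y^-1.
  have [g1|g1] := eqVneq (1 + g) 0.
    exists nu => //; rewrite fmorphV tau_nu; have -> : g = -1 by apply/eqP;
      rewrite -addr_eq0 addrC g1.
    by rewrite invrN mulrN divff.
  exists (1 + g) => //; rewrite fmorphV rmorphD rmorph1 /= -(unitary_inv Tg).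
  by field; rewrite g0 addrC g1.
pose q := pi ^ (- v y); have qn0 : q != 0 by apply: expfz_neq0.
have tq : tau q = q by rewrite fmorphXz /= tau_pi.
exists (q * y); split; first by rewrite mulf_neq0.
  by rewrite (Defs.valM vP)// (val_exprz vP)// v_pi mul1r addNr.
rewrite gzE !fmorphV rmorphM /= tq; field; by rewrite fmorph_eq0 y0 qn0.
Qed.

(** The closed form does not show this; the description by norms does. *)
Lemma sign_charM g k : unitary g -> unitary k -> sign_char (g * k) = sign_char g * sign_char k.
Proof.
move=> Tg Tk; have [z [z0 vz gz]] := unitary_hilbert90 Tg;
  have [y [y0 vy ky]] := unitary_hilbert90 Tk.
rewrite -(sign_charE Tg z0 vz gz) -(sign_charE Tk y0 vy ky).
rewrite -(@sign_charE (g * k) (z * y)); last first.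
- by rewrite gz ky !fmorphV rmorphM /=; field; rewrite !fmorph_eq0 z0 y0.
- by rewrite (Defs.valM vP)// vz vy.
- by rewrite mulf_neq0.
- exact: unitaryM.
have ON x : v x = 0 -> fixed_integer (x * tau x).
  move=> vx; split; first exact: norm_fix.
  by rewrite -[0]addr0; apply: val_geM => //; [|apply/val_ge_tau]; right; rewrite vx.
rewrite -quadratic_charM// -(red_mul (ON _ vz) (ON _ vy)); congr (eta (red _)).
by rewrite rmorphM /=; ring.
Qed.

Lemma sign_char_ulevel g t : unitary g -> ulevel 1 t -> sign_char (g * t) = sign_char g.
Proof.
move=> Tg Tt; rewrite sign_charM//; last exact: ulevel_unitary Tt.
by have [t0 _] := ulevel_res (ltn0Sn 0) Tt; rewrite {2}/sign_char t0 eqxx mulr1.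
Qed.

(** Residues identify [T / T_1] with the points of the norm-one conic over [E]; each point lifts to
    the torus by [unitary_approx]. *)
Lemma ucosets1_card : \sum_(c \in ucosets 1) (1 : R[i]) = #|E|.+1%:R.
Proof.
pose S := [set p : E * E | (p.1 ^+ 2 - nu2_res * p.2 ^+ 2 == 1)%R]%SET.
have cS : #|S| = #|E|.+1.
  apply: (card_norm_form E2 res_charD res_char_neq0 res_char_nontrivial).
    exact: (uq_nonsquare UQ).
  exact: oner_neq0.
have /choice[gl glP] (p : E * E) : exists g, p \in S -> [/\ unitary g, res0 g = p.1 & res1 g = p.2].
  have [pS|] := boolP (p \in S); last by exists 1.
  move: pS; rewrite inE => /eqP pE.
  have [f0 f1] := (lift_redP p.1, lift_redP p.2).
  pose r := lift_red p.1 + lift_red p.2 * nu.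
  have [e0 e1] := coord_eq f0.1 f1.1.
  have Ir : vge 0 r by apply/val_ge_coord; rewrite e0 e1; split; [case: f0|case: f1].
  have Itr : vge 0 (tau r) by apply/val_ge_tau.
  have ON : fixed_integer (r * tau r) by split; [exact: norm_fix|rewrite -[0]addr0; exact: val_geM].
  have O1N : fixed_integer (-1) by apply: fixed_integerN; exact: fixed_integer1.
  have hN : vge 1 (r * tau r - 1).
    apply/red_eq0; first exact: fixed_integerD.
    rewrite red_add// red_opp ?red_one//.
    rewrite -(res0_fix (norm_fix r)) res0M// /res0 /res1 qcoord0_tau qcoord1_tau.
    rewrite red_opp; last exact: fixed_integer_qcoord1.
    by rewrite e0 e1 !lift_redK -pE; ring.
  have [t Tt ht] := unitary_approx (ltn0Sn 0) Ir hN.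
  have ht0 : vge 0 (r - t) by apply: val_geW ht.
  have [d0 d1] := (res01_eq0 ht0).2 ht.
  exists t => _; have It := unitary_integer Tt; have INt := val_geN vP It.
  move: d0 d1; rewrite res0D// res1D// res0N// res1N// /res0 /res1 e0 e1 !lift_redK.
  by move=> /eqP; rewrite subr_eq0 => /eqP -> /eqP; rewrite subr_eq0 => /eqP ->.
rewrite (reindex_fsbig (fun p => ucoset 1 (gl p)) [set` enum S] (ucosets 1)); last first.
  split.
  - by move=> p /=; rewrite mem_enum => /glP[Tg _ _]; exists (gl p).
  - move=> p p' /set_mem/=; rewrite mem_enum => /glP[Tg g0 g1] /set_mem/=.
    rewrite mem_enum => /glP[Tg' g0' g1'] pp.
    have [n Tn gzE] : ucoset 1 (gl p') (gl p).
      by rewrite -pp; exists 1; rewrite ?mulr1//; exact: ulevel1.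
    have [n0 n1] := ulevel_res (ltn0Sn 0) Tn; have In := unitary_integer (ulevel_unitary Tn).
    have Ig' := unitary_integer Tg'.
    move: g0 g1; rewrite -gzE res0M// res1M// n0 n1 g0' g1' !mulr0 !mulr1 addr0 add0r.
    by case: p p' {Tg Tg' g0' g1' pp gzE Ig'} => [? ?] [? ?] /= -> ->.
  move=> _ [g Tg <-]; exists (res0 g, res1 g).
    by rewrite /= mem_enum inE /= (unitary_red Tg).
  have pS : (res0 g, res1 g) \in S by rewrite inE /= (unitary_red Tg).
  have [Tg' /= g0' g1'] := glP _ pS.
  have [Ig' Igi] := (unitary_integer Tg', unitary_integer (unitaryV Tg')).
  have Ig := unitary_integer Tg.
  apply: ucoset_eq => //; apply: res_ulevel1.
  - by apply: unitaryM => //; exact: unitaryV.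
  - rewrite res0M// res0V// res1V// g0' g1' -(unitary_red Tg); ring.
  - rewrite res1M// res0V// res1V// g0' g1'; ring.
rewrite -fsbig_seq ?enum_uniq// big_const_seq count_predT -cardE cS.
by rewrite iter_addr_0.
Qed.

Lemma weilS_ulevel1 phi t w : quasi_inv phi -> supported_in h phi -> ulevel 1 t -> weilS t phi w =
  phi w.
Proof.
move=> Mphi sphi Tt; have [hw|hw] := EM (vge h w); last first.
  have dout y : ~ vge h y -> phi y = 0 by move=> hy; apply/eqP/negP => /negP/sphi.
  rewrite (weilS_unipotent _ Tt Mphi) !dout//.
  by move/(unitary_val_geMl _ _ (unitaryV (ulevel_unitary Tt))).
have hw' : vge (h - 0%N%:Z) w by rewrite subr0.
rewrite (weilS_small Tt Mphi hw').
rewrite (Xi_fixM1 (norm_fix w) (val_ge_norm hw)) ?mul1r//.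
by apply: val_geW (ulevel_qcoord1 Tt); lia.
Qed.

(** The [lift_anti z] represent [B* / A], so the functions [delta_at (lift_anti z)] form a basis of
    this space. *)
Lemma quasi_inv_expand phi w : quasi_inv phi -> supported_in h phi ->
  phi w = \sum_z phi (lift_anti z) * delta_at (lift_anti z) w.
Proof.
move=> Mphi sphi; have hb z := lift_anti_Bs z.
have [hw|hw] := EM (vge h w); last first.
  have -> : phi w = 0 by apply/eqP/negP => /negP/sphi.
  rewrite big1// => z _; rewrite (_ : delta_at _ _ = 0) ?mulr0//.
  by apply/eqP/negP => /negP/(delta_supported (hb z) (lexx h)).
rewrite (bigD1 (sres1 w)) //= big1 ?addr0 => [|z zw]; last first.
  rewrite delta_out ?mulr0// => Aw; case/eqP: zw.
  have hN := val_geN vP (hb z).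
  move/(latticeAE (val_geB vP hw (hb z))): Aw.
  rewrite (sres1D hw hN) (sres1N (hb z)) sres1_lift_anti.
  by move/eqP; rewrite subr_eq0 => /eqP.
have Aw : latticeA (w - lift_anti (sres1 w)) by apply: latticeA_sres1_eq => //;
  rewrite sres1_lift_anti.
by rewrite delta_in// -{1}(subrK (lift_anti (sres1 w)) w) Mphi// mulrC.
Qed.

(** The left side is the trace of [S(g)] in the basis of [quasi_inv_expand]. For generic [g] one
    term of [weil_sum] meets the support, the diagonal entry is a phase quadratic in [z], and the
    trace is a quotient of two Gauss sums. For [g = -1] modulo [T_1] only [z = 0] contributes. *)
Lemma weilS_trace g : unitary g ->
  \sum_z weilS g (delta_at (lift_anti z)) (lift_anti z) =
    (res0 g == 1)%:R * #|E|.+1%:R - sign_char g.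
Proof.
move=> Tg; have Md z := quasi_inv_delta (lift_anti z); have hb z := lift_anti_Bs z.
have [Ig Igi] := (unitary_integer Tg, unitary_integer (unitaryV Tg)).
rewrite /sign_char; have [g0|g0] := eqVneq (res0 g) 1.
  have T1g := res_ulevel1 Tg g0 (res0_eq1 Tg g0).
  under eq_bigr => z _.
    rewrite (weilS_ulevel1 _ (Md z) (delta_supported (hb z) (lexx h)) T1g) delta_self.
    over.
  by rewrite sumr_const mul1r -natr1 addrK.
rewrite mul0r sub0r opprK.
have [g1|g1] := eqVneq (res1 g) 0.
  have g0N : res0 g = -1 by case: (res1_eq0 Tg g1) => // g01; rewrite g01 eqxx in g0.
  transitivity (\sum_z eta (-1) * delta_at (lift_anti z) (g^-1 * lift_anti z)).
    apply: eq_bigr => z _; rewrite /weilS (weil_sum_parabolic _ Tg (Md z) g1) /weil_const g1 eqxx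
      /=.
    by rewrite (negbTE g0) mulrA divfK.
  have hgb z : vge h (g^-1 * lift_anti z) by apply/(unitary_val_geMl _ _ (unitaryV Tg)).
  have r1g z : sres1 (g^-1 * lift_anti z) = - z.
    by rewrite sres1M// res0V// res1V// g1 g0N sres1_lift_anti oppr0 mul0r addr0 mulN1r.
  rewrite (bigD1 0) //= big1 ?addr0 => [|z z0].
    rewrite delta_in; last by apply: latticeA_sres1_eq => //; rewrite r1g sres1_lift_anti oppr0.
    have hN0 : vge h (- lift_anti 0) by apply: (val_geN vP).
    rewrite pairing_res_char ?sres0_lift_anti ?sres1_lift_anti// ?mul0r ?subrr ?res_char0 ?mulr1;
      last exact: (val_geD vP).
    rewrite g0N; have -> : 2%:R * (-1 - 1) = -1 * 2%:R ^+ 2 :> E by ring.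
    by rewrite [in RHS]quadratic_charM// (quadratic_char_sqr R E2) mulr1.
  rewrite delta_out ?mulr0// => Az.
  have hN := val_geN vP (hb z).
  move/(latticeAE (val_geB vP (hgb z) (hb z))): Az.
  rewrite (sres1D (hgb z) hN) (sres1N (hb z)) sres1_lift_anti r1g => /eqP.
  by rewrite -opprD oppr_eq0 -mulr2n -mulr_natl mulf_eq0 (negbTE E2) (negbTE z0).
transitivity ((G (res1 g))^-1 * G (2%:R * (res0 g - 1) / res1 g)); last first.
  have d0 : 2%:R * (res0 g - 1) / res1 g != 0.
    by rewrite !mulf_neq0 ?invr_eq0// subr_eq0.
  rewrite (res_char_gaussE d0) (res_char_gaussE g1) quadratic_charM// quadratic_charV//.
  have G10 := res_char_gauss_neq0 (oner_neq0 E).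
  have eg := quadratic_char_neq0 R g1.
  by field; rewrite G10 eg.
rewrite /gauss mulr_sumr; apply: eq_bigr => z _.
rewrite /weilS /weil_const g1; congr (_ * _).
(* The only [t] for which [g^-1 * (lift_fix t + lift_anti z)] has second residue [z]. *)
pose t0 := (res0 g - 1) * z / res1 g.
have ha t := lift_fix_Bs t.
have hab t : vge h (lift_fix t + lift_anti z) by apply: (val_geD vP).
have hgab t : vge h (g^-1 * (lift_fix t + lift_anti z))
  by apply/(unitary_val_geMl _ _ (unitaryV Tg)).
have r1ab t : sres1 (g^-1 * (lift_fix t + lift_anti z)) = res0 g * z - res1 g * t.
  rewrite sres1M// res0V// res1V// sres1D// sres0D//.
  by rewrite sres1_lift_anti sres0_lift_anti sres0_lift_fix sres1_lift_fix; ring.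
have r0ab t : sres0 (g^-1 * (lift_fix t + lift_anti z)) = res0 g * t - nu2_res * res1 g * z.
  rewrite sres0M// res0V// res1V// sres1D// sres0D//.
  by rewrite sres1_lift_anti sres0_lift_anti sres0_lift_fix sres1_lift_fix; ring.
have hN := val_geN vP (hb z).
rewrite /weil_sum (bigD1 t0) //= big1 ?addr0 => [|t tt0]; last first.
  rewrite /weil_term delta_out ?mulr0// => At; case/eqP: tt0.
  move/(latticeAE (val_geB vP (hgab t) (hb z))): At.
  rewrite (sres1D (hgab t) hN) (sres1N (hb z)) sres1_lift_anti r1ab => /eqP.
  rewrite subr_eq0 subr_eq => /eqP zE; rewrite /t0 mulrBl mul1r.
  apply: (mulIf g1); rewrite divfK//.
  by rewrite zE; ring.
rewrite /weil_term delta_in; last first.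
  apply: latticeA_sres1_eq => //; rewrite r1ab sres1_lift_anti /t0; field; exact: g1.
rewrite !pairing_res_char//; last exact: (val_geD vP).
rewrite (sres0D (hgab t0) hN) (sres1D (hgab t0) hN) (sres0N (hb z)) (sres1N (hb z)).
rewrite !(sres0_lift_anti, sres1_lift_anti, sres0_lift_fix, sres1_lift_fix) r0ab r1ab -res_charD;
  congr res_char.
have N1 := unitary_red Tg.
have -> : nu2_res * res1 g = (res0 g ^+ 2 - 1) / res1 g by rewrite -N1; field; exact: g1.
rewrite /t0; field; exact: g1.
Qed.

(** * Characters of conductor at most one *)

Section Average.
Variable chi : L -> R[i].
Hypothesis chiM : forall s t, unitary s -> unitary t -> chi (s * t) = chi s * chi t.
Hypothesis chi_neq0 : forall t, unitary t -> chi t <> 0.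
Hypothesis chi_Tf1 : forall t, ulevel 1 t -> chi t = 1.

Local Notation F z := (avg_delta chi 1 (lift_anti z)).
Local Notation N := (#|E|.+1%:R : R[i]).
Let N0 : N != 0. Proof. by rewrite pnatr_eq0. Qed.

Let eigen z t : ulevel 1 t -> forall w, weilS t (delta_at (lift_anti z)) w =
  chi t * delta_at (lift_anti z) w.
Proof.
move=> Tt w; rewrite chi_Tf1// mul1r weilS_ulevel1//; first exact: quasi_inv_delta.
exact: (delta_supported (lift_anti_Bs z) (lexx h)).
Qed.

Lemma weight_avg_delta_unramified z : torus_weight chi (F z).
Proof. exact: (weight_avg_delta chiM chi_neq0 (eigen z)). Qed.

Lemma avg_delta_unramified_supported z : supported_in h (F z).
Proof. exact: avg_delta_supported (lexx h) (lift_anti_Bs z). Qed.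

(** Both sides equal the sum of [chi(g)^-1 S(g) phi] over [T / T_1]: on a weight vector each of its
    [N] terms is [phi], and on the right [phi] is expanded in the basis. *)
Lemma weight_unramified_expand phi w : torus_weight chi phi -> supported_in h phi ->
  N * phi w = \sum_z phi (lift_anti z) * F z w.
Proof.
move=> [Mphi eqphi] sphi.
have -> : N * phi w = \sum_(c \in ucosets 1) chi (xget 1 c)^-1 * weilS (xget 1 c) phi w.
  rewrite -ucosets1_card !ucosets_sumE mulr_suml !big_seq; apply: eq_bigr => c /ucosets_seq Tc.
  have /eqP chi_n0 := chi_neq0 Tc.
  by rewrite eqphi// (chiV chiM chi_neq0 Tc) mulrA mulVf.
under [RHS]eq_bigr do rewrite avg_deltaE mulr_sumr.
rewrite ucosets_sumE exchange_big /=; apply: eq_bigr => c _.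
have {1}-> : phi = fun w => \sum_z phi (lift_anti z) * delta_at (lift_anti z) w.
  by apply/funext => w'; apply: quasi_inv_expand.
by rewrite weilS_sum mulr_sumr; apply: eq_bigr => z _; ring.
Qed.

(** Matrix, in the basis of the [delta_at (lift_anti z)], of the projector onto weight [chi]
    obtained by averaging [chi(g)^-1 S(g)]. *)
Let p : 'M[R[i]]_#|E| := \matrix_(i, j) (F (enum_val j) (lift_anti (enum_val i)) / N).

Let p_idempotent : p *m p = p.
Proof.
apply/matrixP => i j; rewrite !mxE.
rewrite -[X in X / N](mulKf N0) (weight_unramified_expand _ (weight_avg_delta_unramified _));
  last first.
  exact: avg_delta_unramified_supported.
rewrite [in RHS](reindex (@enum_val E predT)); last first.
  by exists enum_rank => x _; rewrite ?enum_valK ?enum_rankK.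
rewrite mulr_sumr mulr_suml; apply: eq_bigr => k _; rewrite !mxE.
by move: N N0 => n n0; field.
Qed.

Let X : R[i] := \sum_(c \in ucosets 1) chi (xget 1 c)^-1 * sign_char (xget 1 c).

(** In [weilS_trace] only the coset of [1] has [res0 = 1], and it contributes [N]; the sign terms
    sum to [- X]. Orthogonality of [chi] and [sign_char] then decides between trace [0] and [1]. *)
Let p_trace : \tr p = 1 - X / N.
Proof.
rewrite /mxtrace; under eq_bigr do rewrite mxE.
rewrite -(reindex (@enum_val E predT) (F := fun z => F z (lift_anti z) / N) (P := predT)) /=;
  last first.
  by exists enum_rank => x _; rewrite ?enum_valK ?enum_rankK.
rewrite -mulr_suml; under eq_bigr do rewrite avg_deltaE.
rewrite exchange_big /=.
have -> : \sum_(c <- fset_set (ucosets 1)) \sum_z chi (xget 1 c)^-1 * weilS (xget 1 c) (delta_at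
  (lift_anti z)) (lift_anti z) =
   \sum_(c \in ucosets 1) chi (xget 1 c)^-1 * ((res0 (xget 1 c) == 1)%:R * N - sign_char (xget 1
     c)).
  rewrite ucosets_sumE !big_seq; apply: eq_bigr => c /ucosets_seq Tc.
  by rewrite -mulr_sumr weilS_trace.
have -> : \sum_(c \in ucosets 1) chi (xget 1 c)^-1 * ((res0 (xget 1 c) == 1)%:R * N - sign_char
  (xget 1 c)) =
    N - X; last by rewrite mulrBl divff.
rewrite /X !ucosets_sumE; under eq_bigr do rewrite mulrBr.
rewrite sumrB; congr (_ - _); rewrite -ucosets_sumE.
rewrite (fsbigD1 (ucoset 1 1)) /=; last 2 first.
- exact: sub_finite_set (ucosets_finite 1).
- by exists 1 => //; exact: unitary1.
rewrite fsbig1 ?addr0; last first.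
  move=> c [cQ cn]; have [Tg cE] := ucosets_xget cQ.
  case: eqVneq => [g0|]; last by rewrite mul0r mulr0.
  case: cn; rewrite cE; apply: ucoset_eq => //; first exact: unitary1.
  by rewrite mulr1; apply: ulevelV; apply: res_ulevel1 => //; exact: res0_eq1.
have [t Tt ->] := ucoset_xget 1 unitary1; rewrite mul1r.
have [t0 _] := ulevel_res (ltn0Sn 0) Tt.
by rewrite t0 eqxx mul1r chi_Tf1 ?mul1r//; exact: ulevelV.
Qed.

Let weight_p phi : torus_weight chi phi -> supported_in h phi ->
  forall i, phi (lift_anti (enum_val i)) = \sum_j p i j * phi (lift_anti (enum_val j)).
Proof.
move=> wphi sphi i; apply: (mulfI N0); rewrite weight_unramified_expand//.
rewrite (reindex (@enum_val E predT)); last first.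
  by exists enum_rank => x _; rewrite ?enum_valK ?enum_rankK.
rewrite mulr_sumr; apply: eq_bigr => j _; rewrite mxE.
by move: N N0 => n n0; field.
Qed.

Let eq_on_lift_anti phi1 phi2 : quasi_inv phi1 -> supported_in h phi1 -> quasi_inv phi2 ->
  supported_in h phi2 ->
  (forall i : 'I_#|E|, phi1 (lift_anti (enum_val i)) = phi2 (lift_anti (enum_val i))) ->
    phi1 =1 phi2.
Proof.
move=> M1 s1 M2 s2 e12 w; rewrite (quasi_inv_expand w M1 s1) (quasi_inv_expand w M2 s2).
by apply: eq_bigr => z _; rewrite -(enum_rankK z) e12.
Qed.

(** Here [X = N], and an idempotent of trace zero has rank zero in characteristic zero. *)
Lemma weight_unramified_eta0 : (forall g, unitary g -> chi g = sign_char g) ->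
  forall phi, torus_weight chi phi -> supported_in h phi -> forall w, phi w = 0.
Proof.
move=> chiE phi wphi sphi w.
have XE : X = N.
  rewrite -ucosets1_card /X !ucosets_sumE !big_seq; apply: eq_bigr => c /ucosets_seq Tc.
  rewrite -chiE// -chiM ?mulVf ?(chi1 chiM chi_neq0)//; [exact: (unitary_neq0 Tc)|exact: unitaryV].
have /eqP : \tr p = 0 by rewrite p_trace XE divff// subrr.
rewrite (mxtrace_idempotent p_idempotent) pnatr_eq0 mxrank_eq0 => /eqP p0.
have [Mphi _] := wphi; rewrite (quasi_inv_expand w Mphi sphi) big1// => z _.
rewrite -(enum_rankK z) (weight_p wphi sphi) big1 ?mul0r// => j _.
by rewrite p0 mxE mul0r.
Qed.

(** Translating by an element where [chi] and [sign_char] differ gives [X = 0], so [p] has rank one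
    and factors as [al i * be j]. Any column with [be j != 0] spans its image, which is how [z] is
    found. *)
Lemma weight_unramified : (exists2 g, unitary g & chi g <> sign_char g) ->
  exists z : E, (exists w, F z w <> 0) /\
    forall phi, torus_weight chi phi -> supported_in h phi ->
      exists c, forall w, phi w = c * F z w.
Proof.
move=> [k Tk /eqP nk].
have X0 : X = 0.
  have inv g t : unitary g -> ulevel 1 t -> chi (g * t)^-1 * sign_char (g * t) =
    chi g^-1 * sign_char g.
    move=> Tg Tt; rewrite sign_char_ulevel// invfM chiM; try exact: unitaryV;
      last exact: (unitaryV (ulevel_unitary Tt)).
    by rewrite (chi_Tf1 (ulevelV Tt)) mulr1.
  have XE : X = chi k^-1 * sign_char k * X.
    rewrite {1}/X (ucosets_sum_translate (F := fun g => chi g^-1 * sign_char g) Tk inv).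
    rewrite /X !ucosets_sumE mulr_sumr !big_seq; apply: eq_bigr => c /ucosets_seq Tc.
    by rewrite sign_charM// invfM chiM; [ring|exact: unitaryV|exact: unitaryV].
  have /eqP k0 := chi_neq0 Tk.
  have /eqP : (1 - chi k^-1 * sign_char k) * X = 0 by rewrite mulrBl mul1r -XE subrr.
  rewrite mulf_eq0 => /orP[|/eqP//]; rewrite subr_eq0 => /eqP kE.
  case/eqP: nk; rewrite -[LHS]mulr1 kE mulrA (chiV chiM chi_neq0 Tk) divff ?mul1r//.
have /eqP : \tr p = 1 by rewrite p_trace X0 mul0r subr0.
rewrite (mxtrace_idempotent p_idempotent) (eqr_nat _ _ 1) => /eqP rk.
have [al [be pE]] : exists (al be : 'I_#|E| -> R[i]), forall i j, p i j = al i * be j.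
  have := mulmx_base p; move: (col_base p) (row_base p); rewrite rk => Cp Rp pE.
  by exists (fun i => Cp i 0), (fun j => Rp 0 j) => i j; rewrite -pE mxE big_ord1.
have [i [j pij]] : exists i j, p i j != 0.
  apply: contrapT => np; have p0 : p = 0.
    apply/matrixP => i j; rewrite [RHS]mxE; apply/eqP/negP => /negP h0.
    by apply: np; exists i, j.
  by move: rk; rewrite p0 mxrank0.
have bej : be j != 0 by apply: contraNneq pij => b0; rewrite pE b0 mulr0.
have FE i' : F (enum_val j) (lift_anti (enum_val i')) = N * (al i' * be j).
  by rewrite -pE mxE mulrC divfK.
exists (enum_val j); split.
  exists (lift_anti (enum_val i)); apply/eqP; rewrite FE -pE mulf_neq0//.
move=> phi wphi sphi; have [Mphi _] := wphi.
have [MF _] := weight_avg_delta_unramified (enum_val j).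
exists ((\sum_k be k * phi (lift_anti (enum_val k))) / (N * be j)).
apply: eq_on_lift_anti => //.
- by move=> a w Aa; rewrite MF//; ring.
- by move=> w; rewrite mulf_eq0 negb_or => /andP[_ /avg_delta_unramified_supported].
move=> i'; rewrite FE (weight_p wphi sphi).
under eq_bigr do rewrite pE -mulrA.
by rewrite -mulr_sumr; move: N N0 => n n0; field; rewrite n0 bej.
Qed.

End Average.

End UnramifiedQuadratic.

Arguments qcoord0 {L} tau x.
Arguments qcoord1 {L} tau nu x.
Arguments fixed_integer {L} v tau x.
Arguments res0 {L} tau {E} red x.
Arguments res1 {L} tau nu {E} red x.
Arguments unitary {L} tau g.
Arguments ulevel {L} v tau i g.

(** * Traces in quadratic extensions *)

Section Trace.
Variable k : fieldType.

Definition lfun_trace (V : vectType k) (f : 'End(V)) : k :=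
  \tr (passmx.mxof (vbasis {:V}) (vbasis {:V}) f).

Lemma lfun_traceC (V W : vectType k) (f : 'Hom(V, W)) (g : 'Hom(W, V)) :
  lfun_trace (g \o f)%VF = lfun_trace (f \o g)%VF.
Proof.
have [bV bW] := (vbasisP {:V}, vbasisP {:W}).
by rewrite /lfun_trace (passmx.mxof_comp _ _ bW) (passmx.mxof_comp _ _ bV) mxtrace_mulC.
Qed.

Lemma lfun_traceP (V : vectType k) (a : k) (f g : 'End(V)) :
  lfun_trace (a *: f + g) = a * lfun_trace f + lfun_trace g.
Proof. by rewrite /lfun_trace passmx.mxof_linear mxtraceD mxtraceZ. Qed.

Lemma lfun_traceD (V : vectType k) (f g : 'End(V)) :
  lfun_trace (f + g) = lfun_trace f + lfun_trace g.
Proof. by rewrite -{1}[f]scale1r lfun_traceP mul1r. Qed.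

Lemma lfun_traceZ (V : vectType k) (a : k) (f : 'End(V)) :
  lfun_trace (a *: f) = a * lfun_trace f.
Proof.
have t0 : lfun_trace (0 : 'End(V)) = 0.
  by have := lfun_traceD (0 : 'End(V)) 0; rewrite addr0 => /eqP;
    rewrite -subr_eq0 opprD addNKr oppr_eq0 => /eqP.
by rewrite -[a *: f]addr0 lfun_traceP t0 addr0.
Qed.

Lemma field_traceE (L : fieldExtType k) (x : L) : field_trace x = lfun_trace (amull x).
Proof. by []. Qed.

Lemma field_traceD (L : fieldExtType k) (x y : L) :
  field_trace (x + y) = field_trace x + field_trace y.
Proof. by rewrite !field_traceE -lfun_traceD; congr lfun_trace; exact: linearD. Qed.

Lemma field_traceZ (L : fieldExtType k) (a : k) (x : L) :
  field_trace (a *: x) = a * field_trace x.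
Proof. by rewrite !field_traceE -lfun_traceZ; congr lfun_trace; exact: linearZ. Qed.

Lemma field_traceN (L : fieldExtType k) (x : L) : field_trace (- x) = - field_trace x.
Proof. by rewrite -scaleN1r field_traceZ mulN1r. Qed.

Section Quadratic.
Variables (L : fieldExtType k) (K : {subfield L}) (tau : 'End(L)) (nu : L).
Hypotheses (dimK : \dim_K {:L} = 2%N) (tauP : kAut K {:L} tau).
Hypotheses (two0 : (2%:R : L) != 0) (nu0 : nu != 0) (tau_nu : tau nu = - nu).

Lemma kAut_mul x y : tau (x * y) = tau x * tau y.
Proof. by have /kHomP_tmp[_ ->] := kHom_kAut_sub tauP; rewrite ?memvf. Qed.

Lemma kAut_fix x : x \in K -> tau x = x.
Proof. by have /kHomP_tmp[idK _] := kHom_kAut_sub tauP; apply: idK. Qed.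

Lemma kAut_one : tau 1 = 1.
Proof. by apply: kAut_fix; exact: mem1v. Qed.

Lemma quadratic_notin : nu \notin K.
Proof.
apply/negP => /kAut_fix; rewrite tau_nu => /eqP; rewrite eq_sym -subr_eq0 opprK -mulr2n -mulr_natl.
by rewrite mulf_eq0 (negbTE two0) (negbTE nu0).
Qed.

Lemma quadratic_decomp x : exists a b, [/\ a \in K, b \in K & x = a + b * nu].
Proof.
have cap0 : (K :&: (K * <[nu]>) = 0)%VS.
  apply/eqP; rewrite -subv0; apply/subvP => y; rewrite memv_cap => /andP[yK].
  case/memv_cosetP => b bK yE; rewrite memv0; apply: contraNT quadratic_notin => y0.
  have b0 : b != 0 by apply: contraNneq y0 => b0; rewrite yE b0 mul0r.
  by rewrite (_ : nu = b^-1 * y) ?rpredM ?rpredV// yE mulKf.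
have full : (K + K * <[nu]> = fullv)%VS.
  apply/eqP; rewrite eqEdim subvf /= dimv_disjoint_sum// dim_cosetv//.
  by rewrite (dim_sup_field (subvf K)) dimK mul2n addnn.
have : x \in (K + K * <[nu]>)%VS by rewrite full memvf.
case/memv_addP => a aK [_ /memv_cosetP[b bK ->] ->].
by exists a, b.
Qed.

Lemma quadratic_tauE a b : a \in K -> b \in K -> tau (a + b * nu) = a - b * nu.
Proof. by move=> aK bK; rewrite linearD /= kAut_mul (kAut_fix aK) (kAut_fix bK) tau_nu mulrN. Qed.

Lemma quadratic_fixP x : reflect (tau x = x) (x \in K).
Proof.
apply: (iffP idP) => [|tx]; first exact: kAut_fix.
have [a [b [aK bK xE]]] := quadratic_decomp x.
move: tx; rewrite xE quadratic_tauE// => /addrI/eqP.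
rewrite eq_sym -subr_eq0 opprK -mulr2n -mulr_natl mulrA !mulf_eq0 (negbTE two0) (negbTE nu0) orbF.
by move=> /eqP ->; rewrite mul0r addr0.
Qed.

Lemma quadratic_tauK x : tau (tau x) = x.
Proof.
have [a [b [aK bK ->]]] := quadratic_decomp x.
by rewrite quadratic_tauE// linearB /= kAut_mul (kAut_fix aK) (kAut_fix bK) tau_nu mulrN opprK.
Qed.

(** Multiplication by [tau x] is the conjugate of multiplication by [x] under the involution
    [tau]. *)
Lemma field_trace_tau x : field_trace (tau x) = field_trace x.
Proof.
rewrite !field_traceE.
have -> : amull (tau x) = (tau \o (amull x \o tau))%VF.
  by apply/lfunP => y; rewrite !comp_lfunE !lfunE /= kAut_mul quadratic_tauK.
rewrite lfun_traceC; congr lfun_trace.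
by apply/lfunP => y; rewrite !comp_lfunE quadratic_tauK.
Qed.

(** On each summand of [L = K + K nu], multiplication by [x] is a copy of that on [K]. The maps
    [i0], [i1] and [p0], [p1] are the injections and projections, and cyclicity of the trace brings
    both copies back to [K]. *)
Lemma field_trace_sub x : x \in K -> field_trace x = 2%:R * field_trace (vsproj K x).
Proof.
move=> xK; pose V := subvs_of K.
pose i0 : 'Hom(V, L) := linfun (vsval : V -> L).
pose i1 : 'Hom(V, L) := (amulr nu \o i0)%VF.
pose pr : 'Hom(L, V) := linfun (vsproj K).
pose half : 'End(L) := 2%:R^-1 *: (\1%VF + tau).
pose p0 : 'Hom(L, V) := (pr \o half)%VF.
pose p1 : 'Hom(L, V) := (p0 \o amulr (nu^-1)%R)%VF.
have two0k : (2%:R : k) != 0.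
  apply: contraNneq two0 => h; have -> : (2%:R : L) = (2%:R : k)%:A by rewrite scaler_nat.
  by rewrite h scale0r.
have halfE a b : a \in K -> b \in K -> half (a + b * nu) = a.
  move=> aK bK; rewrite scale_lfunE add_lfunE id_lfunE quadratic_tauE//.
  by rewrite addrACA subrr addr0 -mulr2n -scaler_nat scalerA mulVf// scale1r.
have nuK : nu ^+ 2 \in K.
  by apply/quadratic_fixP; rewrite expr2 kAut_mul tau_nu mulrNN.
have p0E a b : a \in K -> b \in K -> p0 (a + b * nu) = vsproj K a.
  by move=> aK bK; rewrite comp_lfunE halfE// lfunE.
have p1E a b : a \in K -> b \in K -> p1 (a + b * nu) = vsproj K b.
  move=> aK bK.
  have -> : p1 (a + b * nu) = p0 ((a + b * nu) * nu^-1) by rewrite /p1 comp_lfunE [amulr _ _]lfunE.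
  have -> : (a + b * nu) * nu^-1 = b + (a / nu ^+ 2) * nu by field.
  by rewrite p0E// rpred_div.
have i0E y : i0 y = vsval y by rewrite lfunE.
have i1E y : i1 y = vsval y * nu by rewrite /i1 comp_lfunE [amulr _ _]lfunE /= i0E.
pose m : 'End(V) := amull (vsproj K x).
have -> : field_trace (vsproj K x) = lfun_trace m by [].
clearbody p1 p0 i1 i0.
have E : amull x = (i0 \o (m \o p0))%VF + (i1 \o (m \o p1))%VF.
  apply/lfunP => y; have [a [b [aK bK ->]]] := quadratic_decomp y.
  rewrite add_lfunE !comp_lfunE p0E// p1E// i0E i1E /m ![amull _ _]lfunE /= !vsprojK//.
  by rewrite mulrDr mulrA.
rewrite field_traceE E lfun_traceD !(lfun_traceC _ i0) !(lfun_traceC _ i1).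
have -> : ((m \o p0) \o i0 = m)%VF.
  apply/lfunP => y; rewrite !comp_lfunE i0E -[vsval y]addr0 -[0](mul0r nu).
  by rewrite p0E ?subvsP ?mem0v// vsvalK.
have -> : ((m \o p1) \o i1 = m)%VF.
  apply/lfunP => y; rewrite !comp_lfunE i1E -[_ * nu]add0r.
  by rewrite p1E ?subvsP ?mem0v// vsvalK.
by rewrite -mulr2n mulr_natl.
Qed.

Lemma field_trace_anti x : tau x = - x -> field_trace x = 0.
Proof.
move=> tx; have := field_trace_tau x; rewrite tx field_traceN => /eqP.
rewrite eq_sym -subr_eq0 opprK -mulr2n -mulr_natl mulf_eq0 => /orP[|/eqP//].
move=> two0k; case/eqP: two0; have -> : (2%:R : L) = (2%:R : k)%:A by rewrite scaler_nat.
by rewrite (eqP two0k) scale0r.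
Qed.

End Quadratic.
End Trace.

(** * The function theta on generic symplectic maps *)

Section SquareClasses.
Variable F : finFieldType.

Lemma same_square_class_trans (a c d : F) :
  same_square_class a c -> same_square_class c d -> same_square_class a d.
Proof.
move=> [x x0 ->] [y y0 ->]; exists (y * x); first by rewrite mulf_neq0.
by ring.
Qed.

Lemma same_square_classM (a c a' c' : F) :
  same_square_class a c -> same_square_class a' c' -> same_square_class (a * a') (c * c').
Proof.
move=> [x x0 ->] [y y0 ->]; exists (x * y); first by rewrite mulf_neq0.
by ring.
Qed.

End SquareClasses.

Section DetOn.
Variables (F : finFieldType) (b : vectType F) (X : {vspace b}).

(** [det_on] is computed in [vbasis X]; the base change [Q] intertwines the two matrices of [f]. *)
Lemma det_on_basis (l : nat) (eps : l.-tuple b) (f : 'End(b)) (N : 'M[F]_l) :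
  basis_of X eps -> (forall i, f (tnth eps i) = \sum_j N i j *: tnth eps j) ->
  det_on X f = \det N.
Proof.
move=> beps; have El := size_basis beps; move: eps N beps; rewrite -El => eps N beps fE.
pose vb := vbasis X; have bvb : basis_of X vb by exact: vbasisP.
have epsX i : tnth eps i \in X by apply: (basis_mem beps); exact: mem_tnth.
have vbX i : tnth vb i \in X by apply: vbasis_mem; exact: mem_tnth.
have epsE (x : b) : x \in X -> x = \sum_i coord eps i x *: tnth eps i.
  move=> xX; rewrite {1}(coord_basis beps xX).
  by apply: eq_bigr => i _; rewrite (tnth_nth 0).
have vbE (x : b) : x \in X -> x = \sum_i coord vb i x *: tnth vb i.
  move=> xX; rewrite {1}(coord_basis bvb xX).
  by apply: eq_bigr => i _; rewrite (tnth_nth 0).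
have epsI (a c : 'I_(\dim X) -> F) : \sum_i a i *: tnth eps i = \sum_i c i *: tnth eps i -> a =1 c.
  move=> ac i; have := congr1 (coord eps i) ac.
  have sE (d : 'I_(\dim X) -> F) : \sum_i d i *: tnth eps i = \sum_i d i *: eps`_i.
    by apply: eq_bigr => j _; rewrite (tnth_nth 0).
  by rewrite !sE !coord_sum_free ?(basis_free beps).
pose Q : 'M[F]_(\dim X) := \matrix_(i, j) coord eps j (tnth vb i).
pose Q' : 'M[F]_(\dim X) := \matrix_(i, j) coord vb j (tnth eps i).
have sumZ (A B : 'M[F]_(\dim X)) (y z : 'I_(\dim X) -> b) i :
    (forall j, y j = \sum_k B j k *: z k) -> \sum_j A i j *: y j = \sum_k (A *m B) i k *: z k.
  move=> yE; transitivity (\sum_j \sum_k (A i j * B j k) *: z k).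
    by apply: eq_bigr => j _; rewrite yE scaler_sumr; apply: eq_bigr => k _; rewrite scalerA.
  by rewrite exchange_big; apply: eq_bigr => k _; rewrite mxE scaler_suml.
have vbQ i : tnth vb i = \sum_j Q i j *: tnth eps j.
  by rewrite {1}(epsE _ (vbX i)); apply: eq_bigr => j _; rewrite mxE.
have epsQ i : tnth eps i = \sum_j Q' i j *: tnth vb j.
  by rewrite {1}(vbE _ (epsX i)); apply: eq_bigr => j _; rewrite mxE.
have QQ : Q' *m Q = 1%:M.
  apply/matrixP => i j; apply: (epsI (fun j => (Q' *m Q) i j) (fun j => (1%:M : 'M[F]_(\dim X)) i
    j)).
  rewrite -(sumZ _ _ (tnth vb) (tnth eps))// -epsQ (bigD1 i) //= mxE eqxx scale1r big1 ?addr0// =>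
    k ki.
  by rewrite mxE eq_sym (negbTE ki) scale0r.
pose Mf := \matrix_(i, j) coord vb j (f (tnth vb i)).
have fX x : x \in X -> f x \in X.
  move=> /epsE ->; rewrite linear_sum; apply: rpred_sum => i _; rewrite linearZ /= fE.
  by apply: rpredZ; apply: rpred_sum => j _; apply: rpredZ.
have fvb i : f (tnth vb i) = \sum_j Mf i j *: tnth vb j.
  by rewrite {1}(vbE _ (fX _ (vbX i))); apply: eq_bigr => j _; rewrite mxE.
have MQ : Mf *m Q = Q *m N.
  apply/matrixP => i j; apply: (epsI (fun j => (Mf *m Q) i j) (fun j => (Q *m N) i j)).
  rewrite -(sumZ Mf Q (tnth vb) (tnth eps))// -fvb vbQ linear_sum /=.
  rewrite -(sumZ Q N (fun j => f (tnth eps j)) (tnth eps))//.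
  by apply: eq_bigr => k _; rewrite linearZ.
have dQ : \det Q != 0.
  by have := congr1 determinant QQ; rewrite det_mulmx det1; apply: contra_eq_neq => ->;
    rewrite mulr0 eq_sym oner_eq0.
have := congr1 determinant MQ; rewrite !det_mulmx [RHS]mulrC => /(mulIf dQ) <-.
by [].
Qed.

End DetOn.

Section ThetaGeneric.
Variables (F : finFieldType) (b : vectType F) (form : b -> b -> F) (X : {vspace b}).
Hypothesis formL : forall a x y z, form (a *: x + y) z = a * form x z + form y z.
Hypothesis formR : forall a x y z, form z (a *: x + y) = a * form z x + form z y.
Hypothesis form_anti : forall x y, form x y = - form y x.
Variables (theta : 'End(b) -> F) (thetaP : theta_function form X theta).
Variables (l : nat) (eps phi : l.-tuple b).
Hypothesis sb : symplectic_basis form X eps phi.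
Hypothesis theta_tau : forall (S : {set 'I_l}) h, is_tau_S eps phi S h ->
  same_square_class (theta h) 1.

Let form0l z : form 0 z = 0.
Proof. by have := formL 1 0 0 z; rewrite scaler0 addr0 mul1r => /eqP;
  rewrite -subr_eq0 opprD addNKr oppr_eq0 => /eqP. Qed.
Let form0r z : form z 0 = 0. Proof. by rewrite form_anti form0l oppr0. Qed.
Let formZl a x z : form (a *: x) z = a * form x z.
Proof. by rewrite -[a *: x]addr0 formL form0l addr0. Qed.
Let formZr a x z : form z (a *: x) = a * form z x.
Proof. by rewrite -[a *: x]addr0 formR form0r addr0. Qed.
Let form_suml (I : finType) (a : I -> F) (y : I -> b) z :
  form (\sum_i a i *: y i) z = \sum_i a i * form (y i) z.
Proof.
by elim/big_rec2: _ => [|i x1 x2 _ IH]; rewrite ?form0l// formL IH.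
Qed.
Let form_sumr (I : finType) (a : I -> F) (y : I -> b) z :
  form z (\sum_i a i *: y i) = \sum_i a i * form z (y i).
Proof.
by elim/big_rec2: _ => [|i x1 x2 _ IH]; rewrite ?form0r// formR IH.
Qed.

Let ep := tnth eps.
Let ph := tnth phi.
Let fee i j : form (ep i) (ep j) = 0. Proof. by case: sb => _ _ /(_ i j)[]. Qed.
Let fpp i j : form (ph i) (ph j) = 0. Proof. by case: sb => _ _ /(_ i j)[]. Qed.
Let fep i j : form (ep i) (ph j) = (i == j)%:R. Proof. by case: sb => _ _ /(_ i j)[]. Qed.
Let fpe i j : form (ph i) (ep j) = - (i == j)%:R.
Proof. by case: sb => _ _ /(_ j i)[_ _ _ ->]; rewrite eq_sym. Qed.

Let decomp x : exists a c : 'I_l -> F, x = \sum_i a i *: ep i + \sum_i c i *: ph i.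
Proof.
case: sb => bf _ _; have : x \in (<<eps>> + <<phi>>)%VS by rewrite -span_cat (span_basis bf) memvf.
case/memv_addP => y /coord_span yE [z /coord_span zE ->].
exists (fun i => coord eps i y), (fun i => coord phi i z); rewrite {1}yE {1}zE.
by congr (_ + _); apply: eq_bigr => i _; rewrite /ep /ph (tnth_nth 0).
Qed.

Let lin_ext (s t : 'I_l -> b) : exists f : 'End(b), forall i, f (ep i) = s i /\ f (ph i) = t i.
Proof.
case: sb => bf _ _; pose im := map s (enum 'I_l) ++ map t (enum 'I_l).
have [f fE] := linear_of_free (eps ++ phi) im.
have /fE : free (eps ++ phi) by exact: basis_free bf.
have se : size (enum 'I_l) = l := size_enum_ord l.
have sim : size im = size (eps ++ phi).
  rewrite /im !size_cat !size_map (size_tuple eps) (size_tuple phi).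
  by congr (_ + _)%N; rewrite -enumT; exact: size_enum_ord.
move=> /(_ sim).
rewrite map_cat => /eqP; rewrite eqseq_cat; last by rewrite !size_map (size_tuple eps);
  rewrite -enumT; exact: esym (size_enum_ord l).
move=> /andP[/eqP h1 /eqP h2].
exists (linfun f) => i; rewrite !lfunE /ep /ph !(tnth_nth 0); split.
  have := congr1 (fun s => nth 0 s i) h1; rewrite (nth_map 0) ?size_tuple// => ->.
  by rewrite (nth_map i) ?size_enum_ord// nth_ord_enum.
have := congr1 (fun s => nth 0 s i) h2; rewrite (nth_map 0) ?size_tuple// => ->.
by rewrite (nth_map i) ?size_enum_ord// nth_ord_enum.
Qed.

Let symp_ext (f : 'End(b)) :
  (forall i j, form (f (ep i)) (f (ep j)) = 0) ->
  (forall i j, form (f (ep i)) (f (ph j)) = (i == j)%:R) ->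
  (forall i j, form (f (ph i)) (f (ph j)) = 0) -> symplectic form f.
Proof.
move=> h1 h2 h3 x y; have [a [c ->]] := decomp x; have [a' [c' ->]] := decomp y.
have h4 i j : form (f (ph i)) (f (ep j)) = - (i == j)%:R by rewrite form_anti h2 eq_sym.
have formDl x1 x2 z : form (x1 + x2) z = form x1 z + form x2 z.
  by rewrite -{1}[x1]scale1r formL mul1r.
have formDr x1 x2 z : form z (x1 + x2) = form z x1 + form z x2.
  by rewrite -{1}[x1]scale1r formR mul1r.
have fs (d : 'I_l -> F) (z : 'I_l -> b) : f (\sum_i d i *: z i) = \sum_i d i *: f (z i).
  by rewrite linear_sum; apply: eq_bigr => i _; rewrite linearZ.
rewrite !linearD /= !fs !(formDl, formDr) !form_suml.
by congr (_ + _ + (_ + _)); apply: eq_bigr => i _; congr (_ * _); rewrite !form_sumr;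
  apply: eq_bigr => j _; rewrite ?(h1, h2, h3, h4) ?(fee, fep, fpe, fpp).
Qed.

Let symp_ker (f : 'End(b)) : symplectic form f -> lker f == 0%VS.
Proof.
move=> fs; rewrite -subv0; apply/subvP => x; rewrite memv_ker memv0 => /eqP fx0.
have x0 z : form x z = 0 by rewrite -fs fx0 form0l.
have formDl x1 x2 z : form (x1 + x2) z = form x1 z + form x2 z.
  by rewrite -{1}[x1]scale1r formL mul1r.
have [a [c xE]] := decomp x; rewrite xE.
rewrite !big1 ?addr0// => i _.
  have := x0 (ep i); rewrite xE formDl !form_suml.
  rewrite [X in X + _]big1 => [|j _]; last by rewrite fee mulr0.
  rewrite add0r (bigD1 i) //= big1 => [|j ji]; last by rewrite fpe (negbTE ji) oppr0 mulr0.
  by rewrite fpe eqxx addr0 mulrN1 => /eqP; rewrite oppr_eq0 => /eqP ->; rewrite scale0r.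
have := x0 (ph i); rewrite xE formDl !form_suml.
rewrite [X in _ + X]big1 => [|j _]; last by rewrite fpp mulr0.
rewrite addr0 (bigD1 i) //= big1 => [|j ji]; last by rewrite fep (negbTE ji) mulr0.
by rewrite fep eqxx addr0 mulr1 => ->; rewrite scale0r.
Qed.

(** Bruhat decomposition on the open cell. Invertibility of [C] means that [h X] is transverse to
    [X]; then [h] is the composite of [p1], [tt], [p2], where [tt] is the full [tau_S], [p1] is the
    identity on [X] and [p2] has matrix [C^T] on [X]. Only [p2] contributes to [theta]. *)
Lemma theta_generic (h : 'End(b)) : symplectic form h ->
  let C := \matrix_(i, j) form (tnth eps i) (h (tnth eps j)) in
  C \in unitmx -> same_square_class (theta h) (\det C).
Proof.
move=> hs C Cu.
have CE i j : C i j = form (ep i) (h (ep j)) by rewrite mxE.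
clearbody C; pose W := invmx C.
have [tt ttE] := lin_ext ph (fun i => - ep i).
(* The inverse [W] makes the images of the [ph k] dual to the [ep i], whose pairing with [h (ep j)]
   is [C i j]. *)
have [p1 p1E] := lin_ext ep (fun k => \sum_j W j k *: h (ep j)).
have tt_s : symplectic form tt.
  apply: symp_ext => i j; rewrite ?(ttE i).1 ?(ttE j).1 ?(ttE i).2 ?(ttE j).2 ?fpp//.
    by rewrite -scaleN1r formZr fpe mulN1r opprK.
  by rewrite -!scaleN1r formZl formZr fee !mulr0.
have p1_s : symplectic form p1.
  apply: symp_ext => i j; rewrite ?(p1E i).1 ?(p1E j).1 ?(p1E i).2 ?(p1E j).2 ?fee//.
    rewrite form_sumr; have := congr1 (fun A : 'M[F]_l => A i j) (mulmxV Cu).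
    by rewrite !mxE => <-; apply: eq_bigr => k _; rewrite CE mulrC.
  rewrite form_suml big1// => k _; rewrite form_sumr big1 ?mulr0// => k' _.
  by rewrite hs fee mulr0.
have [kt k1] := (symp_ker tt_s, symp_ker p1_s).
pose p2 := (tt^-1 \o (p1^-1 \o h))%VF.
have hE : h = (p1 \o tt \o p2)%VF.
  by rewrite /p2 -comp_lfunA lker0_compVKf// lker0_compVKf.
clearbody p2.
have hz z : h z = p1 (tt (p2 z)) by rewrite {1}hE !comp_lfunE.
have p2_s : symplectic form p2.
  by move=> y z; rewrite -[RHS]hs !hz p1_s tt_s.
have bX : basis_of X eps by case: sb.
have p2E j : p2 (ep j) = \sum_i C^T j i *: ep i.
  apply: (lker0P kt); apply: (lker0P k1); rewrite -hz !linear_sum /=.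
  transitivity (\sum_i \sum_m (C i j * W m i) *: h (ep m)); last first.
    apply: eq_bigr => i _; rewrite !linearZ /= (ttE i).1 (p1E i).2 mxE scaler_sumr.
    by apply: eq_bigr => m _; rewrite scalerA.
  rewrite exchange_big (bigD1 j) //= [X in _ + X]big1 ?addr0.
    rewrite -scaler_suml; have := congr1 (fun A : 'M[F]_l => A j j) (mulVmx Cu).
    rewrite !mxE eqxx => Wj; rewrite (_ : \sum_i _ = 1) ?scale1r// -[RHS]Wj.
    by apply: eq_bigr => i _; rewrite mulrC.
  move=> m mj; rewrite -scaler_suml; have := congr1 (fun A : 'M[F]_l => A m j) (mulVmx Cu).
  rewrite !mxE (negbTE mj) => Wj; rewrite (_ : \sum_i _ = 0) ?scale0r// -[RHS]Wj.
  by apply: eq_bigr => i _; rewrite mulrC.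
have p1p : parabolic form X p1.
  split=> //; rewrite -(span_basis bX) limg_span; congr (<<_>>)%VS.
  apply: (@eq_from_nth _ 0) => [|i]; rewrite size_map// size_tuple => il.
  rewrite (nth_map 0) ?size_tuple//.
  by have := (p1E (Ordinal il)).1; rewrite /ep (tnth_nth 0).
have p2p : parabolic form X p2.
  split; first exact: p2_s.
  apply/eqP; rewrite eqEdim (limg_dim_eq _) ?leqnn ?andbT; last first.
    by rewrite (eqP (symp_ker p2_s)) capv0.
  rewrite -{1}(span_basis bX) limg_span; apply/span_subvP => _ /mapP[x xe ->].
  have [i ->] := tnthP _ _ xe.
  rewrite -/(ep i) p2E; apply: rpred_sum => m _; apply: rpredZ.
  by apply: (basis_mem bX); exact: mem_tnth.
have d1 : det_on X p1 = 1.
  rewrite (det_on_basis (N := 1%:M) bX) ?det1// => i.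
  rewrite (p1E i).1 (bigD1 i) //= mxE eqxx scale1r big1 ?addr0// => m mi.
  by rewrite mxE eq_sym (negbTE mi) scale0r.
have d2 : det_on X p2 = \det C by rewrite (det_on_basis bX p2E) det_tr.
have th1 := theta_parabolic thetaP p1p; have th2 := theta_parabolic thetaP p2p.
have tht : same_square_class (theta tt) 1.
  apply: (theta_tau (S := [set: 'I_l]%SET)) => i; rewrite finset.in_setT; exact: ttE.
rewrite hE; apply: same_square_class_trans (thetaM thetaP p1p tt_s p2p) _.
have -> : \det C = 1 * 1 * \det C by rewrite !mul1r.
rewrite d1 in th1; rewrite d2 in th2.
by apply: same_square_classM => //; apply: same_square_classM.
Qed.

End ThetaGeneric.

(** * Comparison with the Weil representation of the setting *)

Lemma scaled_coordE (F : fieldType) (a b p q n : F) : p != 0 -> q != 0 ->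
  p * (a / p + b / (p * q) * q * n) = a + b * n.
Proof. by move=> p0 q0; field; rewrite p0 q0. Qed.

(** [tau] is only a linear map by its type; as a plain function it can carry the ring morphism
    structure required by the records above. *)
Definition tauf (R : realType) (D : torus_setting R) (x : Lfield D) : Lfield D := tau D x.

Lemma tauf_zmod_morphism (R : realType) (D : torus_setting R) : zmod_morphism (@tauf R D).
Proof. by move=> x y; rewrite /tauf linearB. Qed.

Lemma tauf_monoid_morphism (R : realType) (D : torus_setting R) : monoid_morphism (@tauf R D).
Proof.
split; first exact: (kAut_one (tau_aut D)).
by move=> x y; exact: (kAut_mul (tau_aut D)).
Qed.

HB.instance Definition _ (R : realType) (D : torus_setting R) :=
  GRing.isZmodMorphism.Build (Lfield D) (Lfield D) (@tauf R D) (tauf_zmod_morphism (D := D)).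
HB.instance Definition _ (R : realType) (D : torus_setting R) :=
  GRing.isMonoidMorphism.Build (Lfield D) (Lfield D) (@tauf R D) (tauf_monoid_morphism D).

(** * The setting as an instance of the two records *)

Section Setting.
Variables (R : realType) (D : torus_setting R).
Local Notation k := (kfield D).
Local Notation L := (Lfield D).
Local Notation K := (Kfield D).
Local Notation kv := (kval D).
Local Notation v := (Lval D).
Local Notation vge := (val_ge v).
Local Notation pi := (varpi' D).
Local Notation u := (uelt D).
Local Notation nu := (nu D).
Local Notation ta := (@tauf R D).

Let vP := Lval_val D.
Let kvP := lf_val (k_local D).

Lemma two_k : (2%:R : k) != 0.
Proof.
by have := lf_char0 (k_local D) 2%N; rewrite !inE /= => /negbT.
Qed.

Lemma two_kappa : (2%:R : kappa D) != 0.
Proof. by have := lf_odd (k_local D); rewrite !inE /=. Qed.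

Lemma kval_nat n : val_ge kv 0 n%:R.
Proof.
elim: n => [|n IHn]; first by left.
by rewrite -natr1; apply: (val_geD kvP) => //; right; rewrite (val_one kvP).
Qed.

Lemma kval_two : kv 2%:R = 0.
Proof.
have O2 := kval_nat 2; have RM := lf_residue (k_local D).
case: (O2) => [/eqP|h]; first by rewrite (negbTE two_k).
apply/eqP; rewrite eq_le h andbT leNgt; apply/negP => h1.
have O1 : integers kv 1 by right; rewrite (val_one kvP).
have : red (2%:R : k) = 0 by apply/(red_ker RM) => //; right; lia.
have -> : (2%:R : k) = 1 + 1 by rewrite -[2%:R]natr1.
rewrite (Defs.redD RM)// (Defs.red1 RM) => /eqP.
by rewrite -(natrD _ 1 1) (negbTE two_kappa).
Qed.

Lemma two_L : (2%:R : L) != 0.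
Proof.
have -> : (2%:R : L) = (2%:R : k)%:A by rewrite scaler_nat.
by rewrite scaler_eq0 negb_or two_k oner_eq0.
Qed.

Lemma Lval_two : v 2%:R = 0.
Proof.
have -> : (2%:R : L) = (2%:R : k)%:A by rewrite scaler_nat.
by rewrite Lval_ext ?two_k// kval_two mulr0.
Qed.

Lemma pi_neq0 : pi != 0. Proof. by apply/eqP; case: (varpi'P D). Qed.
Lemma v_pi : v pi = 1. Proof. by case: (varpi'P D). Qed.
Lemma varpi_neq0 : varpi D != 0. Proof. by apply/eqP; case: (varpiP D). Qed.
Lemma kv_varpi : kv (varpi D) = 1. Proof. by case: (varpiP D). Qed.
Lemma u_n0 : u != 0. Proof. by apply/eqP; exact: u_neq0. Qed.
Lemma tau_u : ta u = - u.
Proof. by apply/eqP; rewrite -addr_eq0 addrC; apply/eqP; exact: u_trace0. Qed.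
Lemma tau_pi : ta pi = pi.
Proof. exact: (kAut_fix (tau_aut D) (varpi'K D)). Qed.
Lemma nu_neq0 : nu != 0.
Proof. by rewrite mulf_neq0 ?invr_eq0 ?expfz_neq0 ?u_n0 ?pi_neq0. Qed.
Lemma tau_nu : ta nu = - nu.
Proof. by rewrite /Defs.nu fmorph_div fmorphXz /= tau_u tau_pi mulNr. Qed.
Lemma v_nu : v nu = 0.
Proof.
rewrite (Defs.valM vP) ?invr_eq0 ?expfz_neq0 ?u_n0 ?pi_neq0// (val_inv vP) ?expfz_neq0 ?pi_neq0//.
by rewrite (val_exprz vP) ?pi_neq0// v_pi mul1r subrr.
Qed.

Let KfixP x : reflect (ta x = x) (x \in K).
Proof. exact: (quadratic_fixP (quadratic D) (tau_aut D) two_L nu_neq0 tau_nu). Qed.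
Lemma taK x : ta (ta x) = x.
Proof. exact: (quadratic_tauK (quadratic D) (tau_aut D) two_L nu_neq0 tau_nu). Qed.

Lemma Lval_tau_valuation : normalized_valuation (fun x => v (ta x)).
Proof.
split=> [x y x0 y0|x y x0 y0 xy0|].
- by rewrite rmorphM (Defs.valM vP) ?fmorph_eq0.
- by rewrite rmorphD /=; apply: (Defs.valD vP); rewrite -?rmorphD ?fmorph_eq0.
by exists pi; rewrite ?pi_neq0// tau_pi v_pi.
Qed.

(** Invariance of the valuation is not part of the setting; it comes from the completeness of [k].
    Both [v] and its conjugate extend the valuation of [k], so they have the same elements of
    positive valuation, hence the same units; a power of [pi], fixed by [tau], reduces the general
    case to units. *)
Lemma Lval_tau x : v (ta x) = v x.
Proof.
have [->|x0] := eqVneq x 0; first by rewrite rmorph0.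
have gt0 y : y != 0 -> 0 < v y -> 0 < v (ta y).
  apply: (val_extension_gt0 kvP (lf_complete (k_local D)) vP Lval_tau_valuation
           (ram_gt0 D) (ram_gt0 D) (@Lval_ext R D)) => a a0.
  by rewrite /tauf linearZ /= (kAut_one (tau_aut D)) Lval_ext.
have unit y : y != 0 -> v y = 0 -> v (ta y) = 0.
  move=> y0 vy; apply/eqP; rewrite eq_le !leNgt; apply/andP; split; apply/negP => lt.
    by have := gt0 (ta y); rewrite taK fmorph_eq0 y0 vy lt => /(_ isT isT).
  have := gt0 (ta y^-1); rewrite taK (val_inv vP)// vy oppr0 ltxx fmorph_eq0 invr_eq0.
  rewrite fmorphV (val_inv vP) ?fmorph_eq0// y0 oppr_gt0 lt => h; by have := h isT isT.
pose q := pi ^ v x; have q0 : q != 0 by rewrite expfz_neq0 ?pi_neq0.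
have vq : v q = v x by rewrite (val_exprz vP) ?pi_neq0// v_pi mul1r.
have tq : ta q = q by rewrite fmorphXz /= tau_pi.
have y0 : x / q != 0 by rewrite mulf_neq0 ?invr_eq0.
have := unit _ y0; rewrite (Defs.valM vP) ?invr_eq0// (val_inv vP)// vq subrr => /(_ erefl).
rewrite fmorph_div /= tq (Defs.valM vP) ?invr_eq0 ?fmorph_eq0// (val_inv vP)// vq; lia.
Qed.

Lemma sub_integersE : sub_integers v K = [set x | ta x = x /\ vge 0 x].
Proof.
by apply/seteqP; split=> x [xK hx]; split=> //; apply/KfixP.
Qed.

Lemma setting_quadratic : unramified_quadratic v ta nu pi (@red' R D).
Proof.
have redP : residue_map [set x | ta x = x /\ vge 0 x] [set x | ta x = x /\ vge 1 x] (@red' R D).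
  have := red'P D; rewrite sub_integersE.
  congr (residue_map _ _ _); apply/seteqP; split=> x [xK hx]; split=> //; exact/KfixP.
split=> //.
- exact: taK.
- exact: Lval_tau.
- by split; [exact: two_L|exact: Lval_two].
- by split; [exact: nu_neq0|exact: tau_nu|exact: v_nu].
- by split; [exact: pi_neq0|exact: tau_pi|exact: v_pi].
(* A square root of the residue would lift to a fixed [c] with [(nu - c) (nu + c)] of positive
   valuation. The two factors are conjugate up to sign, so both have positive valuation, and so has
   their sum [2 nu], a unit. *)
move=> b; apply/eqP => bE; have [c [tc hc] cb] := red_surj redP b.
have tn2 : ta (nu ^+ 2) = nu ^+ 2 by rewrite rmorphXn /= tau_nu sqrrN.
have On2 : [set x | ta x = x /\ vge 0 x] (nu ^+ 2).
  by split=> //; right; rewrite (val_expr vP) ?nu_neq0// v_nu mul0r.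
have Oc2 : [set x | ta x = x /\ vge 0 x] (- c ^+ 2).
  split; first by rewrite rmorphN rmorphXn /= tc.
  by apply: (val_geN vP); rewrite expr2 -[0]addr0; apply: (val_geM vP).
have h1 : vge 1 ((nu - c) * (nu + c)).
  have -> : (nu - c) * (nu + c) = nu ^+ 2 + - c ^+ 2 by ring.
  have : red' (nu ^+ 2 + - c ^+ 2) = 0.
    rewrite (Defs.redD redP)// -bE -cb.
    have Oc : [set x | ta x = x /\ vge 0 x] c by [].
    have ON1 : [set x | ta x = x /\ vge 0 x] (-1).
      by split; [rewrite rmorphN1|right; rewrite (val_opp vP) (val_one vP)].
    have O1 : [set x | ta x = x /\ vge 0 x] 1.
      by split; [rewrite rmorph1|right; rewrite (val_one vP)].
    have Oc2' : [set x | ta x = x /\ vge 0 x] (c ^+ 2).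
      by split; [rewrite rmorphXn /= tc|rewrite expr2 -[0]addr0; exact: (val_geM vP)].
    rewrite -(mulN1r (c ^+ 2)) (Defs.redM redP)// expr2 (Defs.redM redP)// -expr2.
    have : red' (1 + -1) = 0 :> kappa' D.
      by rewrite subrr; apply/(red_ker redP); split; rewrite ?rmorph0//; left.
    rewrite (Defs.redD redP)// (Defs.red1 redP) => /eqP; rewrite addrC addr_eq0 => /eqP ->.
    by rewrite mulN1r subrr.
  move/(red_ker redP) => []//; split; last exact: (val_geD vP On2.2 Oc2.2).
  by rewrite rmorphD /= tn2 Oc2.1.
have n0 : nu - c != 0.
  apply/eqP => /eqP; rewrite subr_eq0 => /eqP nc.
  have := tau_nu; rewrite nc tc => /eqP; rewrite eq_sym -subr_eq0 -opprD oppr_eq0 -mulr2n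
    -mulr_natl.
  by rewrite mulf_eq0 (negbTE two_L) -nc (negbTE nu_neq0).
have tE : ta (nu - c) = - (nu + c) by rewrite rmorphB /= tau_nu tc; ring.
have vE : v (nu + c) = v (nu - c) by rewrite -(val_opp vP) -tE Lval_tau.
have n0' : nu + c != 0 by rewrite -oppr_eq0 -tE fmorph_eq0.
have h2 : 1 <= v (nu - c).
  by move: h1 => /(val_geE _ _ (mulf_neq0 n0 n0')); rewrite (Defs.valM vP)// vE; lia.
have : vge 1 (2%:R * nu).
  have -> : 2%:R * nu = (nu - c) + (nu + c) by ring.
  by apply: (val_geD vP); right; rewrite ?vE.
case=> [/eqP|]; first by rewrite mulf_eq0 (negbTE two_L) (negbTE nu_neq0).
by rewrite (Defs.valM vP) ?two_L ?nu_neq0// Lval_two v_nu.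
Qed.

Local Notation UQ := setting_quadratic.

(** The setting describes the different, but traces are controlled by its inverse. If all elements
    of the codifferent had valuation above [- dexp], then [pi^(dexp - 1)] would lie in the
    different; so one has valuation exactly [- dexp], and its integral multiples are everything
    allowed. *)
Lemma codifferentE x : codifferent kv v K x <-> x \in K /\ vge (- (dexp D)%:Z) x.
Proof.
have diffE := dexpP D; set C := codifferent kv v K.
have pid0 : pi ^+ dexp D != 0 by rewrite expf_neq0 ?pi_neq0.
have vpid : v (pi ^+ dexp D) = (dexp D)%:Z by rewrite (val_expr vP) ?pi_neq0// v_pi mul1r.
have le y : C y -> vge (- (dexp D)%:Z) y.
  move=> Cy; have : different kv v K (pi ^+ dexp D).
    rewrite diffE; exists 1; rewrite ?mulr1//; split; first exact: mem1v.
    by right; rewrite (val_one vP).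
  case=> _ /(_ _ Cy)[_] h0; apply/(val_geMl vP _ _ pid0); rewrite vpid subrr//.
split=> [Cx|[xK hx]]; first by split; [case: Cx|exact: le].
have [y [Cy y0 vy]] : exists y, [/\ C y, y != 0 & v y = - (dexp D)%:Z].
  apply: contrapT => ny.
  have lt y : C y -> vge (1 - (dexp D)%:Z) y.
    move=> Cy; have [->|y0] := eqVneq y 0; first by left.
    have [/eqP|h0] := le _ Cy; first by rewrite (negbTE y0).
    right; rewrite addrC -ltzD1 ltrD2r lt_neqAle h0 andbT; apply/eqP => vy; apply: ny.
    by exists y; split.
  have : different kv v K (pi ^ ((dexp D)%:Z - 1)).
    split; first by apply/KfixP; rewrite fmorphXz /= tau_pi.
    move=> y Cy; split.
      by apply/KfixP; rewrite rmorphM fmorphXz /= tau_pi; congr (_ * _); apply/KfixP; case: Cy.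
    rewrite /integers; have -> : 0 = v (pi ^ ((dexp D)%:Z - 1)) + (1 - (dexp D)%:Z).
      by rewrite (val_exprz vP) ?pi_neq0// v_pi; lia.
    by apply: (val_geM vP) (lt _ Cy); exact: val_ge_refl.
  rewrite diffE => -[z [_ Oz] zE].
  have : vge (dexp D)%:Z (pi ^ ((dexp D)%:Z - 1)).
    by rewrite -zE -[X in vge X]addr0 -{1}vpid; apply/(val_geMl vP).
  case=> [/eqP|]; first by rewrite (negbTE (expfz_neq0 _ pi_neq0)).
  by rewrite (val_exprz vP) ?pi_neq0// v_pi; lia.
have yK : y \in K by case: Cy.
have xyO : sub_integers v K (x / y).
  split; first exact: rpred_div.
  apply/(val_geMl vP _ _ y0); rewrite vy addr0 mulrCA divff// mulr1 //.
split=> // z [zK Oz]; case: Cy => _ /(_ (x / y * z)).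
have -> : y * (x / y * z) = x * z by rewrite mulrA [y * _]mulrC divfK.
apply; case: xyO => xyK hxy; split; first exact: rpredM.
by rewrite /integers -[0]addr0; apply: (val_geM vP).
Qed.

Let tr := @field_trace k L.
Let trK (x : L) := field_trace (vsproj K x).

Let tr_sub x : x \in K -> tr x = 2%:R * trK x.
Proof. exact: (field_trace_sub (quadratic D) (tau_aut D) two_L nu_neq0 tau_nu). Qed.
Let tr_tau x : tr (ta x) = tr x.
Proof. exact: (field_trace_tau (quadratic D) (tau_aut D) two_L nu_neq0 tau_nu). Qed.
Let tr_anti x : ta x = - x -> tr x = 0.
Proof. exact: (field_trace_anti (quadratic D) (tau_aut D) two_L nu_neq0 tau_nu). Qed.

Let varpi_val n : kv (varpi D ^ n) = n.
Proof. by rewrite (val_exprz kvP) ?varpi_neq0// kv_varpi mul1r. Qed.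
Let Lval_scale (a : k) (x : L) : a != 0 -> x != 0 -> v (a *: x) = (ram D)%:Z * kv a + v x.
Proof. by move=> a0 x0; rewrite -mulr_algl (Defs.valM vP) ?Lval_ext// scaler_eq0 negb_or a0
  oner_eq0. Qed.

(** The part of [y] along [nu] has trace zero; the rest, divided by [varpi^lam_psi], lies in the
    codifferent. *)
Lemma trace_val y : vge ((ram D)%:Z * lam_psi D - (dexp D)%:Z) y ->
  val_ge kv (lam_psi D) (field_trace y).
Proof.
move=> hy; have /(val_ge_coord UQ)[h0 _] := hy.
have trE : tr y = tr (qcoord0 ta y).
  rewrite {1}(coordE UQ y) /tr field_traceD [X in _ + X]tr_anti ?addr0//.
  by rewrite rmorphM /= (tau_qcoord1 UQ) tau_nu mulrN.
have cK : qcoord0 ta y \in K by apply/KfixP; exact: (tau_qcoord0 UQ).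
rewrite -/(tr y) trE.
have [->|c00] := eqVneq (qcoord0 ta y) 0.
  by left; rewrite /tr -[0](scale0r 0) field_traceZ mul0r.
have w0 : varpi D ^ lam_psi D != 0 by rewrite expfz_neq0 ?varpi_neq0.
pose z := (varpi D ^ lam_psi D)^-1 *: qcoord0 ta y.
have zK : z \in K by exact: rpredZ.
have cE : qcoord0 ta y = varpi D ^ lam_psi D *: z by rewrite scalerA divff// scale1r.
have hz : codifferent kv v K z.
  apply/codifferentE; split=> //; right; rewrite Lval_scale ?invr_eq0//.
  rewrite (val_inv kvP)// varpi_val; have [/eqP|] := h0; first by rewrite (negbTE c00).
  by lia.
have O1 : sub_integers v K 1 by split; [exact: mem1v|right; rewrite (val_one vP)].
have := hz.2 _ O1; rewrite mulr1 -/(trK z) => hzt.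
rewrite cE /tr field_traceZ -/(tr z) (tr_sub zK).
have -> : lam_psi D = lam_psi D + (0 + 0) by rewrite !addr0.
apply: (val_geM kvP); first by right; rewrite varpi_val !addr0.
by apply: (val_geM kvP) => //; exact: kval_nat.
Qed.

Lemma psi_val x : val_ge kv (lam_psi D) x -> psi x = 1.
Proof.
move=> hx; have w0 : varpi D ^ lam_psi D != 0 by rewrite expfz_neq0 ?varpi_neq0.
have -> : x = varpi D ^ lam_psi D * ((varpi D ^ lam_psi D)^-1 * x) by rewrite mulVKf.
apply: psi_trivial; apply/(val_geMl kvP _ _ w0); rewrite varpi_val addr0 mulVKf//.
Qed.

Lemma psi_neq0 (x : k) : psi x != 0 :> R[i].
Proof. by rewrite -normr_eq0 psi_unitary oner_eq0. Qed.
Lemma psi0 : psi (0 : k) = 1 :> R[i].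
Proof. by apply: (mulfI (psi_neq0 0)); rewrite -psiD addr0 mulr1. Qed.
Lemma psiN (x : k) : psi (- x) = (psi x)^-1 :> R[i].
Proof. by apply: (mulfI (psi_neq0 x)); rewrite -psiD subrr psi0 divff// psi_neq0. Qed.

Definition XiD_ (x : L) : R[i] := psi (4%:R^-1 * field_trace (u * x)).
Definition hD : int := ((mu D - 1) %/ 2)%Z.
Hypothesis mu_odd : ~~ (2 %| mu D)%Z.

Lemma muE : mu D = 2 * hD + 1.
Proof. by rewrite /hD; move: mu_odd; lia. Qed.

Lemma four_k : (4%:R : k) != 0.
Proof. by rewrite (natrM _ 2 2) mulf_neq0 ?two_k. Qed.
Lemma kval_four : kv 4%:R = 0.
Proof. by rewrite (natrM _ 2 2) (Defs.valM kvP) ?two_k// !kval_two. Qed.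
Lemma val_ge_quarter n x : val_ge kv n (4%:R^-1 * x) <-> val_ge kv n x.
Proof.
rewrite -(val_geMl kvP n x (invr_neq0 four_k)) (val_inv kvP) ?four_k// kval_four oppr0 add0r//.
Qed.

Lemma XiD_trivial x : vge (2 * hD + 1) x -> XiD_ x = 1.
Proof.
move=> hx; apply: psi_val; apply/val_ge_quarter; apply: trace_val.
have := (val_geMl vP (2 * hD + 1) x u_n0).2 hx; rewrite -muE /mu; apply: val_geW; lia.
Qed.

(** Otherwise [pi^(- dexp - 1)] would lie in the codifferent: a non-integral trace [t] of one of its
    multiples could be rescaled by an element of [k] to hit a point where [psi] is non-trivial. *)
Lemma XiD_nontrivial : exists2 z, fixed_integer v ta z & XiD_ (pi ^ hD * pi ^ hD * (z * nu)) != 1.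
Proof.
apply: contrapT => nz.
have triv z : fixed_integer v ta z -> XiD_ (pi ^ hD * pi ^ hD * (z * nu)) = 1.
  by move=> Oz; apply/eqP/negP => /negP hz; apply: nz; exists z.
pose y0 := pi ^ (- (dexp D)%:Z - 1).
have y0n : y0 != 0 by rewrite expfz_neq0 ?pi_neq0.
have vy0 : v y0 = - (dexp D)%:Z - 1 by rewrite (val_exprz vP) ?pi_neq0// v_pi mul1r.
have y0K : y0 \in K by apply/KfixP; rewrite fmorphXz /= tau_pi.
suff /codifferentE[_] : codifferent kv v K y0.
  by case=> [/eqP|]; [rewrite (negbTE y0n)|rewrite vy0; lia].
split=> // y [yK Oy]; have yyK : y0 * y \in K by exact: rpredM.
have [t0|t0] := eqVneq (trK (y0 * y)) 0; first by rewrite -/(trK _) t0; left.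
rewrite -/(trK _); set t := trK (y0 * y) in t0 *.
right; rewrite leNgt; apply/negP => lt.
have [x Ox] := psi_nontrivial D; apply.
have w0 n : varpi D ^ n != 0 by rewrite expfz_neq0 ?varpi_neq0.
pose s := varpi D ^ (-1) * x / t.
have hs : val_ge kv 0 s.
  have : val_ge kv (-1 + 0 - kv t) s.
    apply: (val_geM kvP); last by right; rewrite (val_inv kvP).
    by apply: (val_geM kvP) => //; right; rewrite varpi_val.
  by apply: val_geW; lia.
have -> : varpi D ^ (lam_psi D - 1) * x = (varpi D ^ lam_psi D * s) * t.
  rewrite /s expfzDr ?varpi_neq0//; move: (varpi D ^ (- 1)) (varpi D ^ lam_psi D) => a b; by field.
set c := varpi D ^ lam_psi D * s.
have un0 := u_n0; have nn0 := nu_neq0.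
(* Solves [tr (u w) / 4 = c t]; the factor [2] and the degree two of [L] over [K] together cancel
   the 1/4. *)
pose w := (2%:R * c%:A * y0 * y) / u.
have wE : 4%:R^-1 * field_trace (u * w) = c * t.
  have -> : u * w = (2%:R * c) *: (y0 * y).
    have -> : (2%:R * c) *: (y0 * y) = 2%:R * c%:A * (y0 * y).
      by rewrite -scalerA scaler_nat -mulrA mulr_algl mulr_natl.
    by rewrite /w mulrC divfK// -mulrA.
  rewrite field_traceZ -/(tr _) (tr_sub yyK) -/t.
  by field; exact: four_k.
have Pn0 : pi ^ hD != 0 by rewrite expfz_neq0 ?pi_neq0.
have PP0 : pi ^ hD * pi ^ hD != 0 by rewrite mulf_neq0.
have nPP0 : nu * (pi ^ hD * pi ^ hD) != 0 by rewrite mulf_neq0.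
pose z := w / (nu * (pi ^ hD * pi ^ hD)).
have wz : w = pi ^ hD * pi ^ hD * (z * nu).
  by rewrite /z [RHS]mulrC -[RHS]mulrA divfK.
rewrite -wE -/(XiD_ w) wz; apply: triv; split.
  have tc : ta c%:A = c%:A by rewrite /tauf linearZ /= (kAut_one (tau_aut D)).
  have ty : ta y = y by apply/KfixP.
  have ty0 : ta y0 = y0 by apply/KfixP.
  have tw : ta w = - w.
    by rewrite /w fmorph_div !rmorphM rmorph_nat /= tc ty ty0 tau_u invrN mulrN.
  have tPP : ta (pi ^ hD * pi ^ hD) = pi ^ hD * pi ^ hD.
    by rewrite rmorphM fmorphXz /= tau_pi.
  have tn : ta (nu * (pi ^ hD * pi ^ hD)) = - (nu * (pi ^ hD * pi ^ hD)).
    by rewrite rmorphM /= tau_nu tPP mulNr.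
  by rewrite /z fmorph_div /= tw tn invrN mulrNN.
have hc : vge ((ram D)%:Z * lam_psi D) c%:A.
  have hc' : val_ge kv (lam_psi D) c.
    by rewrite -[lam_psi D]addr0; apply: (val_geM kvP) => //; right; rewrite varpi_val.
  have [->|cn0] := eqVneq c 0; first by left; rewrite scale0r.
  right; rewrite Lval_ext//; case: hc' => [/eqP|]; first by rewrite (negbTE cn0).
  by move=> hc'; apply: ler_wpM2l.
have : vge (0 + (ram D)%:Z * lam_psi D + v y0 + 0 - v u - (v nu + (v (pi ^ hD) + v (pi ^ hD)))) z.
  rewrite /z; apply: (val_geM vP); last first.
    right; rewrite (val_inv vP nPP0) lerN2 (Defs.valM vP nn0 PP0) (Defs.valM vP Pn0 Pn0) lexx //.
  rewrite /w; apply: (val_geM vP); last by right; rewrite (val_inv vP).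
  apply: (val_geM vP) => //; apply: (val_geM vP); last exact: val_ge_refl.
  by apply: (val_geM vP) => //; right; rewrite Lval_two.
have vPh : v (pi ^ hD) = hD by rewrite (val_exprz vP) ?pi_neq0// v_pi mul1r.
apply: val_geW; rewrite vPh v_nu vy0.
by move: muE; rewrite /mu; clear; lia.
Qed.

Lemma setting_character : weil_character v ta nu pi XiD_ hD.
Proof.
split.
- by move=> x y; rewrite /XiD_ mulrDr field_traceD mulrDr psiD.
- by move=> x; exact: psi_neq0.
- move=> x; rewrite /XiD_ -psiN; congr psi; rewrite -mulrN -field_traceN; congr (_ * _).
  rewrite -[LHS]tr_tau /tr; congr field_trace.
  by rewrite rmorphM /= tau_u taK mulNr.
- exact: XiD_trivial.
exact: XiD_nontrivial.
Qed.

Lemma scaled_val (c : L) n : c != 0 -> scaled c (val_ge v n) = vge (v c + n).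
Proof.
move=> c0; apply/seteqP; split=> [_ [x hx <-]|x hx]; first exact/(val_geMl vP).
by exists (c^-1 * x); [apply/(val_geMl vP _ _ c0); rewrite mulVKf|rewrite mulVKf].
Qed.

Lemma latB_val : latB D = vge (hD + 1).
Proof.
rewrite /latB scaled_val ?expfz_neq0 ?pi_neq0// (val_exprz vP) ?pi_neq0// v_pi; congr vge.
by have := muE; lia.
Qed.

Lemma scaled_kval n x : scaled (varpi D ^ n) (integers kv) x <-> val_ge kv n x.
Proof.
have w0 : varpi D ^ n != 0 by rewrite expfz_neq0 ?varpi_neq0.
split=> [[y Oy <-]|hx].
  by rewrite -[n in val_ge kv n]addr0; apply: (val_geM kvP) => //; right; rewrite varpi_val.
exists ((varpi D ^ n)^-1 * x); last by rewrite mulVKf.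
by apply/(val_geMl kvP _ _ w0); rewrite varpi_val addr0 mulVKf.
Qed.

Lemma beta_XiD x y : psi (2%:R^-1 * beta x y) = pairing ta XiD_ x y.
Proof.
rewrite /beta /pairing /XiD_ mulrA; congr psi; congr (_ * _).
  by rewrite (natrM _ 2 2) invfM.
by rewrite mulrA.
Qed.

(** If [v x < h], the vector [b = pi^(2 h) z nu / tau x] lies in [B], and pairing it with [x] gives
    the non-trivial value of [XiD_nontrivial]. *)
Lemma latBs_val : latBs D = vge hD.
Proof.
apply/seteqP; split=> x.
  move=> hx; have [->|x0] := eqVneq x 0; first by left.
  right; rewrite leNgt; apply/negP => lt.
  have [z [tz Oz] /eqP hz] := XiD_nontrivial; apply: hz.
  have tx0 : ta x != 0 by rewrite fmorph_eq0.
  pose b := pi ^ hD * pi ^ hD * (z * nu) / ta x.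
  have -> : pi ^ hD * pi ^ hD * (z * nu) = ta x * b by rewrite /b [RHS]mulrC divfK.
  rewrite -/(pairing ta XiD_ x b) -beta_XiD; apply: psi_val.
  have Pn0 : pi ^ hD != 0 by rewrite expfz_neq0 ?pi_neq0.
  have : latB D b.
    rewrite latB_val; have : vge (v (pi ^ hD) + v (pi ^ hD) + (0 + v nu) - v (ta x)) b.
      apply: (val_geM vP); last by right; rewrite (val_inv vP).
      by apply: (val_geM vP); [exact: (val_geM vP (val_ge_refl _ _) (val_ge_refl _ _))|apply:
        (val_geM vP) => //; exact: val_ge_refl].
    by apply: val_geW; rewrite v_nu Lval_tau (val_exprz vP) ?pi_neq0// v_pi; lia.
  move/hx => /scaled_kval hb; rewrite -[lam_psi D]add0r; apply: (val_geM kvP) => //.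
  by right; rewrite (val_inv kvP) ?two_k// kval_two.
move=> hx b; rewrite latB_val => hb; apply/scaled_kval.
rewrite -[lam_psi D]add0r; apply: (val_geM kvP).
  by right; rewrite (val_inv kvP) ?two_k// kval_two.
apply: trace_val; have htx : vge hD (ta x) by apply/(val_ge_tau UQ).
have := val_geM vP (val_geM vP (val_ge_refl v u) htx) hb.
by apply: val_geW; have := muE; rewrite /mu; lia.
Qed.

Lemma latA_val : latA D = latticeA v ta nu hD.
Proof.
have Pn0 : pi ^ hD != 0 by rewrite expfz_neq0 ?pi_neq0.
have vPp : v (pi ^ hD) = hD by rewrite (val_exprz vP) ?pi_neq0// v_pi mul1r.
have tP : ta (pi ^ hD) = pi ^ hD by rewrite fmorphXz /= tau_pi.
have tpi := tau_pi.
rewrite /latA -/hD sub_integersE; apply/seteqP; split.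
  move=> _ [_ [x [tx hx] [y [ty hy] <-]] <-].
  have t1 : ta (pi ^ hD * x) = pi ^ hD * x by rewrite rmorphM /= tP tx.
  have t2 : ta (pi ^ hD * (y * pi)) = pi ^ hD * (y * pi) by rewrite !rmorphM /= tP ty tpi.
  have [e0 e1] := coord_eq UQ t1 t2.
  have -> : pi ^ hD * (x + y * pi * nu) = pi ^ hD * x + pi ^ hD * (y * pi) * nu.
    by move: (pi ^ hD) => p; ring.
  split; rewrite ?e0 ?e1.
    by have := val_geM vP (val_ge_refl v (pi ^ hD)) hx; rewrite vPp addr0.
  have hypi : vge (0 + 1) (y * pi) by apply: (val_geM vP) => //; right; rewrite v_pi.
  by have := val_geM vP (val_ge_refl v (pi ^ hD)) hypi; rewrite vPp add0r.
move=> x [h0 h1]; have pn0 := pi_neq0.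
exists (qcoord0 ta x / pi ^ hD + qcoord1 ta nu x / (pi ^ hD * pi) * pi * nu); last first.
  by rewrite {3}(coordE UQ x) scaled_coordE.
exists (qcoord0 ta x / pi ^ hD).
  split; first by rewrite fmorph_div /= (tau_qcoord0 UQ) tP.
  by apply/(val_geMl vP _ _ Pn0); rewrite vPp addr0 mulrCA divff// mulr1.
exists (qcoord1 ta nu x / (pi ^ hD * pi)) => //; split.
  have tPp : ta (pi ^ hD * pi) = pi ^ hD * pi by rewrite rmorphM /= tP tpi.
  by rewrite fmorph_div /= (tau_qcoord1 UQ) tPp.
have PP0 : pi ^ hD * pi != 0 by rewrite mulf_neq0.
by apply/(val_geMl vP _ _ PP0); rewrite (Defs.valM vP)// vPp v_pi addr0 mulrCA divff// mulr1.
Qed.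

Lemma torus_filtrationE j : torus_filtration D j = ulevel v ta j.
Proof.
rewrite /torus_filtration /ulevel scaled_val ?expf_neq0 ?pi_neq0// (val_expr vP) ?pi_neq0// v_pi
  mul1r addr0.
by [].
Qed.

(** * Reduction modulo [B] and evaluation of [m(g)] *)

Variable M : reduction_data D.
Local Notation h := hD.
Local Notation WC := setting_character.
Local Notation F := (kappa D).
Local Notation E := (kappa' D).
Local Notation rB := (redB M).
Local Notation lam := (lam_psi D).
Local Notation form := (red_form rB).
Local Notation e := (pairing ta XiD_).
Local Notation T := (unitary ta).
Local Notation R0 := (res0 ta (@red' R D)).
Local Notation R1 := (res1 ta nu (@red' R D)).
Local Notation r0 := (sres0 ta pi (@red' R D) h).
Local Notation at_ := (lift_fix UQ h).
Local Notation bt_ := (lift_anti UQ h).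
Local Notation lA := (latticeA v ta nu h).
Local Notation Psi := (res_char UQ XiD_ h).
Local Notation G := (gauss Psi).
Local Notation eta := (@quadratic_char R E).
Local Notation etaF := (@quadratic_char R F).
Local Notation Mod := (quasi_inv v ta nu XiD_ h).
Local Notation weilSD := (weilS UQ XiD_ h).
Local Notation Tf := (ulevel v ta).
Local Notation conduct := (has_conductor v ta).
Local Notation weight := (torus_weight UQ XiD_ h).
Local Notation delta := (delta_at v ta nu XiD_ h).
Local Notation phiS := (avg_delta UQ XiD_ h).
Local Notation supported := (supported_in v).

Let RM := lf_residue (k_local D).
Let BsE := latBs_val.
Let BE := latB_val.

Lemma rBD x y : vge h x -> vge h y -> rB (x + y) = rB x + rB y.
Proof. by move=> hx hy; apply: (piD (redBP M)); rewrite BsE. Qed.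
Lemma rBZ c x : val_ge kv 0 c -> vge h x -> rB (c *: x) = red c *: rB x.
Proof. by move=> hc hx; apply: (piZ (redBP M)); rewrite ?BsE. Qed.
Lemma rB_eq0 x : vge h x -> rB x = 0 <-> vge (h + 1) x.
Proof. by move=> hx; rewrite -BE; apply: (pi_ker (redBP M)); rewrite BsE. Qed.
Lemma rBN x : vge h x -> rB (- x) = - rB x.
Proof.
move=> hx; apply/eqP; rewrite -addr_eq0 -rBD//; last exact: (val_geN vP).
by rewrite addNr; apply/eqP; apply/rB_eq0; left.
Qed.
Lemma rB_eq x y : vge h x -> vge h y -> rB x = rB y <-> vge (h + 1) (x - y).
Proof.
move=> hx hy; have hN := val_geN vP hy.
rewrite -rB_eq0; last exact: (val_geD vP).
by rewrite rBD// rBN//; split=> [->|/eqP]; rewrite ?subrr// subr_eq0 => /eqP.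
Qed.
Lemma rB_surj y : exists2 x, vge h x & rB x = y.
Proof. by have [x hx xy] := pi_surj (redBP M) y; exists x => //; rewrite -BsE. Qed.
Lemma pi_liftP y : vge h (pi_lift rB y) /\ rB (pi_lift rB y) = y.
Proof.
have [x hx xy] := rB_surj y.
have ex : exists x, [set x | latBs D x /\ rB x = y] x by exists x; split; rewrite ?BsE.
by have := @xgetPex _ 0 _ ex; rewrite -BsE.
Qed.

Lemma betaDl (x y z : L) : beta (x + y) z = beta x z + beta y z.
Proof. by rewrite /beta linearD mulrDr mulrDl field_traceD mulrDr. Qed.
Lemma betaDr (x y z : L) : beta z (x + y) = beta z x + beta z y.
Proof. by rewrite /beta mulrDr field_traceD mulrDr. Qed.
Lemma betaZr c (x z : L) : beta z (c *: x) = c * beta z x.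
Proof. by rewrite /beta -scalerAr field_traceZ mulrCA. Qed.
Lemma beta_anti (x y : L) : beta x y = - beta y x.
Proof.
rewrite /beta -mulrN -field_traceN; congr (_ * _).
rewrite -(field_trace_tau (quadratic D) (tau_aut D) two_L nu_neq0 tau_nu).
congr field_trace; have tM := kAut_mul (tau_aut D).
have tu : tau D u = - u := tau_u; have tK := taK; rewrite /tauf in tK.
by rewrite !tM tu tK !mulNr mulrAC.
Qed.
Lemma betaZl c (x z : L) : beta (c *: x) z = c * beta x z.
Proof. by rewrite beta_anti betaZr -mulrN -beta_anti. Qed.
Lemma betaN (x z : L) : beta (- x) z = - beta x z.
Proof. by rewrite -scaleN1r betaZl mulN1r. Qed.
Lemma beta_T g (x y : L) : T g -> beta (g * x) (g * y) = beta x y.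
Proof.
move=> Tg; rewrite /beta; congr (_ * field_trace _).
have tM := kAut_mul (tau_aut D).
have Tg' : g * tau D g = 1 := Tg.
transitivity ((g * tau D g) * (u * tau D x * y)); last by rewrite Tg' mul1r.
by rewrite tM; move: (tau D g) (tau D x) => a c; ring.
Qed.

Lemma beta_Bs x y : vge h x -> vge h y -> val_ge kv (lam - 1) (beta x y).
Proof.
move=> hx hy; rewrite -[lam - 1]add0r; apply: (val_geM kvP).
  by right; rewrite (val_inv kvP) ?two_k// kval_two.
have w0 := varpi_neq0; apply/(val_geMl kvP _ _ w0); rewrite kv_varpi.
have -> : 1 + (lam - 1) = lam by lia.
rewrite -field_traceZ; apply: trace_val.
have htx : vge h (ta x) by apply/(val_ge_tau UQ).
have hz := val_geM vP (val_geM vP (val_ge_refl v u) htx) hy.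
have hw : val_ge kv 1 (varpi D) by right; rewrite kv_varpi.
have := val_geZ vP (ram_gt0 D) (@Lval_ext R D) hw hz.
apply: val_geW; have := muE; rewrite /mu; have := ram_gt0 D; lia.
Qed.

Lemma beta_B x y : vge h x -> vge (h + 1) y -> val_ge kv lam (beta x y).
Proof.
move=> hx hy; have : latBs D x by rewrite BsE.
by move=> /(_ y); rewrite BE => /(_ hy) /scaled_kval.
Qed.

Definition bn x y : k := varpi D ^ (1 - lam) * beta x y.

Let w_val n : val_ge kv n (varpi D ^ n).
Proof. by right; rewrite (val_exprz kvP) ?varpi_neq0// kv_varpi mul1r. Qed.

Lemma bn_int x y : vge h x -> vge h y -> integers kv (bn x y).
Proof.
move=> hx hy; have := val_geM kvP (w_val (1 - lam)) (beta_Bs hx hy).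
by apply: val_geW; lia.
Qed.

Lemma redk_eq x y : integers kv x -> integers kv y -> val_ge kv 1 (x - y) -> red x = red y :> F.
Proof.
move=> hx hy h1; have hxy : integers kv (x - y) by exact: (val_geB kvP).
have := (red_ker RM hxy).2 h1 => r0.
by rewrite -(subrK y x) (Defs.redD RM)// r0 add0r.
Qed.

(** [red_form] is computed on chosen lifts; changing one by an element of [B] moves [beta] by
    valuation [lam], hence the normalised form by an element of the maximal ideal. *)
Lemma formE x y : vge h x -> vge h y -> form (rB x) (rB y) = red (bn x y).
Proof.
move=> hx hy; rewrite /red_form.
have [hx' ex] := pi_liftP (rB x); have [hy' ey] := pi_liftP (rB y).
set x' := pi_lift rB (rB x) in hx' ex *; set y' := pi_lift rB (rB y) in hy' ey *.
apply: redk_eq; [exact: bn_int|exact: bn_int|].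
rewrite /bn -mulrBr.
suff hb : val_ge kv lam (beta x' y' - beta x y).
  by have := val_geM kvP (w_val (1 - lam)) hb; rewrite subrK.
have hdx : vge (h + 1) (x' - x) by apply/rB_eq.
have hdy : vge (h + 1) (y' - y) by apply/rB_eq.
have -> : beta x' y' - beta x y = - beta y' (x' - x) + beta x (y' - y).
  rewrite -(beta_anti (x' - x) y') betaDl betaN betaDr (_ : beta x (- y) = - beta x y); last first.
    by rewrite -scaleN1r betaZr mulN1r.
  ring.
by apply: (val_geD kvP); [apply: (val_geN kvP)|]; apply: beta_B.
Qed.

Lemma psibar_red z : integers kv z -> psibar (red z) = psi (varpi D ^ (lam - 1) * z).
Proof.
move=> hz; rewrite /psibar; set x := xget 0 _.
have [hx xz] : integers kv x /\ red x = red z :> F.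
  exact: (@xgetPex _ 0 [set x | integers kv x /\ red x =
    red z :> F] (ex_intro _ z (conj hz erefl))).
have h1 : val_ge kv 1 (x - z).
  apply/(red_ker RM); first exact: (val_geB kvP).
  have hzN : integers kv (- z) by exact: (val_geN kvP).
  rewrite (Defs.redD RM)// xz -(Defs.redD RM)// subrr.
  by apply/(red_ker RM); left.
rewrite -(subrK z x) mulrDr psiD psi_val ?mul1r//.
by have := val_geM kvP (w_val (lam - 1)) h1; rewrite subrK.
Qed.

(** The half turns [omega a] into a plain Gauss sum, up to [sqrtq], and matches [psib] of the
    reduced form with the pairing. *)
Definition psib (a : F) : R[i] := psibar (2%:R^-1 * a).

Let half_int : integers kv 2%:R^-1.
Proof. by right; rewrite (val_inv kvP) ?two_k// kval_two. Qed.
Let red_half : red (2%:R^-1 : k) = 2%:R^-1 :> F.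
Proof.
have O1 : integers kv 1 by right; rewrite (val_one kvP).
have r2 : red (2%:R : k) = 2%:R :> F.
  by have -> : (2%:R : k) = 1 + 1 by []; rewrite (Defs.redD RM)// (Defs.red1 RM).
apply: (mulfI two_kappa); rewrite divff ?two_kappa// -r2 -(Defs.redM RM)//; last exact: kval_nat.
by rewrite divff ?two_k// (Defs.red1 RM).
Qed.

Lemma psib_red z : integers kv z -> psib (red z) = psi (varpi D ^ (lam - 1) * (2%:R^-1 * z)).
Proof.
move=> hz; rewrite /psib -red_half -(Defs.redM RM)// psibar_red//.
by rewrite /integers -[0]addr0; apply: (val_geM kvP).
Qed.

Lemma psibD a c : psib (a + c) = psib a * psib c.
Proof.
have [x hx <-] := red_surj RM a; have [y hy <-] := red_surj RM c.
rewrite -(Defs.redD RM)// !psib_red//; last exact: (val_geD kvP).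
by rewrite -psiD -!mulrDr.
Qed.
Lemma psib_neq0 a : psib a != 0. Proof. by rewrite -normr_eq0 psi_unitary oner_eq0. Qed.
Lemma psib_nontrivial : exists a, psib a != 1.
Proof.
have [x hx /eqP nx] := psi_nontrivial D; exists (red (2%:R * x)).
rewrite psib_red ?mulKf ?two_k//.
by rewrite /integers -[0]addr0; apply: (val_geM kvP) => //; exact: kval_nat.
Qed.

Lemma psib_form x y : vge h x -> vge h y -> psib (form (rB x) (rB y)) = e x y.
Proof.
move=> hx hy; rewrite formE// (psib_red (bn_int hx hy)) -beta_XiD; congr psi; rewrite /bn mulrCA.
congr (_ * _); rewrite mulrA -expfzDr ?varpi_neq0//.
by rewrite (_ : lam - 1 + (1 - lam) = 0) ?expr0z ?mul1r//; lia.
Qed.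

Lemma formL a x y z : form (a *: x + y) z = a * form x z + form y z.
Proof.
have [c hc <-] := red_surj RM a.
have [x' hx <-] := rB_surj x; have [y' hy <-] := rB_surj y; have [z' hz <-] := rB_surj z.
have hcx : vge h (c *: x').
  have := val_geZ vP (ram_gt0 D) (@Lval_ext R D) hc hx; by rewrite mulr0 add0r.
rewrite -rBZ// -rBD// !formE//; last exact: (val_geD vP).
have hcb : integers kv (c * bn x' z').
  by rewrite /integers -[0]addr0; apply: (val_geM kvP) => //; exact: bn_int.
rewrite -(Defs.redM RM hc (bn_int hx hz)) -(Defs.redD RM hcb (bn_int hy hz)).
by congr red; rewrite /bn betaDl betaZl; ring.
Qed.
Lemma form_anti x y : form x y = - form y x.
Proof.
have [x' hx <-] := rB_surj x; have [y' hy <-] := rB_surj y; rewrite !formE//.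
apply/eqP; rewrite -addr_eq0 -(Defs.redD RM (bn_int hx hy) (bn_int hy hx)).
by rewrite /bn beta_anti -mulrDr addNr mulr0; apply/eqP/(red_ker RM); left.
Qed.
Lemma formR a x y z : form z (a *: x + y) = a * form z x + form z y.
Proof. by rewrite form_anti formL opprD -mulrN -!form_anti. Qed.

(** [bar] applies [linfun] to a bare function, which is meaningful only if that function is linear.
    The chosen lifts are linear only modulo [B], but [g] preserves [B]. *)
Lemma bar_lin g : T g -> linear (fun y : bs M => rB (amull g (pi_lift rB y))).
Proof.
move=> Tg a y z; rewrite !lfunE /=.
have [c hc <-] := red_surj RM a.
have [hy ey] := pi_liftP y; have [hz ez] := pi_liftP z.
have [hw ew] := pi_liftP (red c *: y + z).
have hg x : vge h x -> vge h (g * x) by move=> hx; apply/(unitary_val_geMl UQ).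
have hcx x : vge h x -> vge h (c *: x).
  move=> hx; have := val_geZ vP (ram_gt0 D) (@Lval_ext R D) hc hx; by rewrite mulr0 add0r.
have hs : vge h (c *: pi_lift rB y + pi_lift rB z) by apply: (val_geD vP) => //; exact: hcx.
rewrite -rBZ// ?hg//; last exact: hg.
rewrite -rBD; [|by apply: hcx; exact: hg|exact: hg].
have -> : c *: (g * pi_lift rB y) + g * pi_lift rB z = g * (c *: pi_lift rB y + pi_lift rB z).
  by rewrite mulrDr scalerAr.
apply/rB_eq; [exact: hg|exact: hg|].
rewrite -mulrBr; apply/(unitary_val_geMl UQ) => //; apply/rB_eq => //.
by rewrite ew rBD// ?rBZ// ?ey ?ez//; exact: hcx.
Qed.

Lemma barE g x : T g -> vge h x -> bar M (amull g) (rB x) = rB (g * x).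
Proof.
move=> Tg hx; pose f := fun y : bs M => rB (amull g (pi_lift rB y)).
pose fl : {linear bs M -> bs M} := HB.pack f (GRing.isLinear.Build _ _ _ _ f (bar_lin Tg)).
have -> : bar M (amull g) = linfun fl by [].
rewrite lfunE /= /f lfunE /=; have [hl el] := pi_liftP (rB x).
apply/rB_eq; [by apply/(unitary_val_geMl UQ)|by apply/(unitary_val_geMl UQ)|].
by rewrite -mulrBr; apply/(unitary_val_geMl UQ) => //; apply/rB_eq.
Qed.

Lemma bar_symplectic g : T g -> symplectic form (bar M (amull g)).
Proof.
move=> Tg y z; have [x hx <-] := rB_surj y; have [w hw <-] := rB_surj z.
have [hgx hgw] := ((unitary_val_geMl UQ h x Tg).2 hx, (unitary_val_geMl UQ h w Tg).2 hw).
by rewrite !barE// !formE// /bn beta_T.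
Qed.

Lemma xs_at y : y \in xs M <-> exists t, y = rB (at_ t).
Proof.
rewrite (xsP (r := M)) latA_val; split=> [[a Aa <-]|[t ->]]; last first.
  by exists (at_ t) => //; exact: (lift_fix_latticeA UQ).
have hA := latticeA_Bs UQ Aa; exists (r0 a); apply/rB_eq => //; first exact: (lift_fix_Bs UQ).
apply: (Bs_sres_eq UQ) => //; rewrite ?(sres0_lift_fix UQ) ?(sres1_lift_fix UQ)//;
  first exact: (lift_fix_Bs UQ).
exact/(latticeAE UQ).
Qed.

Lemma rB_at_inj : injective (fun t => rB (at_ t)).
Proof.
move=> s t /rB_eq; have [hs ht] := (lift_fix_Bs UQ h s, lift_fix_Bs UQ h t).
move=> /(_ hs ht) hst; have hN := val_geN vP ht.
have := ((sres01_eq0 UQ (val_geD vP hs hN)).2 hst).1.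
rewrite (sres0D UQ)// (sres0N UQ)// !(sres0_lift_fix UQ) => /eqP; by rewrite subr_eq0 => /eqP.
Qed.

Section Basis.
Variables (l : nat) (eps phi : l.-tuple (bs M)).
Hypothesis sb : symplectic_basis form (xs M) eps phi.
Hypothesis theta_tau : forall (S : {set 'I_l}) f, is_tau_S eps phi S f ->
  same_square_class (theta f) 1.

Let bX : basis_of (xs M) eps. Proof. by case: sb. Qed.
Let dimX : \dim (xs M) = l. Proof. exact: size_basis bX. Qed.
Let dimbs : \dim {: bs M} = (l + l)%N.
Proof.
have [bf _ _] := sb; have := size_basis (X := [tuple of eps ++ phi]) bf; done.
Qed.

Let vec (x : 'rV[F]_l) : bs M := \sum_i x 0 i *: tnth eps i.

Let vec_xs x : vec x \in xs M.
Proof. by apply: rpred_sum => i _; apply: rpredZ; apply: (basis_mem bX); exact: mem_tnth. Qed.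

Let vec_inj : injective vec.
Proof.
move=> x y xy; apply/rowP => i; have := congr1 (coord eps i) xy.
have sE (z : 'rV[F]_l) : vec z = \sum_j z 0 j *: eps`_j.
  by apply: eq_bigr => j _; rewrite (tnth_nth 0).
by rewrite !sE !coord_sum_free ?(basis_free bX).
Qed.

Let vec_surj y : y \in xs M -> exists x, y = vec x.
Proof.
move=> yX; exists (\row_i coord eps i y); rewrite {1}(coord_basis bX yX).
by apply: eq_bigr => i _; rewrite mxE (tnth_nth 0).
Qed.

(** [A / B] is seen in two ways: as an [F]-space with basis [eps], and as a line parametrised by
    [E]. A bijection of sets is enough to reindex sums. *)
Lemma row_param : exists2 tE : 'rV[F]_l -> E, bijective tE & forall x, vec x = rB (at_ (tE x)).
Proof.
have /choice[tE tP] : forall x, exists t, vec x = rB (at_ t).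
  by move=> x; apply/xs_at.
exists tE => //.
have /choice[xE xP] : forall t : E, exists x, rB (at_ t) = vec x.
  by move=> t; apply: vec_surj; apply/xs_at; exists t.
exists xE => [x|t].
  by apply: vec_inj; rewrite -xP -tP.
by apply: (rB_at_inj); rewrite -tP -xP.
Qed.

Lemma card_residue : #|E| = (#|F| ^ l)%N.
Proof.
have [tE tb _] := row_param; rewrite -(bij_eq_card tb).
by rewrite card_mx mul1n.
Qed.

Lemma form_sum (x : 'rV[F]_l) y :
  form (vec x) y = \sum_i x 0 i * form (tnth eps i) y.
Proof.
rewrite /vec; have f0 z : form 0 z = 0.
  have := formL 1 0 0 z; rewrite scaler0 addr0 mul1r => /eqP.
  by rewrite -subr_eq0 opprD addNKr oppr_eq0 => /eqP.
by elim/big_rec2: _ => [|i x1 x2 _ IH]; rewrite ?f0// formL IH.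
Qed.

Section Generic.
Variable g : L.
Hypotheses (Tg : T g) (g1 : R1 g != 0).
Local Notation hb := (bar M (amull g)).
Let C := \matrix_(i, j) form (tnth eps i) (hb (tnth eps j)).

Let Ig := unitary_integer UQ Tg.
Let hg x : vge h x -> vge h (g * x). Proof. by move=> hx; apply/(unitary_val_geMl UQ). Qed.
Let ha t := lift_fix_Bs UQ h t.

Let e_at s t : e (at_ s) (g * at_ t) = Psi (R1 g * s * t).
Proof.
rewrite (pairing_res_char UQ WC)//; last exact: hg.
rewrite (sres1M UQ Ig (ha t)) !(sres0_lift_fix UQ) !(sres1_lift_fix UQ).
by rewrite mulr0 add0r mul0r subr0; congr Psi; ring.
Qed.

Let eps_at i : exists t, tnth eps i = rB (at_ t).
Proof. by apply/xs_at; apply: (basis_mem bX); exact: mem_tnth. Qed.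

(** For [s] and [t] fixed by [tau], [beta s (g t)] is half the trace of [u s g t], which is
    symmetric. *)
Lemma C_sym : C^T = C.
Proof.
apply/matrixP => i j; rewrite !mxE; have [s ->] := eps_at i; have [t ->] := eps_at j.
rewrite !barE// !formE//; try exact: hg.
congr red; rewrite /bn /beta.
have tat r : tau D (at_ r) = at_ r := tau_lift_fix UQ h r.
by rewrite !tat; congr (_ * (_ * field_trace _)); ring.
Qed.

Lemma C_form x y : (x *m C *m y^T) 0 0 = form (vec x) (hb (vec y)).
Proof.
have hbv : hb (vec y) = \sum_j y 0 j *: hb (tnth eps j).
  by rewrite /vec linear_sum; apply: eq_bigr => j _; rewrite linearZ.
have fr z : form z (hb (vec y)) = \sum_j y 0 j * form z (hb (tnth eps j)).
  rewrite hbv; have f0 : form z 0 = 0.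
    have := formR 1 0 0 z; rewrite scaler0 addr0 mul1r => /eqP.
    by rewrite -subr_eq0 opprD addNKr oppr_eq0 => /eqP.
  by elim/big_rec2: _ => [|i x1 x2 _ IH]; rewrite ?f0// formR IH.
rewrite form_sum -mulmxA mxE; apply: eq_bigr => i _; rewrite fr mxE; congr (_ * _).
by apply: eq_bigr => j _; rewrite !mxE mulrC.
Qed.

Lemma psib_C x y s t : vec x = rB (at_ s) -> vec y = rB (at_ t) ->
  psib ((x *m C *m y^T) 0 0) = Psi (R1 g * s * t).
Proof.
move=> xs_ yt; rewrite C_form xs_ yt barE// psib_form//; last exact: hg.
Qed.

(** A vector of the kernel corresponds to some [t] in [E] with [Psi (R1 g * t * s) = 1] for all [s];
    as [Psi] is non-trivial, [t = 0]. *)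
Lemma C_unit : C \in unitmx.
Proof.
have [tE [xE tK xK] tP] := row_param.
rewrite -row_free_unit -kermx_eq0; apply/eqP/row_matrixP => i0; rewrite row0.
have /sub_kermxP : (row i0 (kermx C) <= kermx C)%MS by exact: row_sub.
move: (row i0 _) => x xC.
have P1 s : Psi (R1 g * tE x * s) = 1.
  rewrite -(xK s) -(psib_C (tP x) (tP (xE s))) xC mul0mx mxE.
  exact: additive_char0 psibD psib_neq0.
have tx0 : tE x = 0.
  apply/eqP/negP => /negP tx; have [w /eqP] := res_char_nontrivial UQ WC; apply.
  by rewrite -(P1 (w / (R1 g * tE x))); congr Psi; field; rewrite g1 tx.
apply: vec_inj; rewrite tP tx0 /vec big1 => [|i _]; last by rewrite mxE scale0r.
apply/rB_eq0 => //; apply/(sres01_eq0 UQ) => //.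
by rewrite (sres0_lift_fix UQ) (sres1_lift_fix UQ).
Qed.

(** One and the same sum over [A / B] is a one-variable Gauss sum over [E] and the Gauss sum of the
    quadratic form [C] in [l] variables over [F]. *)
Lemma gauss_C : G (R1 g) * gauss psib 1 = gauss psib (\det C) * gauss psib 1 ^+ l.
Proof.
rewrite -(gauss_sum_form two_kappa psibD psib_neq0 psib_nontrivial C_sym C_unit); congr (_ * _).
have [tE tb tP] := row_param.
rewrite /gauss (reindex tE) /=; last by apply: onW_bij.
by apply: eq_bigr => x _; rewrite (psib_C (tP x) (tP x)) expr2 mulrA.
Qed.

Lemma theta_C : same_square_class (theta hb) (\det C).
Proof.
have tg := theta_generic (formL) (formR) (form_anti)
  (thetaP M) sb theta_tau (bar_symplectic Tg).
exact: (tg C_unit).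
Qed.

Lemma jdim_generic : jdim hb = l.
Proof.
rewrite /jdim dimbs addnn doubleK.
suff -> : (xs M :&: hb @: xs M = 0)%VS by rewrite dimv0 subn0.
apply/eqP; rewrite -subv0; apply/subvP => y; rewrite memv_cap memv0 => /andP[/xs_at[s ->]].
case/memv_imgP => z /xs_at[t ->]; rewrite barE// => /rB_eq.
move=> /(_ (ha s) (hg (ha t))) hst; have hN := val_geN vP (hg (ha t)).
have [e0 e1] := (sres01_eq0 UQ (val_geD vP (ha s) hN)).2 hst.
move: e1; rewrite (sres1D UQ (ha s) hN) (sres1N UQ (hg (ha t))) (sres1M UQ Ig (ha t))
  !(sres0_lift_fix UQ, sres1_lift_fix UQ).
rewrite mulr0 !add0r => /eqP; rewrite oppr_eq0 mulf_eq0 (negbTE g1) => /eqP t0.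
move: e0; rewrite (sres0D UQ (ha s) hN) (sres0N UQ (hg (ha t))) (sres0M UQ Ig (ha t))
  !(sres0_lift_fix UQ, sres1_lift_fix UQ).
rewrite t0 !mulr0 addr0 subr0 => s0.
by apply/eqP/rB_eq0 => //; apply/(sres01_eq0 UQ) => //;
  rewrite s0 (sres0_lift_fix UQ) (sres1_lift_fix UQ).
Qed.

End Generic.

Lemma sqrtq_sqr : sqrtq D ^+ 2 = #|F|%:R.
Proof.
rewrite /sqrtq -rmorphXn /= sqr_sqrtr ?ler0n//.
by rewrite -(rmorph_nat (real_complex R)).
Qed.
Lemma sqrtq_neq0 : sqrtq D != 0.
Proof. by rewrite -sqrf_eq0 sqrtq_sqr; exact: card_field_neq0. Qed.

Lemma omegaE (a : F) : omega a = (sqrtq D)^-1 * gauss psib a.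
Proof. by rewrite /omega /gauss; congr (_ * _); apply: eq_bigr => t _;
  rewrite /psib -(mulrA _ a). Qed.

Lemma omega_class (a c : F) : same_square_class a c -> omega a = omega c.
Proof. by move=> [d d0 ->]; rewrite !omegaE gauss_sqr. Qed.

(** With [theta = det C] and [j = l], [gauss_C] absorbs the Gauss sums over [F], and the powers of
    [sqrtq] cancel because [#|E| = #|F|^l]. *)
Lemma const_generic g : T g -> R1 g != 0 ->
  weil_m (bar M (amull g)) * sqrtq D ^+ jdim (bar M (amull g)) * #|E|%:R^-1 = (G (R1 g))^-1.
Proof.
move=> Tg g1; rewrite /weil_m (omega_class (theta_C Tg g1)) (jdim_generic Tg g1) !omegaE.
have key := gauss_C Tg g1.
set d := \det _ in key *.
have d0 : d != 0 by have := C_unit Tg g1; rewrite unitmxE unitfE.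
have Gd := gauss_neq0 two_kappa psibD psib_neq0 psib_nontrivial d0.
have G1 := gauss_neq0 two_kappa psibD psib_neq0 psib_nontrivial (oner_neq0 F).
have sq0 := sqrtq_neq0.
have GE : G (R1 g) = gauss psib d * gauss psib 1 ^+ l / gauss psib 1 by rewrite -key mulfK.
rewrite GE card_residue natrX -sqrtq_sqr.
have -> : ((sqrtq D)^-1 * gauss psib 1) ^ (1 - l%:Z) =
    ((sqrtq D)^-1 * gauss psib 1) * ((sqrtq D)^-1 * gauss psib 1) ^- l.
  by rewrite expfzDr ?mulf_neq0 ?invr_eq0// -exprnN.
rewrite exprMn exprVn -exprM mulnC exprM.
have := expf_neq0 l G1; have := expf_neq0 l sq0.
move: (sqrtq D ^+ l) (gauss psib 1 ^+ l) => A B A0 B0.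
by field; rewrite A0 B0 Gd G1 sq0.
Qed.

Lemma jdim_parabolic (f : 'End(bs M)) : (f @: xs M)%VS = xs M -> jdim f = 0%N.
Proof. by move=> fX; rewrite /jdim fX capvv dimX dimbs addnn doubleK subnn. Qed.

Lemma weil_m_parabolic (f : 'End(bs M)) : parabolic form (xs M) f ->
  weil_m f = (omega (det_on (xs M) f))^-1 * omega (1 : F).
Proof.
move=> fp; rewrite /weil_m (omega_class (theta_parabolic (thetaP M) fp)).
by rewrite (jdim_parabolic fp.2) subr0 expr1z.
Qed.

Lemma bar_scalar g (a : F) : T g -> (forall y, bar M (amull g) y = a *: y) -> a != 0 ->
  parabolic form (xs M) (bar M (amull g)) /\ det_on (xs M) (bar M (amull g)) = a ^+ l.
Proof.
move=> Tg bE a0; split.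
  split; first exact: bar_symplectic.
  apply/eqP; rewrite eqEsubv; apply/andP; split; apply/subvP => y.
    by case/memv_imgP => z zX ->; rewrite bE rpredZ.
  move=> yX; apply/memv_imgP; exists (a^-1 *: y); first by rewrite rpredZ.
  by rewrite bE scalerA divff// scale1r.
rewrite (det_on_basis (N := a%:M) bX) ?det_scalar// => i.
rewrite bE (bigD1 i) //= mxE eqxx mulr1n big1 ?addr0// => j ji.
by rewrite mxE eq_sym (negbTE ji) scale0r.
Qed.

Lemma bar_pm g : T g -> R1 g = 0 -> forall y, bar M (amull g) y =
  (if R0 g == 1 then 1 else -1) *: y.
Proof.
move=> Tg g1 y; have [x hx <-] := rB_surj y; rewrite barE//.
have Ig := unitary_integer UQ Tg; have hgx : vge h (g * x) by apply/(unitary_val_geMl UQ).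
case: eqVneq => [g0|g0].
  rewrite scale1r; apply/rB_eq => //; apply: (Bs_sres_eq UQ) => //.
    by rewrite (sres0M UQ)// g0 g1 mul1r mulr0 mul0r addr0.
  by rewrite (sres1M UQ)// g0 g1 mul1r mul0r addr0.
have g0' : R0 g = -1 by case: (res1_eq0 UQ Tg g1) => // g01; rewrite g01 eqxx in g0.
have hN := val_geN vP hx.
rewrite scaleN1r -rBN//; apply/rB_eq => //; apply: (Bs_sres_eq UQ) => //.
  by rewrite (sres0M UQ)// (sres0N UQ)// g0' g1 mulN1r mulr0 mul0r addr0.
by rewrite (sres1M UQ)// (sres1N UQ)// g0' g1 mulN1r mul0r addr0.
Qed.

Lemma T_generic : exists2 g, T g & R1 g != 0.
Proof.
have O1 := fixed_integer1 UQ; exists (cayley nu 1); first exact: (cayley_unitary UQ).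
have [_ t1] := cayley_coord UQ O1; have [n1 v1] := cayley_unit UQ O1.
apply/eqP => /(red_eq0 UQ)-/(_ (fixed_integer_qcoord1 UQ (unitary_integer UQ (cayley_unitary UQ
  O1)))).
rewrite t1 mulr1 => -[/eqP|].
  by rewrite mulf_eq0 invr_eq0 (negbTE two_L) (negbTE n1).
by rewrite (Defs.valM vP) ?invr_eq0 ?two_L// (val_inv vP)// v1 Lval_two.
Qed.

(** Obtained by comparing [gauss_C] at [g] and at [g^-1]: inversion changes the sign of [R1 g] and,
    [C] being symmetric and [bar] symplectic, turns [C] into [- C]. *)
Lemma eta_minus_one : eta (-1) = etaF ((-1) ^+ l).
Proof.
have [g Tg g1] := T_generic; have TgV := unitaryV UQ Tg.
have g1' : R1 g^-1 != 0 by rewrite (res1V UQ)// oppr_eq0.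
have k1 := gauss_C Tg g1; have k2 := gauss_C TgV g1'.
set C1 := \matrix_(i, j) _ in k1; set C2 := \matrix_(i, j) _ in k2.
have CC : C2 = -1 *: C1.
  have C1s : C1^T = C1 := C_sym Tg; rewrite -C1s; apply/matrixP => i j; rewrite !mxE mulN1r.
  rewrite -[LHS](bar_symplectic Tg) -form_anti; congr form.
  have [x hx <-] := rB_surj (tnth eps j).
  have hgx : vge h (g^-1 * x) by apply/(unitary_val_geMl UQ _ _ TgV).
  by rewrite !barE// mulVKf// (unitary_neq0 Tg).
have d0 : \det C1 != 0 by have := C_unit Tg g1; rewrite unitmxE unitfE.
have gE' := gaussE (E_two UQ) (res_charD UQ WC) (res_char_neq0 UQ WC) (res_char_nontrivial UQ WC).
have gF := gaussE two_kappa psibD psib_neq0 psib_nontrivial.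
have N1n0 : (-1 : F) ^+ l != 0 by rewrite expf_neq0// oppr_eq0 oner_eq0.
have N1E : (-1 : E) != 0 by rewrite oppr_eq0 oner_eq0.
move: k2; rewrite CC detZ (res1V UQ Tg) (gF _ (mulf_neq0 N1n0 d0)) (quadratic_charM R two_kappa).
have -> : G (- R1 g) = eta (-1) * G (R1 g).
  rewrite -[- R1 g]mulN1r (gE' _ (mulf_neq0 N1E g1)) (gE' _ g1) (quadratic_charM R (E_two UQ));
    ring.
rewrite -mulrA k1 (gF _ d0) => /eqP; rewrite -subr_eq0.
have -> : eta (-1) * (etaF (\det C1) * gauss psib 1 * gauss psib 1 ^+ l) -
  etaF ((-1) ^+ l) * etaF (\det C1) * gauss psib 1 * gauss psib 1 ^+ l =
  (eta (-1) - etaF ((-1) ^+ l)) * (etaF (\det C1) * gauss psib 1 * gauss psib 1 ^+ l) by ring.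
have G1 := gauss_neq0 two_kappa psibD psib_neq0 psib_nontrivial (oner_neq0 F).
rewrite mulf_eq0 => /orP[|]; first by rewrite subr_eq0 => /eqP.
by rewrite !mulf_eq0 expf_eq0 (negbTE G1) andbF !orbF (negbTE (quadratic_char_neq0 R d0)).
Qed.

(** Such a [g] acts on [B* / B] by a sign [s], with determinant [s ^+ l] on [A / B]; [eta_minus_one]
    moves its quadratic symbol from [F] to [E]. *)
Lemma const_parabolic g : T g -> R1 g = 0 ->
  weil_m (bar M (amull g)) * sqrtq D ^+ jdim (bar M (amull g)) = if R0 g == 1 then 1 else eta (-1).
Proof.
move=> Tg g1; set s : F := if R0 g == 1 then 1 else -1.
have s0 : s != 0 by rewrite /s; case: ifP => _; rewrite ?oppr_eq0 oner_eq0.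
have [bp dE] := bar_scalar Tg (bar_pm Tg g1) s0.
rewrite (jdim_parabolic bp.2) expr0 mulr1 weil_m_parabolic// dE !omegaE.
have gF := gaussE two_kappa psibD psib_neq0 psib_nontrivial (expf_neq0 l s0).
have G1 := gauss_neq0 two_kappa psibD psib_neq0 psib_nontrivial (oner_neq0 F).
have sq0 := sqrtq_neq0.
rewrite -/s gF.
have -> : ((sqrtq D)^-1 * (etaF (s ^+ l) * gauss psib 1))^-1 * ((sqrtq D)^-1 * gauss psib 1) =
   (etaF (s ^+ l))^-1.
  have e0 := quadratic_char_neq0 R (expf_neq0 l s0).
  by field; rewrite e0 G1 sq0.
rewrite /s; case: ifP => _; first by rewrite expr1n -(expr1n F 2) quadratic_char_sqr ?oner_eq0//
  invr1.
rewrite -eta_minus_one; have n0 : (-1 : E) != 0 by rewrite oppr_eq0 oner_eq0.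
apply: (mulfI (quadratic_char_neq0 R n0)).
by rewrite divff ?quadratic_char_neq0// -expr2 quadratic_char_expr2.
Qed.

Lemma amull_inv (g x : L) : g != 0 -> ((amull g)^-1)%VF x = g^-1 * x.
Proof.
move=> g0; have k0 : lker (amull g) == 0%VS.
  rewrite -subv0; apply/subvP => y; rewrite memv_ker lfunE /= memv0.
  by rewrite mulf_eq0 (negbTE g0).
rewrite -{1}(mulVKf g0 x) (_ : g * (g^-1 * x) = amull g (g^-1 * x)); last by rewrite lfunE.
by rewrite lker0_lfunK.
Qed.

Lemma weil_weilS_basis g phi0 w : T g -> Mod phi0 -> weil M (amull g) phi0 w = weilSD g phi0 w.
Proof.
move=> Tg Mphi; have Ig := unitary_integer UQ Tg; have g0 := unitary_neq0 Tg.
rewrite /weil; set Q := add_cosets _ _.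
have sumE : \sum_(c \in Q) (let a := xget 0 c in psi (2%:R^-1 * beta a w) *
    phi0 ((amull g)^-1%VF (a + w))) = \sum_(c \in Q) weil_term ta XiD_ g phi0 w (xget 0 c).
  by apply: eq_fsbigr => c _ /=; rewrite /weil_term beta_XiD amull_inv.
rewrite sumE.
have imE : [set amull g x | x in latA D] = [set x | lA (g^-1 * x)].
  rewrite latA_val; apply/seteqP; split=> [_ [x Ax <-]|x Ax] /=.
    by rewrite lfunE /= mulKf.
  by exists (g^-1 * x) => //; rewrite lfunE /= mulVKf.
(* If [g A = A], the quotient is a single class, whereas [weilS] averages [#|E|] equal terms. *)
have [g1|g1] := eqVneq (R1 g) 0.
  have AgA x : lA x -> lA (g^-1 * x).
    by move=> Ax; apply: (latticeA_unitary UQ) => //;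
      [exact: (unitaryV UQ)|rewrite (res1V UQ)// g1 oppr0].
  have QE : Q = [set latA D].
    rewrite /Q imE latA_val.
    have cosA m : lA m -> [set m + n | n in lA `&` [set x | lA (g^-1 * x)]] = lA.
      move=> Am; apply/seteqP; split=> [_ [n [An _] <-]|x Ax]; first exact: (latticeAD UQ).
      exists (x - m); last by rewrite addrC subrK.
      have Axm : lA (x - m) by apply: (latticeAD UQ) => //; exact: (latticeAN UQ).
      by split=> //; exact: AgA.
    apply/seteqP; split=> [_ [m Am <-]|_ ->]; first exact: cosA.
    by exists 0; [exact: (latticeA0 UQ)|apply: cosA; exact: (latticeA0 UQ)].
  rewrite QE fsbig_set1 fset_set1 cardfs1 invr1 mulr1 const_parabolic//.
  have Ax : lA (xget 0 (latA D)).
    by rewrite latA_val; apply: (@xgetPex _ 0 lA); exists 0; exact: (latticeA0 UQ).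
  rewrite -[xget 0 _]add0r (weil_term_shift UQ WC)//; last 2 first.
  - exact: AgA.
  - by rewrite /pairing rmorph0 mul0r (Xi0 WC).
  rewrite /weil_term add0r /pairing rmorph0 mul0r (Xi0 WC) mul1r.
  rewrite /weilS (weil_sum_parabolic UQ WC _ Tg Mphi g1) /weil_const g1 eqxx /=.
  have q0 := card_field_neq0 R E.
  by case: ifP => _; rewrite ?mul1r ?mulKf// mulrA divfK.
(* For generic [g] the intersection is [B], and the classes are represented by the [lift_fix t]. *)
have capE : latA D `&` [set amull g x | x in latA D] = vge (h + 1).
  rewrite imE latA_val; apply/seteqP; split=> x.
    move=> [Ax Agx]; have hx := latticeA_Bs UQ Ax; have hgx := latticeA_Bs UQ Agx.
    have x1 := (latticeAE UQ hx).1 Ax; apply/(sres01_eq0 UQ) => //; split=> //.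
    have := (latticeAE UQ hgx).1 Agx; rewrite (sres1M UQ)//;
      last exact: (unitary_integer UQ (unitaryV UQ Tg)).
    rewrite x1 mulr0 add0r (res1V UQ)// => /eqP; rewrite mulf_eq0 oppr_eq0 (negbTE g1).
    by move/eqP.
  move=> hx; split; first exact: (B_latticeA UQ).
  by apply: (B_latticeA UQ); apply/(unitary_val_geMl UQ _ _ (unitaryV UQ Tg)).
pose cos t : set L := [set at_ t + n | n in vge (h + 1)].
have cosb : set_bij [set` enum E] Q cos.
  split.
  - by move=> t _; exists (at_ t); rewrite ?capE// latA_val; exact: (lift_fix_latticeA UQ).
  - move=> s t _ _ st; apply: (rB_at_inj); apply/rB_eq; try exact: (lift_fix_Bs UQ).
    have [n hn <-] : cos t (at_ s) by rewrite -st; exists 0; [left|rewrite addr0].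
    by rewrite addrAC subrr add0r.
  - move=> _ [a Aa <-]; rewrite latA_val in Aa; have hA := latticeA_Bs UQ Aa.
    exists (r0 a); first by rewrite /= mem_enum.
    have hd : vge (h + 1) (a - at_ (r0 a)).
      apply: (Bs_sres_eq UQ) => //; rewrite ?(sres0_lift_fix UQ) ?(sres1_lift_fix UQ)//;
        first exact: (lift_fix_Bs UQ).
      exact/(latticeAE UQ).
    rewrite capE; apply/seteqP; split=> _ [n hn <-].
      exists (n - (a - at_ (r0 a))); first exact: (val_geB vP).
      by ring.
    exists (n + (a - at_ (r0 a))); first exact: (val_geD vP).
    by ring.
have Qcard : #|` fset_set Q|%:R = #|E|%:R :> R[i].
  have Qf : finite_set Q.
    have := cosb; move=> [_ _ cs]; apply: sub_finite_set cs _.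
    by apply: finite_image; exact: finite_seq.
  have -> : #|` fset_set Q|%:R = \sum_(c \in Q) (1 : R[i]).
    by rewrite fsbig_finite// big_const_seq count_predT iter_addr_0 cardfE.
  rewrite (reindex_fsbig cos [set` enum E] Q)// -fsbig_seq ?enum_uniq//.
  by rewrite big_const_seq count_predT iter_addr_0 -cardE.
rewrite Qcard const_generic// /weilS /weil_const g1; congr (_ * _).
rewrite (reindex_fsbig cos [set` enum E] Q)// -fsbig_seq ?enum_uniq// big_enum.
apply: eq_bigr => t _.
have [n hn <-] : cos t (xget 0 (cos t)).
  by apply: (@xgetPex _ 0 (cos t)); exists (at_ t); exists 0; [left|rewrite addr0].
rewrite (weil_term_shift UQ WC)//.
  by apply: (B_latticeA UQ); apply/(unitary_val_geMl UQ _ _ (unitaryV UQ Tg)).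
by apply: (pairing_val UQ WC (lift_fix_Bs UQ h t) hn); lia.
Qed.

End Basis.

(** * Transfer of the weight spaces to the setting *)

Lemma weil_weilS g phi0 w : T g -> Mod phi0 -> weil M (amull g) phi0 w = weilSD g phi0 w.
Proof.
move=> Tg Mphi; have [l [eps [phi [sb th]]]] := theta_tau_S (thetaP M).
exact: (weil_weilS_basis sb th).
Qed.

Lemma lattice_model_Mod phi : lattice_model phi -> Mod phi.
Proof. by move=> [h1 _] a w Aa; rewrite h1 ?latA_val// beta_XiD. Qed.

(** Square-summability is automatic: a ball [val_ge n] meets only finitely many classes modulo [A],
    and all others contribute zero. *)
Lemma Mod_lattice_model phi n : Mod phi -> supported n phi -> lattice_model phi.
Proof.
move=> Mphi sphi; split=> [a w|].
  by rewrite latA_val => Aa; rewrite Mphi// beta_XiD.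
set S := add_cosets _ _.
pose a (c : set L) : \bar R := ((ComplexField.Normc.normc (phi (xget 0 c))) ^+ 2)%:E.
change (\esum_(c in S) a c < +oo)%E.
pose cos (m : L) : set L := [set m + x | x in latA D].
pose Q : set (set L) := [set cos m | m in vge n].
have Qf : finite_set Q.
  apply: (finite_cosets UQ (M := vge n) (m := n) (n := h + 1)) => // g g' _ _ hgg.
  have Agg := B_latticeA UQ hgg.
  rewrite /cos latA_val; apply/seteqP; split=> _ [x Ax <-].
    by exists (x + (g - g')); [exact: (latticeAD UQ)|ring].
  exists (x - (g - g')); [|by ring].
  by apply: (latticeAD UQ) => //; exact: (latticeAN UQ).
have a_ge0 c : (0 <= a c)%E by rewrite lee_fin sqr_ge0.
have out0 : \esum_(c in S `&` ~` Q) a c = 0%E.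
  apply: esum1 => c [[m _ <-] nQ].
  have [phi0|phi0] := eqVneq (phi (xget 0 (cos m))) 0.
    by rewrite /a phi0 ComplexField.Normc.normc0 expr0n.
  have [x Ax xE] : cos m (xget 0 (cos m)).
    by apply: (@xgetPex _ 0 (cos m)); exists (m + 0), 0 => //; rewrite latA_val;
      exact: (latticeA0 UQ).
  case: nQ; exists (xget 0 (cos m)); first exact: sphi.
  rewrite -xE /cos latA_val; rewrite latA_val in Ax; apply/seteqP; split=> _ [y Ay <-].
    by exists (x + y); [exact: (latticeAD UQ)|rewrite addrA].
  by exists (y - x); [apply: (latticeAD UQ) => //; exact: (latticeAN UQ)|ring].
rewrite (esumID Q)// out0.
have fQ : finite_set (S `&` Q) by apply: sub_finite_set Qf; exact: subIsetr.
rewrite adde0 esum_fset// fsbig_finite//=.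
by rewrite sumEFin ltry.
Qed.

Lemma weight_vector_weight chi phi : weight_vector M chi phi -> weight chi phi.
Proof.
move=> [/lattice_model_Mod Mphi eqphi]; split=> // g Tg w.
by rewrite -weil_weilS// eqphi.
Qed.

Lemma weight_weight_vector chi phi n : weight chi phi -> supported n phi -> weight_vector M chi phi.
Proof.
move=> [Mphi eqphi] sphi; split; first exact: Mod_lattice_model Mphi sphi.
by move=> g Tg w; rewrite weil_weilS// eqphi.
Qed.

Lemma delta_funE x : delta_fun x = delta x.
Proof.
apply/funext => w; rewrite /delta_fun /delta_at latA_val beta_XiD; by [].
Qed.

Lemma phi_chiE chi j x w : phi_chi M chi j x w = phiS chi j x w.
Proof.
rewrite /phi_chi /avg_delta torus_filtrationE; apply: eq_fsbigr => c /set_mem cQ /=.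
have [Tg _] := ucosets_xget UQ cQ.
rewrite delta_funE weil_weilS//.
exact: (quasi_inv_delta UQ WC).
Qed.

Lemma conductor_conduct chi c : conductor chi c -> conduct chi c.
Proof.
move=> [h1 h2]; split=> [t Tt|j hj]; first by apply: h1; rewrite torus_filtrationE.
by apply: h2 => t; rewrite torus_filtrationE; exact: hj.
Qed.

(** [eta0] picks some [z]; [sign_charE] gives the same value for every admissible one. *)
Lemma eta0E g : T g -> eta0 g = sign_char R ta (@red' R D) g.
Proof.
move=> Tg; have [z [z0 vz gz]] := unitary_hilbert90 UQ Tg.
rewrite /eta0; set y := xget 1 _.
have [[/eqP y0 vy] gy] : integer_units v y /\ g = y * ta y^-1.
  apply: (@xgetPex _ 1 [set z | integer_units v z /\ g = z * ta z^-1]).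
  by exists z; split=> //; split=> //; exact/eqP.
exact: (sign_charE R UQ Tg y0 vy gy).
Qed.

Lemma weight_scale chi phi c : weight chi phi -> weight chi (fun w => c * phi w).
Proof.
move=> [Mphi eqphi]; split=> [a w Aa|g Tg w]; first by rewrite Mphi//; ring.
by rewrite (weilS_scale UQ) eqphi//; ring.
Qed.

Lemma spanned chi phi0 n : weight chi phi0 -> supported n phi0 ->
  (forall phi, weight chi phi -> exists c, forall w, phi w = c * phi0 w) ->
  weight_space_spanned_by M chi phi0.
Proof.
move=> w0 s0 span phi; split=> [/weight_vector_weight/span//|[c phiE]].
have -> : phi = fun w => c * phi0 w by apply/funext.
apply: (@weight_weight_vector _ _ n); first exact: weight_scale.
by move=> w; rewrite mulf_eq0 negb_or => /andP[_ /s0].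
Qed.

Lemma occursP chi phi0 n w : weight chi phi0 -> supported n phi0 -> phi0 w <> 0 -> occurs M chi.
Proof. by move=> w0 s0 hw; exists phi0; split; [exact: weight_weight_vector w0 s0|exists w]. Qed.

Lemma tame_part (chi : L -> R[i]) (c : nat) :
  torus_character chi -> conductor chi c -> (c <= 1)%N ->
  (occurs M chi <-> exists2 g, torus D g & chi g <> eta0 g) /\
  ((exists2 g, torus D g & chi g <> eta0 g) ->
   exists x : L, [/\ latBs D x, exists w, phi_chi M chi 1 x w <> 0 &
       weight_space_spanned_by M chi (phi_chi M chi 1 x)]).
Proof.
move=> [chiM chi0 _] /conductor_conduct cP c1.
have chiT t : Tf 1 t -> chi t = 1 by move=> Tt; apply: cP.1; apply: ulevel_le c1 Tt.
(* The other alternative of [weight_support] has conductor [2 j + 1 > 1]. *)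
have sup phi : weight chi phi -> supported h phi.
  move=> wphi w /eqP w0; have [[//]|[j [j0 cE _ _ _]]] := weight_support WC wphi cP w0.
  by move: c1; rewrite cE; lia.
have part2 : (exists2 g, torus D g & chi g <> eta0 g) -> exists z,
    let x := bt_ z in (exists w, phiS chi 1 x w <> 0) /\
    weight_space_spanned_by M chi (phiS chi 1 x).
  move=> [g Tg ng].
  have [|z [nz span]] := weight_unramified UQ WC chiM chi0 chiT.
    by exists g => //; rewrite -eta0E.
  exists z; split=> //; apply: (@spanned _ _ h).
  - exact: (weight_avg_delta_unramified UQ WC chiM chi0 chiT).
  - exact: avg_delta_unramified_supported.
  - by move=> phi wphi; apply: span => //; exact: sup.
split; first split.
- move=> [phi [/weight_vector_weight wphi [w w0]]]; apply: contrapT => ng; apply: w0.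
  apply: (weight_unramified_eta0 WC chiM chi0 chiT _ wphi (sup _ wphi)) => g Tg.
  by rewrite -eta0E//; apply: contrapT => hg; apply: ng; exists g.
- move=> /part2[z [[w hw] sp]]; exists (phiS chi 1 (bt_ z)); split; last by exists w.
  by apply/sp; exists 1 => w'; rewrite mul1r.
move=> /part2[z [nz sp]]; exists (bt_ z).
have -> : phi_chi M chi 1 (bt_ z) = phiS chi 1 (bt_ z).
  by apply/funext => w; exact: phi_chiE.
by split=> //; rewrite latBs_val; exact: (lift_anti_Bs UQ).
Qed.

Lemma wild_occurs (chi : L -> R[i]) (c : nat) :
  torus_character chi -> conductor chi c -> (1 < c)%N -> (occurs M chi <-> odd c).
Proof.
move=> [chiM chi0 _] /conductor_conduct cP c1; split.
  move=> [phi [/weight_vector_weight wphi [w w0]]].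
  have [[_]|[j [_ -> _ _ _]]] := weight_support WC wphi cP w0; first by rewrite leqNgt c1.
  by rewrite oddD oddM.
move=> oc; pose j := c./2; have cE : c = (2 * j + 1)%N by rewrite /j; lia.
have j0 : (0 < j)%N by rewrite /j; lia.
move: j0 cE; move: {c1 oc} j => j j0 cE; rewrite {c}cE in cP.
have [a [a0 va R0a chiE]] := char_vector UQ WC chiM chi0 cP j0.
apply: (@occursP _ _ _ (pi ^ (h - j%:Z) * a)).
- exact: (weight_avg_delta_ramified UQ WC chiM chi0 j0 a0 va R0a chiE).
- exact: (avg_delta_ramified_supported j0 a0 va R0a).
- by rewrite (avg_delta_ramified_x0 UQ WC chiM chi0 j0 a0 va R0a chiE); exact/eqP/oner_neq0.
Qed.

Lemma wild_span (chi : L -> R[i]) (j : nat) :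
  torus_character chi -> conductor chi (2 * j + 1)%N -> (1 < 2 * j + 1)%N ->
  exists a : L,
    [/\ integer_units v a,
        ~ [set pi * x + y * nu | x in sub_integers v K & y in sub_integers v K] a,
        forall t, torus_filtration D j.+1 t ->
          chi t = psi (- (4%:R^-1 *
            field_trace (pi ^ (mu D - (2 * j + 1)%N%:Z) * a * tau D a * u * t))) &
        weight_space_spanned_by M chi
          (phi_chi M chi j.+1 (pi ^ (((mu D - 1) %/ 2)%Z - j%:Z) * a))].
Proof.
move=> [chiM chi0 _] /conductor_conduct cP c1.
have j0 : (0 < j)%N by lia.
have [a [a0 va R0a chiE]] := char_vector UQ WC chiM chi0 cP j0.
have [pi0 tau_pi v_pi] := uq_pi UQ.
exists a; split.
- by split=> //; exact/eqP.
(* On [pi O' + O' nu] the first coordinate is divisible by [pi], against [res0 a != 0]. *)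
- rewrite sub_integersE => -[x [tx x_int] [y [ty _] aE]].
  have tpx : ta (pi * x) = pi * x by rewrite rmorphM /= tau_pi tx.
  have px1 : vge 1 (pi * x) by rewrite -[1]addr0; apply: val_geM => //; right; rewrite v_pi.
  case/eqP: R0a; rewrite /res0 -aE (coord_eq UQ tpx ty).1.
  by apply/(red_eq0 UQ); first split=> //; first exact: val_geW px1.
- move=> t; rewrite torus_filtrationE => /chiE ->.
  rewrite /XiD_ mulrN field_traceN mulrN; congr (psi (- (_ * field_trace _))).
  have -> : mu D - (2 * j + 1)%N%:Z = 2 * h - 2 * j%:Z by rewrite muE; lia.
  rewrite /tauf mulrC -!mulrA; do 3 congr (_ * _); exact: mulrC.
have -> : phi_chi M chi j.+1 (pi ^ (((mu D - 1) %/ 2)%Z - j%:Z) * a) =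
          phiS chi j.+1 (pi ^ (h - j%:Z) * a).
  by apply/funext => w; exact: phi_chiE.
apply: spanned.
- exact: (weight_avg_delta_ramified UQ WC chiM chi0 j0 a0 va R0a chiE).
- exact: (avg_delta_ramified_supported j0 a0 va R0a).
move=> phi wphi; exists (phi (pi ^ (h - j%:Z) * a)) => w.
exact: (weight_ramified WC chiM chi0 cP j0 a0 va R0a chiE).
Qed.

End Setting.

Theorem mainTheorem15 (R : realType) (D : torus_setting R)
    (M : reduction_data D) (mu_odd : ~~ (2 %| mu D)%Z) :
  (forall (chi : Lfield D -> R[i]) (c : nat),
     torus_character chi -> conductor chi c -> (c <= 1)%N ->
     (occurs M chi <-> exists2 g, torus D g & chi g <> eta0 g) /\
     ((exists2 g, torus D g & chi g <> eta0 g) ->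
      exists x : Lfield D,
        [/\ latBs D x,
            exists w, phi_chi M chi 1 x w <> 0 &
            weight_space_spanned_by M chi (phi_chi M chi 1 x)])) /\
  (forall (chi : Lfield D -> R[i]) (c : nat),
     torus_character chi -> conductor chi c -> (1 < c)%N ->
     (occurs M chi <-> odd c)) /\
  (forall (chi : Lfield D -> R[i]) (j : nat),
     torus_character chi -> conductor chi (2 * j + 1)%N ->
     (1 < 2 * j + 1)%N ->
     exists a : Lfield D,
       [/\ integer_units (Lval D) a,
           ~ [set varpi' D * x + y * nu D |
                x in sub_integers (Lval D) (Kfield D) &
                y in sub_integers (Lval D) (Kfield D)] a,
           forall t, torus_filtration D j.+1 t ->
             chi t = psi (- (4%:R^-1 *
               field_trace (varpi' D ^ (mu D - (2 * j + 1)%N%:Z) *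
                            a * tau D a * uelt D * t))) &
           weight_space_spanned_by M chi
             (phi_chi M chi j.+1
                (varpi' D ^ (((mu D - 1) %/ 2)%Z - j%:Z) * a))]).
Proof.
split=> [chi c chiT cP c1|]; first exact: (tame_part mu_odd M chiT cP c1).
split=> [chi c chiT cP c1|chi j chiT cP j1].
  exact: (wild_occurs mu_odd M chiT cP c1).
exact: (wild_span mu_odd M chiT cP j1).
Qed.
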